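(* Let $f\in L_2(\Omega)$ be given and assume that there are $C_{\mathrm{PF}}>0$ and $c_{\mathrm{is}}>0$ such that \[ \|v\|\le C_{\mathrm{PF}}\|Av\|\quad\forall v\in H_0(A),\qquad \sup_{w\in H(A^* ),\ \|w\|_{A^*}=1}(A^*w,v)\ge c_{\mathrm{is}}\|v\|\quad\forall v\in L_2(\Omega). \] Consider the generalized mixed hybrid formulation: find $w\in\widetilde H(A^*,\mathcal T)$, $u\in L_2(\Omega)$, and $\phi\in H_0(A,\mathcal S)$ such that \[ (\mathcal C^{-1}w,\delta w)-(u,A^*\delta w)_{\mathcal T}-\langle\phi,\delta w\rangle_{\mathcal S}=0\quad\forall\delta w\in\widetilde H(A^*,\mathcal T), \] \[ -(A^*w,\delta u)_{\mathcal T}-\langle\delta\phi,w\rangle_{\mathcal S}=-(f,\delta u)\quad\forall\delta u\in L_2(\Omega),\ \forall\delta\phi\in H_0(A,\mathcal S). \] This problem is well posed (it has exactly one solution, depending continuously on $f$). Its solution $(w,u,\phi)$ satisfies \[ \|w\|_{A^*,\mathcal T}+\|u\|+\|\phi\|_{A,\mathcal S}\le C\|f\| \] with a constant $C$ that is independent of $f$ and $\mathcal T$. Furthermore, $u\in H_0(A)$, $w=\mathcal C Au\in H(A^* )$, $\phi=\gamma_{A,\mathcal S}(u)$, and $u$ solves $A^*\mathcal C Au=f$.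
   Context: Setting. $\Omega\subset\mathbb R^d$ ($d\in\mathbb N$) is a bounded Lipschitz domain and $U\in\{\mathbb R,\mathbb R^d,\mathbb R^{d\times d}\}$ or $U=\mathbb S:=\{w\in\mathbb R^{d\times d}: w=w^\top\}$. $A$ is a linear differential operator with constant coefficients taking scalar functions to $U$-valued functions, and $A^*$ is its formal adjoint (taking $U$-valued functions to scalar functions); both are applied in the distributional sense. $(\cdot,\cdot)$ and $\|\cdot\|$ are the $L_2(\Omega)$ inner product and norm (for scalar or $U$-valued functions). Set $H(A)=\{v\in L_2(\Omega): Av\in L_2(\Omega;U)\}$ with $\|v\|_A^2=\|v\|^2+\|Av\|^2$, and $H(A^* )=\{w\in L_2(\Omega;U): A^*w\in L_2(\Omega)\}$ with $\|w\|_{A^*}^2=\|w\|^2+\|A^*w\|^2$. The trace operator $\gamma_{A,\Gamma}:H(A)\to H(A^* )^*$ is $\langle\gamma_{A,\Gamma}(v),w\rangle_\Gamma:=(Av,w)-(v,A^*w)$, and $H_0(A):=\{v\in H(A):\gamma_{A,\Gamma}(v)=0\}$. $\mathcal C\in L_\infty(\Omega;U\times U)$ is a symmetric, (uniformly) positive definite tensor field, acting pointwise as a linear map $U\to U$, with pointwise inverse $\mathcal C^{-1}$. $\mathcal T=\{T\}$ is a regular mesh of polyhedral elements covering $\Omega$, with skeleton $\mathcal S=\bigcup\{\partial T: T\in\mathcal T\}$. $(\cdot,\cdot)_{\mathcal T}$ is the sum over $T\in\mathcal T$ of the $L_2(T)$ inner products, differential operators inside it being taken elementwise, and $\|\cdot\|_{\mathcal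 T}^2=(\cdot,\cdot)_{\mathcal T}$. Set $H(A^*,\mathcal T)=\{w\in L_2(\Omega;U): A^*(w|_T)\in L_2(T)\ \forall T\in\mathcal T\}$ with $\|w\|_{A^*,\mathcal T}^2=\|w\|^2+\|A^*w\|_{\mathcal T}^2$. $\widetilde H(A^*,\mathcal T)$ is a given closed subspace of $H(A^*,\mathcal T)$ with $H(A^* )\subset\widetilde H(A^*,\mathcal T)\subset H(A^*,\mathcal T)$. Trace operator: $\gamma_{A,\mathcal S}:H(A)\to\widetilde H(A^*,\mathcal T)^*$, $\langle\gamma_{A,\mathcal S}(v),w\rangle_{\mathcal S}:=(Av,w)-(v,A^*w)_{\mathcal T}$. Trace spaces: $H(A,\mathcal S):=\gamma_{A,\mathcal S}(H(A))$ and $H_0(A,\mathcal S):=\gamma_{A,\mathcal S}(H_0(A))$ with norm $\|\phi\|_{A,\mathcal S}:=\inf\{\|v\|_A: v\in H(A),\ \gamma_{A,\mathcal S}(v)=\phi\}$; for $\phi\in H(A,\mathcal S)$ and $w\in\widetilde H(A^*,\mathcal T)$, $\langle\phi,w\rangle_{\mathcal S}:=\langle\gamma_{A,\mathcal S}(v),w\rangle_{\mathcal S}$ for any $v\in H(A)$ with $\gamma_{A,\mathcal S}(v)=\phi$. *)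

(* Defs.v *)
From HB Require Import structures.
From mathcomp Require Import all_boot all_order all_algebra.
From mathcomp Require Import all_classical all_reals all_analysis.

Set Implicit Arguments.
Unset Strict Implicit.
Unset Printing Implicit Defensive.
Import Order.TTheory GRing.Theory Num.Theory.
Import numFieldNormedType.Exports.
Local Open Scope classical_set_scope.
Local Open Scope ring_scope.

(* Points of R^n are row vectors 'rV[R]_n, equipped with the sigma-algebra
   generated by the coordinates, i.e. the Borel sigma-algebra of R^n. *)
Section rV_measurable.
Context (R : realType) (n : nat).

Definition rV_coord (i : 'I_n) (x : 'rV[R]_n) : R := x ord0 i.

Let rV_set0 : g_sigma_preimage rV_coord set0.
Proof. exact: sigma_algebra0. Qed.

Let rV_setC A : g_sigma_preimage rV_coord A -> g_sigma_preimage rV_coord (~` A).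
Proof. exact: sigma_algebraC. Qed.

Let rV_bigcup (F : _^nat) : (forall i, g_sigma_preimage rV_coord (F i)) ->
  g_sigma_preimage rV_coord (\bigcup_i (F i)).
Proof. exact: sigma_algebra_bigcup. Qed.

HB.instance Definition _ := @isMeasurable.Build default_measure_display
  'rV[R]_n (g_sigma_preimage rV_coord) rV_set0 rV_setC rV_bigcup.
End rV_measurable.

Lemma measurable_rV_coord (R : realType) (n : nat) (i : 'I_n) :
  measurable_fun [set: 'rV[R]_n] (@rV_coord R n i).
Proof.
move=> _ Y mY; rewrite setTI; apply: sub_sigma_algebra => /=.
rewrite -bigcup_seq/=; exists i => /=; first by rewrite mem_index_enum.
by exists Y => //; rewrite setTI.
Qed.

Lemma measurable_fun_rV (d : measure_display) (T : measurableType d)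
    (R : realType) (n : nat) (f : T -> 'rV[R]_n) :
  (forall i, measurable_fun [set: T] (@rV_coord R n i \o f)) ->
  measurable_fun [set: T] f.
Proof.
move=> mf _ Y mY; rewrite setTI.
have : preimage_set_system [set: T] f (g_sigma_preimage (@rV_coord R n))
    (f @^-1` Y) by exists Y => //; rewrite setTI.
rewrite -g_sigma_preimage_comp; apply: smallest_sub.
  exact: sigma_algebra_measurable.
rewrite -bigcup_seq => A /= [i _ [B mB <-]].
by apply: (mf i).
Qed.

Section lebesgue_rV.
Context (R : realType).

Definition rV_cons n (p : measurableTypeR R * 'rV[R]_n) : 'rV[R]_n.+1 :=
  \row_i oapp (fun j => p.2 ord0 j) p.1 (unlift ord0 i).

Definition rV_uncons n (x : 'rV[R]_n.+1) : measurableTypeR R * 'rV[R]_n :=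
  (x ord0 ord0, \row_i x ord0 (lift ord0 i)).

Lemma rV_consK n : cancel (@rV_cons n) (@rV_uncons n).
Proof.
move=> [a v]; rewrite /rV_uncons !mxE unlift_none /=; congr pair.
by apply/rowP => i; rewrite !mxE liftK.
Qed.

Lemma measurable_rV_cons n : measurable_fun setT (@rV_cons n).
Proof.
apply: measurable_fun_rV => i.
rewrite (_ : _ \o _ = fun p : measurableTypeR R * 'rV[R]_n =>
    oapp (fun j => rV_coord j p.2) p.1 (unlift ord0 i)); last first.
  by apply/funext => p; rewrite /= /rV_coord mxE; case: unlift.
case: unliftP => [j _|_] /=; last exact: measurable_fst.
apply: (measurableT_comp (@measurable_rV_coord R n j)).
exact: measurable_snd.
Qed.

Lemma measurable_rV_uncons n : measurable_fun setT (@rV_uncons n).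
Proof.
apply/measurable_fun_pair => /=.
  exact: (@measurable_rV_coord R n.+1 ord0).
apply: measurable_fun_rV => i.
rewrite (_ : _ \o _ = @rV_coord R n.+1 (lift ord0 i)); last first.
  by apply/funext => x; rewrite /rV_coord /= mxE.
exact: measurable_rV_coord.
Qed.

Section step.
Context (n : nat) (mu : {sigma_finite_measure set 'rV[R]_n -> \bar R}).

(* lebesgue_measure on the first coordinate times mu on the others *)
Definition lebesgue_step : set 'rV[R]_n.+1 -> \bar R :=
  pushforward (@lebesgue_measure R \x mu)%E (@rV_cons n).

Let mprecons A : measurable A -> measurable (@rV_cons n @^-1` A).
Proof.
by move=> mA; rewrite -[X in measurable X]setTI; exact: measurable_rV_cons.
Qed.

Let lebesgue_step0 : lebesgue_step set0 = 0%E.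
Proof. by rewrite /lebesgue_step /pushforward preimage_set0 measure0. Qed.

Let lebesgue_step_ge0 A : (0 <= lebesgue_step A)%E.
Proof. by apply: integral_ge0 => x _. Qed.

Let lebesgue_step_sigma_additive : semi_sigma_additive lebesgue_step.
Proof.
move=> F mF tF mUF; rewrite /lebesgue_step /pushforward preimage_bigcup.
apply: measure_semi_sigma_additive.
- by move=> k; exact: mprecons.
- apply/trivIsetP => /= i j _ _ ij; rewrite -preimage_setI.
  by move/trivIsetP : tF => /(_ _ _ _ _ ij) ->//; rewrite preimage_set0.
- by rewrite -preimage_bigcup; exact: mprecons.
Qed.

HB.instance Definition _ := isMeasure.Build _ _ _ lebesgue_step
  lebesgue_step0 lebesgue_step_ge0 lebesgue_step_sigma_additive.

Let lebesgue_step_sigma_finite : sigma_finite setT lebesgue_step.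
Proof.
have /sigma_finiteP[F [TF ndF Foo]] := sigma_finiteT (@lebesgue_measure R).
have /sigma_finiteP[G [TG ndG Goo]] := sigma_finiteT mu.
exists (fun k => @rV_uncons n @^-1` (F k `*` G k)).
  rewrite -preimage_bigcup (_ : \bigcup_k _ = setT) ?preimage_setT//.
  rewrite -setXTT TF TG predeqE => -[x y]; split.
    by move=> [k _ []/= ? ?]; split; exists k.
  move=> [/= [k _ Fkx] [l _ Gly]]; exists (maxn k l) => //; split.
  - by move: x Fkx; exact/subsetPset/ndF/leq_maxl.
  - by move: y Gly; exact/subsetPset/ndG/leq_maxr.
move=> k; have [? ?] := Foo k; have [? ?] := Goo k; split.
  rewrite -[X in measurable X]setTI; apply: measurable_rV_uncons => //.
  exact: measurableX.
rewrite /lebesgue_step /pushforward -comp_preimage.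
rewrite (_ : _ \o _ = id); last by apply/funext => p /=; rewrite rV_consK.
by rewrite preimage_id product_measure1E// lte_mul_pinfty// ge0_fin_numE.
Qed.

HB.instance Definition _ := Measure_isSigmaFinite.Build _ _ _ lebesgue_step
  lebesgue_step_sigma_finite.

End step.

(* n-dimensional Lebesgue measure (on Borel sets) as an iterated product *)
Fixpoint lebesgue_rV n : {sigma_finite_measure set 'rV[R]_n -> \bar R} :=
  match n with
  | 0 => @dirac _ 'rV[R]_0 0 R
  | n'.+1 => lebesgue_step (lebesgue_rV n')
  end.
End lebesgue_rV.
Arguments lebesgue_rV {R} n.

(* The four admissible spaces U, realised as sets of real matrices: scalars are
   1 x 1 matrices and vectors are rows. *)
Variant Ukind := Uscalar | Uvector | Umatrix | Usymmetric.

Definition Urows (k : Ukind) (d : nat) : nat :=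
  match k with Uscalar | Uvector => 1 | Umatrix | Usymmetric => d end.

Definition Ucols (k : Ukind) (d : nat) : nat :=
  match k with Uscalar => 1 | Uvector | Umatrix | Usymmetric => d end.

Definition Uset (R : realType) (k : Ukind) (d : nat) :
    set 'M[R]_(Urows k d, Ucols k d) :=
  match k with
  | Usymmetric => [set w : 'M[R]_(d, d) | w = w^T]
  | _ => setT
  end.
Arguments Uset : clear implicits.

Definition frob (R : realType) m n (z z' : 'M[R]_(m, n)) : R :=
  \sum_i \sum_j z i j * z' i j.

Section geometry.
Context (R : realType) (d : nat).
Implicit Types (Om T : set 'rV[R]_d).

(* Lipschitz boundary: near each boundary point, Om is the strict subgraph, in
   some unit direction e, of a Lipschitz function of the component orthogonal
   to e. *)
Definition bounded_lipschitz_domain Om : Prop :=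
  [/\ open Om, connected Om, Om !=set0, bounded_set Om &
    forall x0, (closure Om `\` Om) x0 ->
    exists (e : 'rV[R]_d) (g : 'rV[R]_d -> R) (V : set 'rV[R]_d),
      [/\ frob e e = 1, lipschitz g, nbhs x0 V &
        forall x, V x -> (Om x <-> frob x e < g (x - frob x e *: e))]].

Definition halfspaces (hs : seq ('rV[R]_d * R)) : set 'rV[R]_d :=
  [set x | forall h, h \in hs -> frob x h.1 <= h.2].

(* Interiors of finite unions of (convex, bounded) polytopes; the elements need
   not be convex. *)
Definition polyhedral T : Prop :=
  [/\ T !=set0, connected T &
    exists Ps : seq (seq ('rV[R]_d * R)),
      (forall hs, hs \in Ps -> bounded_set (halfspaces hs)) /\
      T = [set x | exists2 hs, hs \in Ps & halfspaces hs x]°].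

(* Finitely many non-overlapping open polyhedral elements covering Om.  Elements
   are general polyhedra, whose flat faces may be subdivided, so that there is
   no separate condition on hanging nodes; no shape regularity is imposed. *)
Definition regular_mesh K Om (T : 'I_K -> set 'rV[R]_d) : Prop :=
  [/\ forall i, polyhedral (T i) /\ T i `<=` Om,
      forall i j, i != j -> T i `&` T j = set0 &
      closure Om = \bigcup_i closure (T i)].

End geometry.

Section L2.
Context (R : realType) (d m n : nat) (U : set 'M[R]_(m, n)).
Implicit Types (D : set 'rV[R]_d) (f g : 'rV[R]_d -> R).
Implicit Types (F G : 'rV[R]_d -> 'M[R]_(m, n)).

(* Elements of L_2(D) and L_2(D; U) are represented by functions on R^d whose
   values outside D are irrelevant; equality in these spaces is [ae_on]. *)
Definition L2 D f : Prop :=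
  measurable_fun D f /\
  (\int[lebesgue_rV d]_(x in D) ((f x) ^+ 2)%:E < +oo)%E.

Definition L2U D F : Prop :=
  (forall x, D x -> U (F x)) /\ (forall i j, L2 D (fun x => F x i j)).

Definition ae_on D (P : 'rV[R]_d -> Prop) : Prop :=
  {ae lebesgue_rV d, forall x, D x -> P x}.

Definition ip D f g : R := \int[lebesgue_rV d]_(x in D) (f x * g x).
Definition ipU D F G : R := \int[lebesgue_rV d]_(x in D) frob (F x) (G x).
Definition norm2 D f : R := Num.sqrt (ip D f f).
Definition norm2U D F : R := Num.sqrt (ipU D F F).

End L2.

Section test_functions.
Context (R : realType) (d : nat).
Implicit Types (D : set 'rV[R]_d) (f : 'rV[R]_d -> R).

Definition partial (i : 'I_d) f : 'rV[R]_d -> R := 'D_(delta_mx ord0 i) f.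

Definition smooth f : Prop := forall s : seq 'I_d,
  continuous (foldr partial f s) /\
  forall i x, derivable (foldr partial f s) x (delta_mx ord0 i).

Definition test_fun D f : Prop :=
  smooth f /\ exists2 K, compact K /\ K `<=` D & forall x, ~ K x -> f x = 0.

Definition test_funU m n (U : set 'M[R]_(m, n)) D
    (eta : 'rV[R]_d -> 'M[R]_(m, n)) : Prop :=
  (forall x, U (eta x)) /\ (forall i j, test_fun D (fun x => eta x i j)).

End test_functions.

Section differential_operator.
Context (R : realType) (d N m n : nat).

(* A = sum_alpha a_alpha d^alpha over multi-indices with entries at most N;
   every linear constant-coefficient operator has this form for some N. *)
Definition diffop := {ffun 'I_d -> 'I_N.+1} -> 'M[R]_(m, n).

Definition Dalpha (alpha : {ffun 'I_d -> 'I_N.+1}) (f : 'rV[R]_d -> R) :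
    'rV[R]_d -> R :=
  foldr (fun i => iter (alpha i) (partial i)) f (enum 'I_d).

Definition A_test (a : diffop) (psi : 'rV[R]_d -> R) (x : 'rV[R]_d) :
    'M[R]_(m, n) :=
  \sum_alpha Dalpha alpha psi x *: a alpha.

Definition As_test (a : diffop) (eta : 'rV[R]_d -> 'M[R]_(m, n))
    (x : 'rV[R]_d) : R :=
  \sum_(alpha : {ffun 'I_d -> 'I_N.+1}) (-1) ^+ (\sum_i alpha i)%N *
    \sum_i \sum_j a alpha i j * Dalpha alpha (fun y => eta y i j) x.

Context (U : set 'M[R]_(m, n)) (a : diffop).
Implicit Types (D : set 'rV[R]_d) (v q : 'rV[R]_d -> R).
Implicit Types (w g : 'rV[R]_d -> 'M[R]_(m, n)).

(* A v = g and A^* w = q as distributions on the open set D *)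
Definition weakA D v g : Prop := forall eta, test_funU U D eta ->
  ipU D g eta = ip D v (As_test a eta).
Definition weakAs D w q : Prop := forall psi, test_fun D psi ->
  ip D q psi = ipU D w (A_test a psi).

Definition HA D v : Prop := L2 D v /\ exists g, L2U U D g /\ weakA D v g.
Definition HAs D w : Prop := L2U U D w /\ exists q, L2 D q /\ weakAs D w q.

(* L_2 representatives of A v and A^* w, unique up to null sets *)
Definition dA D v : 'rV[R]_d -> 'M[R]_(m, n) :=
  xget (fun=> 0) [set g | L2U U D g /\ weakA D v g].
Definition dAs D w : 'rV[R]_d -> R :=
  xget (fun=> 0) [set q | L2 D q /\ weakAs D w q].

Definition normA D v : R :=
  Num.sqrt (norm2 D v ^+ 2 + norm2U D (dA D v) ^+ 2).
Definition normAs D w : R :=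
  Num.sqrt (norm2U D w ^+ 2 + norm2 D (dAs D w) ^+ 2).

Definition gammaGamma D v w : R := ipU D (dA D v) w - ip D v (dAs D w).

Definition H0A D v : Prop :=
  HA D v /\ forall w, HAs D w -> gammaGamma D v w = 0.

Context (Om : set 'rV[R]_d) (K : nat) (T : 'I_K -> set 'rV[R]_d).

(* (v, A^* w)_T with A^* taken elementwise *)
Definition ip_meshAs v w : R := \sum_(i < K) ip (T i) v (dAs (T i) w).

Definition HAsT w : Prop :=
  L2U U Om w /\ forall i, exists q, L2 (T i) q /\ weakAs (T i) w q.

Definition normAsT w : R :=
  Num.sqrt (norm2U Om w ^+ 2 + \sum_(i < K) norm2 (T i) (dAs (T i) w) ^+ 2).

(* Ht is a closed subspace with H(A^* ) <= Ht <= H(A^*, T); being closed for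
   the seminorm on functions, it is stable under almost-everywhere equality. *)
Definition closed_intermediate_space (Ht : set ('rV[R]_d -> 'M[R]_(m, n))) :
    Prop :=
  [/\ (forall w, HAs Om w -> Ht w), (forall w, Ht w -> HAsT w),
      (forall (c : R) w w', Ht w -> Ht w' -> Ht (fun x => c *: w x + w' x)) &
      forall (w_ : nat -> 'rV[R]_d -> 'M[R]_(m, n)) w,
        (forall k, Ht (w_ k)) -> HAsT w ->
        (fun k => normAsT (fun x => w_ k x - w x)) @ \oo --> (0 : R) ->
        Ht w].

Context (Ht : set ('rV[R]_d -> 'M[R]_(m, n))).

Definition gammaS v w : R := ipU Om (dA Om v) w - ip_meshAs v w.

(* Functionals on Ht are represented by functions on all of
   'rV[R]_d -> 'M[R]_(m, n), of which only the values on Ht matter. *)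
Definition trace_of (phi : ('rV[R]_d -> 'M[R]_(m, n)) -> R) v : Prop :=
  forall w, Ht w -> phi w = gammaS v w.

Definition HAS phi : Prop := exists2 v, HA Om v & trace_of phi v.

Definition H0AS phi : Prop := exists2 v, H0A Om v & trace_of phi v.

Definition normAS phi : R :=
  inf [set normA Om v | v in [set v | HA Om v /\ trace_of phi v]].

Context (C : 'rV[R]_d -> 'M[R]_(m, n) -> 'M[R]_(m, n)).

(* C in L_infty(Om; U x U), symmetric and uniformly positive definite *)
Definition spd_tensor_field : Prop :=
  [/\ forall x, Om x -> (forall z, U z -> U (C x z)) /\
        (forall (c : R) z z', U z -> U z' ->
           C x (c *: z + z') = c *: C x z + C x z'),
      forall z i j, U z -> measurable_fun Om (fun x => C x z i j),
      exists M : R, ae_on Om (fun x => forall z z', U z -> U z' ->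
        `|frob (C x z) z'| <= M * Num.sqrt (frob z z) * Num.sqrt (frob z' z')),
      ae_on Om (fun x => forall z z', U z -> U z' ->
        frob (C x z) z' = frob z (C x z')) &
      exists2 c : R, 0 < c & ae_on Om (fun x => forall z, U z ->
        c * frob z z <= frob (C x z) z)].

(* The a.e. unique L_2 function z = C^{-1} w, i.e. C(x) z(x) = w(x) a.e. *)
Definition applyCinv w : 'rV[R]_d -> 'M[R]_(m, n) :=
  xget (fun=> 0) [set z | L2U U Om z /\ ae_on Om (fun x => C x (z x) = w x)].

Definition is_solution (f : 'rV[R]_d -> R) (w : 'rV[R]_d -> 'M[R]_(m, n))
    (u : 'rV[R]_d -> R) (phi : ('rV[R]_d -> 'M[R]_(m, n)) -> R) : Prop :=
  [/\ Ht w, L2 Om u, H0AS phi,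
      forall dw, Ht dw ->
        ipU Om (applyCinv w) dw - ip_meshAs u dw - phi dw = 0 &
      forall du dphi, L2 Om du -> H0AS dphi ->
        - ip_meshAs du w - dphi w = - ip Om f du].

End differential_operator.

(* Main.v *)
(** On H_0(A) the Friedrichs inequality makes (C A u, A v) a complete inner
    product, so the Riesz theorem yields u in H_0(A) with
    (C A u, A v) = (f, v) for all v in H_0(A). Test functions belong to H_0(A)
    (integration by parts), hence w = C A u satisfies A^* w = f, and
    (w, u, gamma_S(u)) solves the hybrid problem because the skeleton has
    measure zero. Conversely, testing the first equation with H(A^* ), on which
    traces of H_0(A) vanish, shows u in H_0(A) and w = C A u; testing the second
    with traces of test functions shows A^* w = f. The bound then follows from
    c |A u|^2 <= (C A u, A u) = (f, u), and uniqueness from linearity. Weak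
    derivatives are well defined by the fundamental lemma of the calculus of
    variations. *)
Require Import Defs.
From mathcomp Require Import all_boot all_order all_algebra.
From mathcomp Require Import all_classical all_reals all_analysis.
From mathcomp Require Import measurable_realfun ring lra.
Set Implicit Arguments.
Unset Strict Implicit.
Unset Printing Implicit Defensive.
Import Order.TTheory GRing.Theory Num.Theory.
Import numFieldNormedType.Exports.
Local Open Scope classical_set_scope.
Local Open Scope ring_scope.

(** * Semi-inner products *)

(** The obstacle is that [dA] and [dAs] are chosen representatives, hence linear only up to null
    sets, whereas the Riesz theorem is applied to a space of functions with an actual linear
    structure. The argument therefore runs on pairs (v, g) with g a weak A v, and returns to
    representatives only at the two ends, through uniqueness almost everywhere. The mesh takes no
    part in the construction: [strong_solution] records what u, w and g = A u satisfy on Om alone,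
    and every solution of the hybrid problem, for any mesh and any [Ht], is shown to be of this
    kind. This is why one constant serves all meshes: once A^* w exists globally, the broken norm of
    w is the global one, and u itself competes in the infimum that defines the norm of its trace. A
    priori a solution w has A^* w only element by element. Splitting the second equation into its
    volume part and its skeleton part is what glues the pieces to a global distribution. The four
    spaces U are treated at once through an orthogonal projector onto U. *)

Lemma discriminant_le (R : realFieldType) (a b c : R) :
  (forall t, 0 <= a + 2 * t * b + t ^+ 2 * c) -> b ^+ 2 <= a * c.
Proof.
move=> h; have a0 : 0 <= a by have := h 0; lra.
have [c0|c0|c0] := ltgtP c 0.
- have b_ge0 := normr_ge0 b.
  (* This t makes [t * (- c)] larger than 1 + a + 2|b|, so the negative quadratic term outweighs the
     others and the hypothesis is contradicted. *)
  have := h ((1 + a + 2 * `|b|) / - c + 1); set t := _ + 1 => ht.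
  have t1 : 1 <= t by rewrite lerDr divr_ge0//; [lra|lra].
  have tc : - c * (t - 1) = 1 + a + 2 * `|b| by rewrite /t; field; lra.
  have bb : b <= `|b| := ler_norm b.
  nra.
- have := h (- b / c).
  have -> : a + 2 * (- b / c) * b + (- b / c) ^+ 2 * c = (a * c - b ^+ 2) / c.
    by field; lra.
  by rewrite pmulr_lge0 ?invr_gt0// subr_ge0.
- rewrite c0 mulr0; have [->|b0] := eqVneq b 0; first by rewrite expr0n.
  have := h (- (a + 1) / (2 * b)); rewrite c0 mulr0 addr0.
  have -> : a + 2 * (- (a + 1) / (2 * b)) * b = - 1 by field.
  lra.
Qed.

(* No algebraic law is required of [lin c x y], which stands for [c x + y]:
   for functions known only almost everywhere it suffices that the form sees
   it as a linear combination. *)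
Section semi_inner_product.
Context (R : realType) (E : Type) (S : set E) (lin : R -> E -> E -> E).
Context (B : E -> E -> R).
Context (S_lin : forall c x y, S x -> S y -> S (lin c x y)).
Context (B_lin : forall c x y z, S x -> S y -> S z ->
  B (lin c x y) z = c * B x z + B y z).
Context (B_sym : forall x y, S x -> S y -> B x y = B y x).
Context (B_ge0 : forall x, S x -> 0 <= B x x).

Lemma form_linr c x y z : S x -> S y -> S z ->
  B z (lin c x y) = c * B z x + B z y.
Proof.
by move=> Sx Sy Sz; rewrite B_sym ?B_lin// ?(B_sym Sx)// ?(B_sym Sy)//; exact: S_lin.
Qed.

Lemma form_lin_diag c x y : S x -> S y ->
  B (lin c x y) (lin c x y) = B y y + 2 * c * B x y + c ^+ 2 * B x x.
Proof.
move=> Sx Sy; rewrite B_lin ?form_linr//; last exact: S_lin.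
by rewrite (B_sym Sy Sx); ring.
Qed.

Lemma form_cauchy_schwarz x y : S x -> S y -> (B x y) ^+ 2 <= B x x * B y y.
Proof.
move=> Sx Sy; rewrite mulrC; apply: discriminant_le => t.
by rewrite -form_lin_diag//; apply: B_ge0; exact: S_lin.
Qed.

Lemma form_cauchy_schwarz_sqrt x y : S x -> S y ->
  `|B x y| <= Num.sqrt (B x x) * Num.sqrt (B y y).
Proof.
move=> Sx Sy; rewrite -sqrtrM ?B_ge0// -sqrtr_sqr ler_sqrt; last first.
  by rewrite mulr_ge0// B_ge0.
exact: form_cauchy_schwarz.
Qed.

Context (F : E -> R) (L : R).
Context (S_neq0 : S !=set0).
Context (F_lin : forall c x y, S x -> S y -> F (lin c x y) = c * F x + F y).
Context (F_bounded : forall x, S x -> `|F x| <= L * Num.sqrt (B x x)).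
Context (S_complete : forall x_ : nat -> E, (forall n, S (x_ n)) ->
  (forall e, 0 < e -> exists N, forall n m, (N <= n)%N -> (N <= m)%N ->
     B (lin (-1) (x_ n) (x_ m)) (lin (-1) (x_ n) (x_ m)) < e) ->
  exists2 x, S x & forall e, 0 < e -> exists N, forall n, (N <= n)%N ->
     B (lin (-1) (x_ n) x) (lin (-1) (x_ n) x) < e).

Let J x := B x x - 2 * F x.

(** Completing the square: J x >= s^2 - 2 L s >= - L^2 with s = sqrt (B x x). The infimum of J is
    therefore finite. *)
Let J_ge x : S x -> - L ^+ 2 <= J x.
Proof.
move=> Sx; have := F_bounded Sx; have := ler_norm (F x).
have : Num.sqrt (B x x) ^+ 2 = B x x by rewrite sqr_sqrtr// B_ge0.
rewrite /J; set s := Num.sqrt _ => <- h1 h2.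
have := sqr_ge0 (s - L); nra.
Qed.

(* Minimizing sequences of J are Cauchy by the parallelogram law. *)
Lemma riesz_representation : exists2 u, S u & forall v, S v -> B u v = F v.
Proof.
pose I := inf [set J x | x in S].
have hI : has_inf [set J x | x in S].
  split; first by case: S_neq0 => x Sx; exists (J x), x.
  by exists (- L ^+ 2) => _ [x Sx <-]; exact: J_ge.
have IJ x : S x -> I <= J x by move=> Sx; apply: ge_inf; [exact: hI.2|exists x].
have /choice[x_ hx_] : forall n : nat, exists x, S x /\ J x < I + n.+1%:R^-1.
  move=> n; have [|_ [x Sx <-] ?] := inf_adherent (eps := n.+1%:R^-1) _ hI.
    by rewrite invr_gt0.
  by exists x.
have Jdiag c x y : S x -> S y -> J (lin c x y) =
    B y y + 2 * c * B x y + c ^+ 2 * B x x - 2 * (c * F x + F y).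
  by move=> Sx Sy; rewrite /J form_lin_diag// F_lin.
have near x y e : S x -> S y -> J x < I + e -> J y < I + e ->
    B (lin (-1) x y) (lin (-1) x y) < 4 * e.
  move=> Sx Sy Jx Jy; rewrite form_lin_diag//.
  (* The midpoint of x and y: only [lin] is available, so y/2 is produced as -y/2 + y. The
     parallelogram law then reads |x - y|^2 = 2 J x + 2 J y - 4 J z < 4 e. *)
  pose z := lin 2^-1 x (lin (- 2^-1) y y).
  have Syy : S (lin (- 2^-1) y y) by exact: S_lin.
  have Sz : S z by exact: S_lin.
  have := IJ _ Sz; rewrite /z Jdiag// form_lin_diag// F_lin// form_linr//.
  move: Jx Jy; rewrite /J; lra.
have small e : 0 < e -> exists N, forall n, (N <= n)%N -> (n.+1%:R^-1 : R) < e.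
  move=> e0; have /cvgrPdist_lt/(_ _ e0) := @cvg_harmonic R.
  move=> [N _ hN]; exists N => n /hN; rewrite /harmonic /= sub0r normrN.
  by rewrite ger0_norm// invr_ge0.
have [|e e0|u Su hu] := S_complete (x_ := x_).
- by move=> n; case: (hx_ n).
- have [N hN] := small (e / 4) (divr_gt0 e0 (ltr0n _ 4)).
  exists N => n m /hN hn /hN hm; have -> : e = 4 * (e / 4) by field.
  have [Sn Jn] := hx_ n; have [Sm Jm] := hx_ m.
  by apply: near => //; [apply: lt_trans Jn _|apply: lt_trans Jm _]; rewrite ltrD2l.
exists u => //.
have JuI : J u <= I.
  apply/ler_addgt0Pl => e e0.
  (* With d = u - x_n, Cauchy-Schwarz gives J u - J x_n <= (2|u| + 2|L|) |d|, which is at most e/2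
     once |d| <= r; the summand 1 keeps K positive. *)
  pose K := 2 * Num.sqrt (B u u) + 2 * `|L| + 1.
  have Bu0 := sqrtr_ge0 (B u u); have L0 := normr_ge0 L.
  have K0 : 0 < K by rewrite /K; lra.
  pose r := Num.min 1 (e / 2 / K).
  have r0 : 0 < r by rewrite !lt_min ltr01 !divr_gt0.
  have rK : r * K <= e / 2.
    have : r <= e / 2 / K by rewrite ge_min lexx orbT.
    by rewrite ler_pdivlMr.
  have [N1 hN1] := hu (r ^+ 2) (exprn_gt0 2 r0).
  have [N2 hN2] := small (e / 2) (divr_gt0 e0 (ltr0n _ 2)).
  pose n := maxn N1 N2.
  have [Sn Jn] := hx_ n.
  have {}Jn : J (x_ n) < I + e / 2.
    by rewrite (lt_trans Jn)// ltrD2l hN2// leq_maxr.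
  have := hN1 n (leq_maxl _ _).
  have Sd : S (lin (-1) (x_ n) u) by exact: S_lin.
  set d := lin (-1) (x_ n) u in Sd *; move=> hd.
  have d_lt : Num.sqrt (B d d) <= r.
    by rewrite -(ger0_norm (ltW r0)) -sqrtr_sqr ler_sqrt ?sqr_ge0// ltW.
  have Bud := form_cauchy_schwarz_sqrt Su Sd.
  have Fd := F_bounded Sd.
  have BdE : B d d = B u u - 2 * B (x_ n) u + B (x_ n) (x_ n).
    by rewrite /d form_lin_diag//; ring.
  have BudE : B u d = B u u - B (x_ n) u.
    by rewrite /d form_linr// (B_sym Su Sn); ring.
  have FdE : F d = F u - F (x_ n) by rewrite /d F_lin//; ring.
  have : J u = J (x_ n) - B d d + 2 * B u d - 2 * F d.
    by rewrite /J BdE BudE FdE; ring.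
  have := B_ge0 Sd; have := ler_norm (B u d); have := ler_norm (- F d).
  rewrite normrN.
  have h1 : Num.sqrt (B u u) * Num.sqrt (B d d) <= Num.sqrt (B u u) * r.
    by rewrite ler_wpM2l.
  have h2 : L * Num.sqrt (B d d) <= `|L| * r.
    by rewrite (le_trans (ler_wpM2r (sqrtr_ge0 _) (ler_norm L)))// ler_wpM2l.
  move: rK; rewrite /K; lra.
move=> v Sv; apply/eqP; rewrite -subr_eq0 -sqrf_eq0 eq_le sqr_ge0 andbT.
(* First variation: J (u + t v) - J u is a nonnegative quadratic in t with zero constant term, so
   the discriminant bound forces (B u v - F v)^2 <= 0. *)
rewrite -[leRHS](mul0r (B v v)); apply: discriminant_le => t.
have Svu : S (lin t v u) by exact: S_lin.
have := IJ _ Svu; rewrite Jdiag// (B_sym Sv Su).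
by move: JuI; rewrite /J; lra.
Qed.

End semi_inner_product.

(** * Lebesgue measure on R^n *)

Lemma continuous_sum (R : realType) (T : topologicalType) I (r : seq I)
    (P : pred I) (f : I -> T -> R) : (forall i, P i -> continuous (f i)) ->
  continuous (fun x => \sum_(i <- r | P i) f i x).
Proof.
move=> cf; elim: r => [|i r IH].
  rewrite (_ : (fun x => _) = fun=> 0) => [x|]; first exact: cvg_cst.
  by apply/funext => x; rewrite big_nil.
case Pi : (P i); last first.
  by rewrite (_ : (fun x => _) = fun x => \sum_(i <- r | P i) f i x)//;
    apply/funext => x; rewrite big_cons Pi.
rewrite (_ : (fun x => _) = f i \+ (fun x => \sum_(i <- r | P i) f i x)) => [x|].
  by apply: cvgD; [exact: cf|exact: IH].
by apply/funext => x; rewrite big_cons Pi.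
Qed.

Section borel_rV.
Context (R : realType) (n : nat).

Definition rV_box (I : 'I_n -> set R) : set 'rV[R]_n :=
  [set v | forall i, I i (v ord0 i)].

Definition rV_cube (M : R) : set 'rV[R]_n := rV_box (fun=> `[-M, M]%classic).

Lemma measurable_rV_box (I : 'I_n -> set R) :
  (forall i, measurable (I i)) -> measurable (rV_box I).
Proof.
move=> mI; have -> : rV_box I = \bigcap_(i in setT) (@rV_coord R n i @^-1` I i).
  by apply/seteqP; split=> v /= h => [i _|i]; exact: h.
apply: fin_bigcap_measurable => // i _; rewrite -[X in measurable X]setTI.
exact: measurable_rV_coord.
Qed.

Definition cube_radius (k : nat) : R := k.+1%:R^-1.

Definition rat_cube (p : 'rV[rat]_n * nat) : set 'rV[R]_n := rV_box (fun i =>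
  `]ratr (p.1 ord0 i) - cube_radius p.2, ratr (p.1 ord0 i) + cube_radius p.2[%classic).

Definition rat_closed_cube (p : 'rV[rat]_n * nat) : set 'rV[R]_n := rV_box (fun i =>
  `[ratr (p.1 ord0 i) - cube_radius p.2, ratr (p.1 ord0 i) + cube_radius p.2]%classic).

(** Cubes with rational centre and radius 1/(k+1) form a countable base. The closed cube is also
    kept inside A because it will be the compact support of a bump function. *)
Lemma open_rat_cube (A : set 'rV[R]_n) x : open A -> A x ->
  exists p, rat_cube p x /\ rat_closed_cube p `<=` A.
Proof.
move=> oA Ax; have /nbhs_ballP[e /= e0 he] : nbhs x A by exact: open_nbhs_nbhs.
have /cvgrPdist_lt/(_ _ (divr_gt0 e0 (ltr0n _ 2))) := @cvg_harmonic R.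
move=> [k _ /(_ k (leqnn k))]; rewrite /harmonic /= sub0r normrN.
rewrite ger0_norm ?invr_ge0// -/(cube_radius k) => ke.
have r0 : 0 < cube_radius k by rewrite invr_gt0.
have /choice[q hq] : forall i, exists q : rat,
    `|x ord0 i - ratr q| < cube_radius k.
  move=> i; have [|q] := @rat_in_itvoo R (x ord0 i - cube_radius k)
      (x ord0 i + cube_radius k).
    by rewrite ltrBlDr -addrA ltrDl addr_gt0.
  rewrite in_itv/= => /andP[q1 q2].
  by exists q; rewrite ltr_norml; apply/andP; split; lra.
exists (\row_i q i, k); split.
  by move=> i; have := hq i; rewrite /= mxE in_itv/= ltr_norml => /andP[h1 h2];
    apply/andP; split; lra.
move=> y Qy; apply: he; split=> [//|i j]; rewrite (ord1 i).
have := Qy j; have := hq j; rewrite /= mxE in_itv/= /ball /= !ltr_norml.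
by move=> /andP[h1 h2] /andP[h3 h4]; apply/andP; split; lra.
Qed.

Lemma sub_rat_closed_cube p : rat_cube p `<=` rat_closed_cube p.
Proof.
by move=> x hx i; move: (hx i); rewrite /= !in_itv/= => /andP[/ltW-> /ltW->].
Qed.

Lemma open_measurable_rV (A : set 'rV[R]_n) : open A -> measurable A.
Proof.
(* Intersecting with a constant set, full or empty, discards the inadmissible cubes while the union
   still ranges over the whole countable type of indices. *)
move=> oA; have -> : A = \bigcup_p (rat_cube p `&` [set _ | rat_closed_cube p `<=` A]).
  apply/seteqP; split=> [x Ax|x [p _ [px pA]]].
    by have [p [px pA]] := open_rat_cube oA Ax; exists p.
  exact/pA/sub_rat_closed_cube.
apply: countable_bigcupT_measurable => // p.
have [pA|npA] := pselect (rat_closed_cube p `<=` A); last first.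
  by rewrite (_ : _ `&` _ = set0)//; apply/seteqP; split=> // v [].
rewrite (_ : _ `&` _ = rat_cube p).
  by apply: measurable_rV_box => i; exact: measurable_itv.
by apply/seteqP; split=> v; [case|].
Qed.

Lemma continuous_measurable_rV (f : 'rV[R]_n -> R) :
  continuous f -> measurable_fun setT f.
Proof.
move=> cf; apply: (measurability _ (RGenOpens.measurableE R)).
move=> _ [_ [a [b ->] <-]]; rewrite setTI; apply: open_measurable_rV.
by apply: open_comp; [move=> x _; exact: cf|exact: interval_open].
Qed.

Lemma coord_le_norm (v : 'rV[R]_n) i : `|v ord0 i| <= `|v|.
Proof.
have /mapP[j Hj ->] : `|v ord0 i| \in [seq `|v x.1 x.2| | x : 'I_1 * 'I_n].
  by apply/mapP; exists (ord0, i) => //=; rewrite mem_enum.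
by rewrite [leRHS]/Num.norm /= mx_normrE; apply/bigmax_geP; right => /=; exists j.
Qed.

Lemma bounded_sub_box (A : set 'rV[R]_n) : bounded_set A ->
  exists2 M, 0 < M & A `<=` rV_cube M.
Proof.
move=> [M0 [_ hM0]]; exists (Num.max M0 0 + 1).
  by rewrite ltr_wpDl// le_max lexx orbT.
move=> v Av i /=; rewrite in_itv/= -ler_norml.
apply: le_trans (coord_le_norm v i) _; apply: hM0 => //.
by rewrite ltr_pwDr// le_max lexx.
Qed.

End borel_rV.

Section lebesgue_rV_lemmas.
Context (R : realType).
Local Notation mu := (@lebesgue_rV R).

Lemma lebesgue_rV_itv_lty n (M : R) :
  (mu n (rV_cube M) < +oo)%E.
Proof.
elim: n => [|n IH] /=; first by rewrite diracE; case: (_ \in _); rewrite ?ltry.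
rewrite /lebesgue_step /pushforward.
have -> : @rV_cons R n @^-1` rV_cube (M : R) =
    (`[-M, M]%classic : set (measurableTypeR R)) `*`
     rV_cube M.
  apply/seteqP; split=> [[t v] h|[t v] [/= ht hv] i]; last first.
    rewrite mxE; case: unliftP => [j _|_] //=; exact: hv.
  split; first by have := h ord0; rewrite /= mxE unlift_none.
  by move=> i; have := h (lift ord0 i); rewrite /= mxE liftK.
rewrite product_measure1E//; last exact: measurable_rV_box.
have M_lty : (@lebesgue_measure R `[(- M)%R, M]%classic < +oo)%E.
  by rewrite lebesgue_measure_itv/=; case: ifP => //; rewrite -EFinB ltry.
by rewrite lte_mul_pinfty// ge0_fin_numE.
Qed.

Lemma bounded_lebesgue_rV_lty n (A : set 'rV[R]_n) :
  measurable A -> bounded_set A -> (mu n A < +oo)%E.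
Proof.
move=> mA /bounded_sub_box[M _ AM].
apply: le_lt_trans (lebesgue_rV_itv_lty n M).
by apply: le_measure; rewrite ?inE//; exact: measurable_rV_box.
Qed.

Lemma frob_rV n (x h : 'rV[R]_n) : frob x h = \sum_j x ord0 j * h ord0 j.
Proof. by rewrite /frob big_ord1. Qed.

Lemma continuous_frobl n (h : 'rV[R]_n) : continuous (fun x => frob x h).
Proof.
rewrite (_ : (fun x => _) = fun x : 'rV[R]_n => \sum_j x ord0 j * h ord0 j).
  apply: continuous_sum => j _ x.
  apply: (@continuousM _ _ (fun y : 'rV[R]_n => y ord0 j) (cst (h ord0 j))).
    exact: coord_continuous.
  exact: cst_continuous.
by apply/funext => x; rewrite frob_rV.
Qed.

Definition hyperplane n (h : 'rV[R]_n) c : set 'rV[R]_n :=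
  [set x | frob x h = c].

Lemma measurable_hyperplane n (h : 'rV[R]_n) c : measurable (hyperplane h c).
Proof.
rewrite (_ : hyperplane _ _ = setT `&` (fun x => frob x h) @^-1` [set c]).
  by apply: (continuous_measurable_rV (@continuous_frobl n h)).
by rewrite setTI.
Qed.

(** Fubini and induction on the dimension. If the first entry of h is zero, fixing the first
    coordinate leaves a hyperplane of lower dimension; otherwise, fixing the other coordinates
    leaves a single point of the line. *)
Lemma lebesgue_rV_hyperplane n (h : 'rV[R]_n) c :
  h != 0 -> mu n (hyperplane h c) = 0%E.
Proof.
elim: n h c => [|n IH] h c h0.
  by case/negP: h0; apply/eqP/rowP => -[].
have frob_cons t y : frob (rV_cons (t, y)) h =
    t * h ord0 ord0 + frob y (\row_i h ord0 (lift ord0 i)).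
  rewrite !frob_rV big_ord_recl !mxE unlift_none /=; congr +%R.
  by apply: eq_bigr => i _; rewrite !mxE liftK.
have mH : measurable (@rV_cons R n @^-1` hyperplane h c).
  rewrite -[X in measurable X]setTI; apply: measurable_rV_cons => //.
  exact: measurable_hyperplane.
rewrite /= /lebesgue_step /pushforward.
set h' := \row_i h ord0 (lift ord0 i) in frob_cons.
have [h00|h00] := eqVneq (h ord0 ord0) 0.
  have h'0 : h' != 0.
    apply: contra_neq h0 => h'0; apply/rowP => i; rewrite mxE.
    have [j ->|->] := unliftP ord0 i; last exact: h00.
    by move/rowP/(_ j): h'0; rewrite !mxE.
  rewrite /product_measure1 integral0_eq// => t _ /=.
  rewrite -[RHS](IH h' c h'0); congr (mu n _); apply/seteqP; split=> y /=;
  by rewrite /xsection/= inE/= /hyperplane /= frob_cons h00 mulr0 add0r.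
(* Uniqueness of the product measure exchanges the order of integration, so that the sections in the
   first coordinate can be measured. *)
rewrite (@product_measure_unique _ _ _ _ R (@lebesgue_measure R) (mu n)
  (product_measure2 (@lebesgue_measure R) (mu n)))//.
  rewrite /= /product_measure2 integral0_eq// => y _ /=.
  rewrite (_ : ysection _ _ = [set (c - frob y h') / h ord0 ord0]).
    exact: lebesgue_measure_set1.
  apply/seteqP; split=> t /=; rewrite /ysection/= inE/= /hyperplane /= frob_cons.
    by move=> <-; rewrite addrK mulfK.
  by move=> ->; rewrite divfK// subrK.
by move=> A B mA mB; rewrite /= product_measure2E.
Qed.

End lebesgue_rV_lemmas.

(** * Polyhedral meshes: the skeleton is a null set *)

Section mesh.
Context (R : realType) (d : nat).
Local Notation mu := (@lebesgue_rV R d).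
Implicit Types hs : seq ('rV[R]_d * R).

(** Zero normals are excluded because their hyperplane may be the whole space; such a constraint
    holds everywhere or nowhere and contributes no face. *)
Definition active_faces hs : set 'rV[R]_d :=
  [set x | exists2 h, h \in hs & h.1 != 0 /\ hyperplane h.1 h.2 x].

Lemma negligible_active_faces hs : mu.-negligible (active_faces hs).
Proof.
elim: hs => [|h hs IH].
  by rewrite (_ : active_faces _ = set0); [exact: negligible_set0|
    apply/seteqP; split=> // x []].
have : mu.-negligible ([set x | h.1 != 0 /\ hyperplane h.1 h.2 x] `|`
    active_faces hs).
  apply: negligibleU => //; have [h0|h0] := eqVneq h.1 0.
    apply: (@negligibleS _ _ _ _ set0) => [x []//|].
    exact: negligible_set0.
  apply: (@negligibleS _ _ _ _ (hyperplane h.1 h.2)) => [x []//|].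
  apply/negligibleP; first exact: measurable_hyperplane.
  exact: lebesgue_rV_hyperplane.
apply: negligibleS => x [g]; rewrite inE => /orP[/eqP ->|ghs] gx; first by left.
by right; exists g.
Qed.

Lemma closed_halfspaces hs : closed (halfspaces hs).
Proof.
rewrite (_ : halfspaces hs = \bigcap_(h in [set` hs]) [set x | frob x h.1 <= h.2]).
  apply: closed_bigI => h _.
  apply: (@closed_comp _ _ (fun x => frob x h.1) [set y | y <= h.2]).
    by move=> x _; exact: continuous_frobl.
  exact: closed_le.
by apply/seteqP; split=> x hx h; exact: hx.
Qed.

(** Off the faces every constraint with nonzero normal is strict and persists nearby by continuity;
    a constraint with zero normal does not depend on the point. *)
Lemma nbhs_halfspaces hs x : halfspaces hs x -> ~ active_faces hs x ->
  nbhs x (halfspaces hs).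
Proof.
move=> hx nx.
have : forall h, h \in hs -> nbhs x [set y | frob y h.1 <= h.2].
  move=> h hhs; have hxh := hx h hhs; have [h0|h0] := eqVneq h.1 0.
    have fr0 (y : 'rV[R]_d) : frob y h.1 = 0.
      by rewrite frob_rV h0 big1// => j _; rewrite mxE mulr0.
    by apply: filterE => y /=; rewrite fr0 -(fr0 x).
  have xlt : frob x h.1 < h.2.
    rewrite lt_neqAle hxh andbT; apply/eqP => xh.
    by apply: nx; exists h.
  have : nbhs x ((fun y => frob y h.1) @^-1` [set z | z < h.2]).
    by apply: (@continuous_frobl R d h.1 x); exact: lt_nbhsl.
  by apply: filterS => y /= /ltW.
move=> {hx nx} hn; elim: hs hn => [|h hs IH] hn; first exact: filterE.
have h1 := hn h (mem_head _ _).
have h2 : nbhs x (halfspaces hs).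
  by apply: IH => g ghs; apply: hn; rewrite inE ghs orbT.
apply: filterS2 h1 h2 => y hy hhs g; rewrite inE => /orP[/eqP ->//|].
exact: hhs.
Qed.

Lemma polyhedral_open (T : set 'rV[R]_d) : polyhedral T -> open T.
Proof. by move=> [_ _ [Ps [_ ->]]]; exact: open_interior. Qed.

(** T is the interior of a closed finite union of polytopes. A point of the closure outside T lies
    in one of these polytopes but is not interior to it, hence sits on one of finitely many
    hyperplanes. *)
Lemma negligible_frontier_polyhedral (T : set 'rV[R]_d) : polyhedral T ->
  mu.-negligible (closure T `\` T).
Proof.
move=> [_ _ [Ps [_ TE]]].
pose P := [set x | exists2 hs, hs \in Ps & halfspaces hs x].
have cP : closed P.
  rewrite (_ : P = \bigcup_(hs in [set` Ps]) halfspaces hs).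
    apply: closed_bigcup => [|hs _]; [exact: finite_seq|exact: closed_halfspaces].
  by apply/seteqP; split=> x [hs]; exists hs.
apply: negligibleS _ (negligible_active_faces (flatten Ps)) => x [cTx nTx].
have [hs hsP hx] : P x.
  have TP : T `<=` P by rewrite TE; exact: interior_subset.
  by rewrite ((closure_id _).1 cP); exact: closure_subset cTx.
have [[h hhs hh]|nx] := pselect (active_faces hs x).
  by exists h => //; apply/flattenP; exists hs.
exfalso; apply: nTx; rewrite TE.
by apply: filterS (nbhs_halfspaces hx nx) => y hy; exists hs.
Qed.

(** The closed elements cover Om, so an uncovered point lies on one of finitely many null
    frontiers. *)
Lemma regular_mesh_ae K Om (T : 'I_K -> set 'rV[R]_d) : regular_mesh Om T ->
  {ae mu, forall x, Om x -> (\bigcup_i T i) x}.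
Proof.
move=> [polT _ cOm].
have : mu.-negligible (\big[setU/set0]_(i < K) (closure (T i) `\` T i)).
  elim/big_ind : _ => [|A B|i _].
  - exact: negligible_set0.
  - exact: negligibleU.
  - by apply: negligible_frontier_polyhedral; case: (polT i).
apply: negligibleS => x /= /not_implyP[Omx nTx].
have : (\bigcup_i closure (T i)) x by rewrite -cOm; exact: subset_closure.
move=> [i _ cTx]; rewrite -(bigcup_pred (T := 'I_K) xpredT); exists i => //.
by split=> // Tx; apply: nTx; exists i.
Qed.

End mesh.

(** * Smooth bump functions *)

Section smooth_real_functions.
Context (R : realType).
Implicit Types (f g : R -> R) (p : {poly R}).

Lemma is_derive_continuous f (f' : R -> R) :
  (forall x : R, is_derive x (1 : R) f (f' x)) -> continuous f.
Proof.
move=> fd x; apply/differentiable_continuous/derivable1_diffP.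
by case: (fd x).
Qed.

(** The derivative is an existential witness, so closure under sums, products and affine changes of
    variable follows by induction on k from the one-step rules. *)
Fixpoint Ck (k : nat) f : Prop :=
  if k is k'.+1 then exists2 f', forall x : R, is_derive x (1 : R) f (f' x) & Ck k' f'
  else continuous f.

Lemma CkW k f : Ck k.+1 f -> Ck k f.
Proof.
elim: k f => [|k IH] f [f' fd f'C]; first exact: is_derive_continuous fd.
by exists f' => //; exact: IH.
Qed.

Lemma CkD k f g : Ck k f -> Ck k g -> Ck k (f \+ g).
Proof.
elim: k f g => [|k IH] f g.
  by move=> cf cg x; apply: cvgD; [exact: cf|exact: cg].
move=> [f' fd f'C] [g' gd g'C]; exists (f' \+ g'); last exact: IH.
by move=> x; exact: is_deriveD.
Qed.

Lemma CkM k f g : Ck k f -> Ck k g -> Ck k (f \* g).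
Proof.
elim: k f g => [|k IH] f g.
  by move=> cf cg x; apply: cvgM; [exact: cf|exact: cg].
move=> fC gC; have [f' fd f'C] := fC; have [g' gd g'C] := gC.
exists ((f \* g') \+ (g \* f')).
  move=> x; exact: is_deriveM.
by apply: CkD; apply: IH => //; exact: CkW.
Qed.

Lemma Ck_cst k (c : R) : Ck k (fun=> c).
Proof.
elim: k c => [|k IH] c; first exact: cst_continuous.
by exists (fun=> 0) => [x|]; [exact: is_derive_cst|exact: IH].
Qed.

Lemma Ck_affine k f a b : Ck k f -> Ck k (fun x => f (a * x + b)).
Proof.
elim: k f => [|k IH] f.
  move=> cf x; apply: (@continuous_comp _ _ _ (fun x => a * x + b) f); last exact: cf.
  by apply: cvgD; [apply: cvgMl_tmp; exact: cvg_id|exact: cvg_cst].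
move=> [f' fd f'C]; exists ((fun=> a) \* (fun x => f' (a * x + b))).
  move=> x /=; rewrite mulrC.
  apply: (@is_derive1_comp _ f (fun x => a * x + b)) => //.
  have := is_deriveD (is_deriveZ a (is_derive_id x (1 : R))) (is_derive_cst b x (1 : R)).
  by rewrite addr0 [_ *: 1]mulr1.
by apply: CkM; [exact: Ck_cst|exact: IH].
Qed.

Definition smooth1 f := forall k, Ck k f.

Lemma smooth1_derivable f (x : R) : smooth1 f -> derivable f x (1 : R).
Proof. by move=> /(_ 1) [f' fd _]; case: (fd x). Qed.

Lemma smooth1_continuous f : smooth1 f -> continuous f.
Proof. by move/(_ 0). Qed.

Lemma smooth1_derive f : smooth1 f -> smooth1 ('D_(1 : R) f).
Proof.
move=> fs k; have [f' fd f'C] := fs k.+1.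
suff -> : 'D_(1 : R) f = f' by [].
by apply/funext => x; by case: (fd x).
Qed.

(* The functions [p(1/t) exp(-1/t)], extended by zero to [t <= 0]; this family
   is stable under differentiation. *)
Definition flat p (t : R) : R :=
  if 0 < t then p.[t^-1] * expR (- t^-1) else 0.

(** With s = 1/t, the inequality s^(i+1)/(i+1)! <= exp s bounds the i-th term by |p_i| (i+1)! t. The
    linear decay at 0 is what makes the difference quotient there vanish in the limit. *)
Lemma flat_bound p : exists K, forall t, `|flat p t| <= K * `|t|.
Proof.
exists (\sum_(i < size p) `|p`_i| * i.+1`!%:R) => t; rewrite /flat.
have [t0|t0] := ltP 0 t; last by rewrite normr0 mulr_ge0// sumr_ge0.
rewrite horner_coef mulr_suml (le_trans (ler_norm_sum _ _ _))//.
rewrite [leRHS]mulr_suml; apply: ler_sum => i _.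
rewrite !normrM -!mulrA ler_wpM2l// (gtr0_norm t0).
have s0 : 0 < t^-1 by rewrite invr_gt0.
rewrite !ger0_norm ?expR_ge0 ?exprn_ge0 ?(ltW s0)//.
have := expR_ge1Dxn i (ltW s0); rewrite expRN; set e := expR _ => he.
have e0 : 0 < e by exact: expR_gt0.
rewrite ler_pdivrMr//.
have fi0 : (0 : R) < i.+1`!%:R by rewrite ltr0n fact_gt0.
have {}he : t^-1 ^+ i.+1 <= i.+1`!%:R * e.
  by rewrite mulrC -ler_pdivrMr// (le_trans _ he)// lerDr.
by rewrite -mulrA [t * e]mulrC mulrA -ler_pdivrMr// -exprSr.
Qed.

(** For t > 0 the chain rule gives (p(1/t) - p'(1/t)) / t^2 times exp(-1/t), whence the polynomial
    X^2 (p - p'). *)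
Lemma is_derive_flat p (x : R) :
  is_derive x (1 : R) (flat p) (flat ('X^2 * (p - p^`())) x).
Proof.
have [x0|x0|->] := ltgtP x 0.
- rewrite [X in is_derive _ _ _ X]/flat ltNge (ltW x0)/=.
  apply: (@near_eq_is_derive _ _ _ (cst (0 : R))).
  near=> y; rewrite /flat ltNge (_ : y <= 0)//.
  by apply: ltW; near: y; exact: lt_nbhsl.
- rewrite [X in is_derive _ _ _ X]/flat x0.
  apply: (@near_eq_is_derive _ _ _ (fun t : R => p.[t^-1] * expR (- t^-1))).
    by near=> y; rewrite /flat (_ : 0 < y)//; near: y; exact: lt_nbhsr.
  have xV : is_derive x (1 : R) (fun y : R => y^-1) (- x ^- 2 *: 1).
    by apply: is_deriveV; rewrite gt_eqF.
  have pd : is_derive x (1 : R) (horner p \o GRing.inv) (p^`().[x^-1] * (- x ^- 2 *: 1)).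
    have hp := derivableP (@derivable_horner R p x^-1).
    by apply: (@is_derive1_comp _ (horner p) GRing.inv); rewrite derivE derive1E.
  have ed : is_derive x (1 : R) (expR \o (fun y => - y^-1))
      (expR (- x^-1) * - (- x ^- 2 *: 1)).
    by apply: (@is_derive1_comp _ expR (fun y => - y^-1)); exact: is_deriveN.
  apply: (is_derive_eq (is_deriveM pd ed)).
  rewrite hornerM hornerD hornerN !hornerE /=.
  rewrite /GRing.scale /= exprVn; ring.
- rewrite [X in is_derive _ _ _ X]/flat ltxx.
  have [K hK] := flat_bound ('X * p).
  have lim0 : h^-1 *: (flat p (h *: 1 + 0) - flat p 0) @[h --> 0^'] --> (0 : R).
    (* Dividing by h amounts to multiplying p by X, so the difference quotient at 0 is again a flat
       function and tends to 0 by the linear bound. *)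
    rewrite (_ : (fun h => _) = flat ('X * p)); last first.
      apply/funext => h; rewrite /flat ltxx subr0 addr0 [h *: 1]mulr1.
      by case: ifP => _; rewrite /GRing.scale /= ?mulr0// hornerM hornerX mulrA.
    apply/cvgr0Pnorm_le => e e0.
    have K1 : 0 < `|K| + 1 by rewrite ltr_wpDl.
    near=> h; rewrite (le_trans (hK h))//.
    rewrite (@le_trans _ _ ((`|K| + 1) * `|h|))//.
      by rewrite ler_wpM2r// (le_trans (ler_norm K))// lerDl.
    rewrite mulrC -ler_pdivlMr//; near: h.
    apply: nbhs_dnbhs; apply/nbhs_ballP; exists (e / (`|K| + 1)); first exact: divr_gt0.
    by move=> h; rewrite /ball /= sub0r normrN => /ltW.
  apply: DeriveDef; last exact: cvg_lim lim0.
  by apply/cvg_ex; exists 0.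
Unshelve. all: by end_near. Qed.

Lemma smooth1_flat p : smooth1 (flat p).
Proof.
move=> k; elim: k p => [|k IH] p /=.
  exact: is_derive_continuous (is_derive_flat p).
by exists (flat ('X^2 * (p - p^`()))); [exact: is_derive_flat|exact: IH].
Qed.

(** Equals exp(-1/(t-l) - 1/(r-t)) on ]l, r[ and 0 elsewhere; the arguments are spelled a t + b to
    match [Ck_affine]. *)
Definition bump1 (l r : R) : R -> R :=
  (fun t => flat 1 (1 * t + - l)) \* (fun t => flat 1 ((-1) * t + r)).

Lemma smooth1_bump1 l r : smooth1 (bump1 l r).
Proof. by move=> k; apply: CkM; apply: Ck_affine; exact: smooth1_flat. Qed.

Lemma bump1_gt0 l r t : l < t -> t < r -> 0 < bump1 l r t.
Proof.
move=> lt tr; rewrite /bump1 /= /flat !hornerC !mul1r mulN1r subr_gt0 lt.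
by rewrite [- t + r]addrC subr_gt0 tr mulr_gt0// expR_gt0.
Qed.

Lemma bump1_eq0 l r t : ~~ (l < t < r) -> bump1 l r t = 0.
Proof.
rewrite negb_and /bump1 /= /flat (mul1r t) mulN1r [- t + r]addrC !subr_gt0.
by case/orP => /negbTE ->; rewrite ?mul0r ?mulr0.
Qed.

End smooth_real_functions.

(** * Partial derivatives *)

(** Both sides have the same difference quotient. One-variable calculus, such as the mean value
    theorem, thus applies to directional derivatives without total differentiability. *)
Lemma is_derive_line (R : realType) (V : normedModType R) (f : V -> R)
    (x v : V) (t df : R) :
  is_derive (t *: v + x) v f df <->
  is_derive t (1 : R) (fun h => f (h *: v + x)) df.
Proof.
have E : (fun h : R => h^-1 *: ((f \o shift (t *: v + x)) (h *: v) -
      f (t *: v + x))) =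
    (fun h : R => h^-1 *: (((fun h => f (h *: v + x)) \o shift t) (h *: (1 : R)) -
      f (t *: v + x))).
  by apply/funext => h /=; rewrite [h *: 1]mulr1 scalerDl addrA.
split=> -[dfx <-]; apply: DeriveDef; move: dfx; rewrite /derivable /derive.
- by rewrite E.
- by rewrite E.
- by rewrite E.
- by rewrite E.
Qed.

Section partial.
Context (R : realType) (d : nat).
Implicit Types (f g : 'rV[R]_d -> R) (x : 'rV[R]_d) (i j : 'I_d) (s : seq 'I_d).
Local Notation e_ i := (delta_mx ord0 i : 'rV[R]_d).

Lemma smooth_continuous f : smooth f -> continuous f.
Proof. by move/(_ [::]) => -[]. Qed.

Lemma smooth_partial i f : smooth f -> smooth (partial i f).
Proof. by move=> fs s; have := fs (rcons s i); rewrite foldr_rcons. Qed.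

Lemma smooth_is_derive f i x : smooth f -> is_derive x (e_ i) f (partial i f x).
Proof. by move=> /(_ [::])[_ /(_ i x)]; exact: derivableP. Qed.

Lemma smooth_line f i x t : smooth f ->
  is_derive t (1 : R) (fun h => f (h *: e_ i + x)) (partial i f (t *: e_ i + x)).
Proof.
by move=> fs; apply: (is_derive_line f x (e_ i) t _).1; exact: smooth_is_derive.
Qed.

Lemma smoothZ c f : smooth f -> smooth (fun x => c * f x).
Proof.
move=> fs; have E s : foldr (@partial R d) (fun x => c * f x) s =
    (fun x => c * foldr (@partial R d) f s x).
  elim: s => [//|i s IH] /=; rewrite IH; apply/funext => x.
  by rewrite /partial (@deriveZ _ _ _ (foldr (@partial R d) f s) c)//; case: (fs s).
move=> s; rewrite E; have [cf df] := fs s; split=> [x|i x].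
  by apply: continuousM; [exact: cst_continuous|exact: cf].
exact: (@derivableZ _ _ _ (foldr (@partial R d) f s) c).
Qed.

Lemma MVT_line f i x h : smooth f -> 0 < h -> exists2 c, 0 < c < h &
  f (h *: e_ i + x) - f x = h * partial i f (c *: e_ i + x).
Proof.
move=> fs h0; have := @MVT R (fun t => f (t *: e_ i + x))
  (fun t => partial i f (t *: e_ i + x)) 0 h h0.
case=> [t _|t|c]; first exact: smooth_line.
- apply: continuous_subspaceT => {}t; have := smooth_line i x t fs.
  by move=> [df _]; apply/differentiable_continuous/derivable1_diffP.
- rewrite in_itv/= => c0h; rewrite scale0r add0r subr0 => ->.
  by exists c => //; rewrite mulrC.
Qed.

(** The mean value theorem is used twice: in direction i for the increment of f along e_j, then in
    direction j for the partial derivative so obtained. *)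
Lemma second_difference f i j x h : smooth f -> 0 < h ->
  exists p : R * R, [/\ 0 < p.1 < h, 0 < p.2 < h &
    f (h *: e_ i + (h *: e_ j + x)) - f (h *: e_ j + x) -
    (f (h *: e_ i + x) - f x) =
    h * (h * partial j (partial i f) (p.2 *: e_ j + (p.1 *: e_ i + x)))].
Proof.
move=> fs h0.
pose g t := f (t *: e_ i + (h *: e_ j + x)) - f (t *: e_ i + x).
pose g' t := partial i f (t *: e_ i + (h *: e_ j + x)) -
  partial i f (t *: e_ i + x).
have gd (t : R) : is_derive t (1 : R) g (g' t).
  by apply: is_deriveB; exact: smooth_line.
have [|c] := @MVT R g g' 0 h h0 (fun t _ => gd t).
  apply: continuous_subspaceT => t; have := gd t.
  by move=> [df _]; apply/differentiable_continuous/derivable1_diffP.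
rewrite in_itv/= subr0 => c0h gE.
have [c' c'0h fE] := MVT_line j (c *: e_ i + x) (smooth_partial i fs) h0.
exists (c, c'); split => //=; rewrite -fE mulrC.
transitivity (g h - g 0); first by rewrite /g !scale0r !add0r; ring.
by rewrite gE /g' addrCA.
Qed.

(** Schwarz's theorem. The second difference is symmetric in i and j, so the two mixed derivatives
    agree at two points close to x; their continuity at x does the rest. *)
Lemma partialC f i j : smooth f ->
  partial i (partial j f) = partial j (partial i f).
Proof.
move=> fs; apply/funext => x; apply/eqP; rewrite -subr_eq0 -normr_le0.
apply/ler_addgt0Pl => e e0; rewrite addr0.
have cij : continuous (partial i (partial j f)).
  exact/smooth_continuous/smooth_partial/smooth_partial.
have cji : continuous (partial j (partial i f)).
  exact/smooth_continuous/smooth_partial/smooth_partial.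
have e2 : 0 < e / 2 by exact: divr_gt0.
have /cvgrPdist_lt/(_ _ e2)/nbhs_ballP[r1 /= r10 h1] := cij x.
have /cvgrPdist_lt/(_ _ e2)/nbhs_ballP[r2 /= r20 h2] := cji x.
(* Two displacements smaller than h move each coordinate by less than 2h, even when i = j; hence the
   division by 2. *)
pose h := Num.min r1 r2 / 2.
have h0 : 0 < h by rewrite divr_gt0// lt_min r10.
have near_x a b r k l : 0 < a < h -> 0 < b < h -> h * 2 <= r ->
    ball x r (a *: e_ k + (b *: e_ l + x)).
  move=> /andP[a0 ah] /andP[b0 bh] hr; split.
    by rewrite (lt_le_trans _ hr)// mulr_gt0.
  move=> u v; rewrite !mxE /ball /=.
  rewrite (_ : forall X A B : R, X - (A + (B + X)) = - (A + B)); last first.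
    by move=> X A B; ring.
  rewrite normrN.
  have d01 (w : 'I_d) : `|((u == ord0) && (v == w))%:R : R| <= 1.
    by case: (_ && _); rewrite ?normr1// normr0.
  rewrite (le_lt_trans (ler_normD _ _))// !normrM (gtr0_norm a0) (gtr0_norm b0).
  have := d01 k; have := d01 l.
  move: (`|_%:R|) => y; move: (`|_%:R|) => z; nra.
have [p [p1 p2 pE]] := second_difference i j x fs h0.
have [q [q1 q2 qE]] := second_difference j i x fs h0.
have h1' := h1 _ (near_x _ _ r1 i j q2 q1 _).
have h2' := h2 _ (near_x _ _ r2 j i p2 p1 _).
move: h1' h2' pE qE; rewrite [h *: e_ j + (h *: e_ i + x)]addrCA.
move: (partial j (partial i f) x) (partial i (partial j f) x) => v u.
move: (partial j _ _) (partial i _ _) => w' w.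
have hr1 : h * 2 <= r1 by rewrite /h divfK ?pnatr_eq0// ge_min lexx.
have hr2 : h * 2 <= r2 by rewrite /h divfK ?pnatr_eq0// ge_min lexx orbT.
move=> /(_ hr1) a2 /(_ hr2) a1 pE qE.
have E : w' = w.
  by apply: (mulfI (lt0r_neq0 h0)); apply: (mulfI (lt0r_neq0 h0)); lra.
rewrite E in a1.
have -> : u - v = (u - w) - (v - w) by ring.
rewrite (le_trans (ler_normB _ _))// (splitr e) lerD// ltW//.
Qed.

Lemma test_fun_continuous D f : test_fun D f -> continuous f.
Proof. by move=> [/smooth_continuous]. Qed.

Lemma partial_support (K : set 'rV[R]_d) i f : closed K ->
  (forall x, ~ K x -> f x = 0) -> forall x, ~ K x -> partial i f x = 0.
Proof.
move=> cK f0 x Kx; rewrite /partial.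
rewrite (@near_eq_derive _ _ _ f (cst (0 : R))) ?derive_cst//.
have : nbhs x (~` K) by apply: open_nbhs_nbhs; split=> //; exact: closed_openC.
by apply: filterS => y /f0.
Qed.

Lemma test_fun_partial D i f : test_fun D f -> test_fun D (partial i f).
Proof.
move=> [fs [K [cK KD] f0]]; split; first exact: smooth_partial.
exists K; first by split.
by apply: partial_support => //; apply: compact_closed => //; exact: norm_hausdorff.
Qed.

Lemma test_funZ D c f : test_fun D f -> test_fun D (fun x => c * f x).
Proof.
move=> [fs [K cK f0]]; split; first exact: smoothZ.
by exists K => // x /f0 ->; rewrite mulr0.
Qed.

Lemma test_funS D D' f : D `<=` D' -> test_fun D f -> test_fun D' f.
Proof.
by move=> DD' [fs [K [cK KD] f0]]; split=> //; exists K => //; split=> // x /KD/DD'.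
Qed.

Lemma test_fun_eq0 D f x : test_fun D f -> ~ D x -> f x = 0.
Proof. by move=> [_ [K [_ KD] f0]] Dx; apply: f0 => /KD. Qed.

Definition tensor (b : 'I_d -> R -> R) x := \prod_i b i (x ord0 i).

Lemma tensor_line b j x h : tensor b (h *: e_ j + x) =
  b j (h + x ord0 j) * \prod_(i | i != j) b i (x ord0 i).
Proof.
rewrite /tensor (bigD1 j)//= !mxE !eqxx mulr1; congr *%R.
by apply: eq_bigr => i ij; rewrite !mxE eqxx (negbTE ij) mulr0 add0r.
Qed.

(** Only the j-th factor varies along e_j, so a partial derivative of a tensor product is a tensor
    product; all iterated derivatives are thereby under control. *)
Lemma is_derive_tensor b j x : (forall i, smooth1 (b i)) ->
  is_derive x (e_ j) (tensor b)
    (tensor (fun i => if i == j then 'D_(1 : R) (b i) else b i) x).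
Proof.
move=> bs; rewrite -[x in is_derive x](add0r x) -{1}(scale0r (e_ j)).
apply: (is_derive_line (tensor b) x (e_ j) 0 _).2.
rewrite (_ : (fun h => _) = fun h : R => (b j \o shift (x ord0 j)) h *
    \prod_(i | i != j) b i (x ord0 i)); last first.
  by apply/funext => h; rewrite tensor_line.
rewrite /tensor [X in is_derive _ _ _ X](bigD1 j)//= eqxx.
have -> : \prod_(i | i != j) (if i == j then 'D_(1 : R) (b i) else b i) (x ord0 i)
    = \prod_(i | i != j) b i (x ord0 i) by apply: eq_bigr => i /negbTE ->.
set c := \prod_(i | _) _.
have /derivableP bd : derivable (b j) (0 + x ord0 j) (1 : R).
  exact: smooth1_derivable.
have bd' : is_derive (0 : R) (1 : R) (fun h => b j (h *: 1 + x ord0 j))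
    ('D_1 (b j) (0 + x ord0 j)).
  by apply: (is_derive_line (b j) (x ord0 j) (1 : R) 0 _).1; rewrite scale0r.
have prod_d := is_deriveM bd' (is_derive_cst c (0 : R) (1 : R)).
rewrite (_ : (fun h => _) = (fun h : R => b j (h *: 1 + x ord0 j)) * cst c).
  by apply: (is_derive_eq prod_d); rewrite scaler0 !add0r; exact: mulrC.
by apply/funext => h; rewrite -[h in LHS]mulr1.
Qed.

Lemma continuous_tensor b : (forall i, continuous (b i)) -> continuous (tensor b).
Proof.
move=> bc; rewrite /tensor; elim: (index_enum _) => [|i r IH].
  rewrite (_ : (fun x => _) = fun=> 1); first exact: cst_continuous.
  by apply/funext => x; rewrite big_nil.
rewrite (_ : (fun x => _) = fun x : 'rV[R]_d =>
    b i (x ord0 i) * \prod_(i <- r) b i (x ord0 i)) => [x|].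
  apply: continuousM; last exact: IH.
  by apply: continuous_comp; [exact: coord_continuous|exact: bc].
by apply/funext => x; rewrite big_cons.
Qed.

Lemma smooth_tensor b : (forall i, smooth1 (b i)) -> smooth (tensor b).
Proof.
move=> bs s.
have [b' bs' ->] : exists2 b', (forall i, smooth1 (b' i)) &
    foldr (@partial R d) (tensor b) s = tensor b'.
  elim: s => [|j s [b' b's IH]] /=; first by exists b.
  exists (fun i => if i == j then 'D_(1 : R) (b' i) else b' i).
    by move=> i; case: ifP => // _; exact: smooth1_derive.
  rewrite IH; apply/funext => x; rewrite /partial.
  by have [_ ->] := is_derive_tensor j x b's.
split; first by apply: continuous_tensor => i; exact: smooth1_continuous.
by move=> i x; have [] := is_derive_tensor i x bs'.
Qed.

Lemma smooth_tensor_bump (l r : 'I_d -> R) : smooth (tensor (fun i => bump1 (l i) (r i))).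
Proof. by apply: smooth_tensor => i; exact: smooth1_bump1. Qed.

End partial.

(** * Integration by parts *)

Section compactly_supported.
Context (R : realType).
Local Notation mu := (@lebesgue_rV R).

Lemma compact_rV_cube n (M : R) : compact (@rV_cube R n M).
Proof.
by apply: (@rV_compact _ _ (fun=> `[-M, M]%classic)) => _; exact: segment_compact.
Qed.

Lemma measurable_rV_cube n (M : R) : measurable (@rV_cube R n M).
Proof. exact: measurable_rV_box. Qed.

Lemma integrable_rV_cube n (M : R) (f : 'rV[R]_n -> R) : continuous f ->
  (forall x, ~ rV_cube M x -> f x = 0) -> (mu n).-integrable setT (EFin \o f).
Proof.
move=> cf f0.
have : (mu n).-integrable (rV_cube M) (EFin \o f).
  apply: measurable_bounded_integrable.
  - exact: measurable_rV_cube.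
  - exact: lebesgue_rV_itv_lty.
  - by apply: measurable_funTS; exact: continuous_measurable_rV.
  - have : compact (f @` rV_cube M).
      apply: continuous_compact; last exact: compact_rV_cube.
      exact: continuous_subspaceT.
    move=> /compact_bounded[B [Br hB]]; exists B; split=> // C BC x Mx.
    by apply: hB => //; exists x.
move=> /(integrable_mkcond _ (measurable_rV_cube _)); apply: eq_integrable => //.
move=> x _; rewrite patchE; case: ifPn => // /negP Mx.
by rewrite /= f0// => Mx'; apply: Mx; rewrite inE.
Qed.

Lemma rV_cons_cube n (M : R) t (y : 'rV[R]_n) :
  rV_cube M (rV_cons (t, y)) <-> `[-M, M]%classic t /\ rV_cube M y.
Proof.
split=> [h|[ht hy] i].
  split; first by have := h ord0; rewrite mxE unlift_none.
  by move=> i; have := h (lift ord0 i); rewrite mxE liftK.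
by rewrite mxE; case: unliftP => [j _|_] //=; exact: hy.
Qed.

Lemma rV_consD n (p q : R * 'rV[R]_n) h :
  rV_cons (h *: p + q) = h *: rV_cons p + rV_cons q.
Proof.
apply/rowP => i; rewrite !mxE; case: unlift => [j|] //=.
by rewrite !mxE.
Qed.

Lemma delta_rV_cons0 n : delta_mx ord0 ord0 = rV_cons (1, 0) :> 'rV[R]_n.+1.
Proof.
apply/rowP => i; rewrite !mxE /=; case: unliftP => [j ->|->] //=.
by rewrite mxE.
Qed.

Lemma delta_rV_cons n (j : 'I_n) :
  delta_mx ord0 (lift ord0 j) = rV_cons (0, delta_mx ord0 j) :> 'rV[R]_n.+1.
Proof.
apply/rowP => i; rewrite !mxE /=; case: unliftP => [k ->|->] //=.
by rewrite mxE (inj_eq lift_inj).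
Qed.

Lemma rV_cons_split n t (y : 'rV[R]_n) :
  rV_cons (t, y) = t *: rV_cons (1, 0) + rV_cons (0, y).
Proof.
rewrite -rV_consD; congr rV_cons; congr pair; rewrite /= ?scaler0 ?add0r//.
by rewrite addr0 [_ *: 1]mulr1.
Qed.

Lemma continuous_rV_cons n t : continuous (fun y : 'rV[R]_n => rV_cons (t, y)).
Proof.
move=> y A /nbhs_ballP[e /= e0 eA]; apply/nbhs_ballP; exists e => // z yz.
apply: eA; split=> // i j; rewrite !mxE /=.
by case: unlift => [k|] /=; [have [_] := yz; apply|exact: ballxx].
Qed.

Lemma integral_derive_compact (f g : R -> R) (M : R) : 0 < M ->
  (forall t : R, is_derive t (1 : R) f (g t)) -> continuous g ->
  (forall t, ~ `[-M, M]%classic t -> f t = 0) ->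
  (forall t, ~ `[-M, M]%classic t -> g t = 0) ->
  (\int[lebesgue_measure]_t (g t)%:E = 0)%E.
Proof.
move=> M0 fd cg f0 g0.
have cf : continuous f by exact: is_derive_continuous fd.
(* The interval is enlarged by 1 so that its end points lie outside the support, where f is 0 by
   hypothesis. *)
rewrite -(_ : \int[lebesgue_measure]_(t in `[(- (M + 1))%R, (M + 1)%R]) (g t)%:E = 0)%E.
  rewrite [RHS]integral_mkcond; apply: eq_integral => t _.
  rewrite patchE; case: ifPn => // /negP nt; rewrite g0// => tM; apply: nt.
  by move: tM; rewrite inE /= !in_itv/= => /andP[h1 h2]; apply/andP; split; lra.
rewrite (@continuous_FTC2 _ g f)//.
- by rewrite !f0 ?subee// /= in_itv/= => /andP[]; lra.
- lra.
- exact: continuous_subspaceT.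
- split; first by move=> t _; case: (fd t).
  + exact: cvg_at_right_filter (cf _).
  + exact: cvg_at_left_filter (cf _).
- by move=> t _; rewrite derive1E; case: (fd t).
Qed.

(** Fubini and induction on the dimension: for the first coordinate the inner integral vanishes by
    the fundamental theorem of calculus, for another one the first coordinate is frozen. Assuming
    only a derivative g in direction i keeps the hypotheses stable under slicing. *)
Lemma integral_partial0 n (f g : 'rV[R]_n -> R) (i : 'I_n) (M : R) : 0 < M ->
  (forall x, is_derive x (delta_mx ord0 i : 'rV[R]_n) f (g x)) ->
  continuous g ->
  (forall x, ~ rV_cube M x -> f x = 0) ->
  (forall x, ~ rV_cube M x -> g x = 0) ->
  (\int[mu n]_x (g x)%:E = 0)%E.
Proof.
move=> M0; elim: n f g i => [|n IH] f g i fd cg f0 g0; first by case: i fd.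
have mg : measurable_fun setT (EFin \o g).
  by apply/measurable_EFinP; exact: continuous_measurable_rV.
have ig := integrable_rV_cube cg g0.
have mcons := @measurable_rV_cons R n.
have igc : ((@lebesgue_measure R) \x mu n)%E.-integrable setT
    ((EFin \o g) \o @rV_cons R n).
  apply/integrableP; split; first exact: measurableT_comp mg mcons.
  have /integrableP[_] := ig.
  rewrite (ge0_integral_pushforward mcons)//; last exact: measurableT_comp.
rewrite (integral_pushforward mcons)// preimage_setT.
have [j ij|i0] := unliftP ord0 i.
  rewrite -integral12_prod_meas1//= /fubini_F integral0_eq// => t _ /=.
  apply: (IH (fun y => f (rV_cons (t, y))) (fun y => g (rV_cons (t, y))) j).
  - move=> y.
    have := fd (rV_cons (t, y)); rewrite ij delta_rV_cons => fdy.
    have E h : rV_cons (t, h *: delta_mx ord0 j + y) =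
        h *: rV_cons (0, delta_mx ord0 j) + rV_cons (t, y).
      by rewrite -rV_consD; congr rV_cons; congr pair; rewrite /= scaler0 add0r.
    rewrite -[y in is_derive y](add0r y) -(scale0r (delta_mx ord0 j)).
    apply: (is_derive_line (fun y => f (rV_cons (t, y))) y _ 0 _).2.
    under eq_fun do rewrite E.
    apply: (is_derive_line f (rV_cons (t, y)) _ 0 _).1.
    by rewrite scale0r add0r.
  - by move=> y; apply: continuous_comp; [exact: continuous_rV_cons|exact: cg].
  - by move=> y My; apply: f0 => /rV_cons_cube[_].
  - by move=> y My; apply: g0 => /rV_cons_cube[_].
rewrite -integral21_prod_meas1//= /fubini_G integral0_eq// => y _ /=.
apply: (@integral_derive_compact (fun t => f (rV_cons (t, y)))
  (fun t => g (rV_cons (t, y))) M) => //.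
- move=> t; under eq_fun do rewrite rV_cons_split.
  apply: (is_derive_line f (rV_cons (0, y)) _ t _).1.
  by rewrite -rV_cons_split -delta_rV_cons0 -i0.
- move=> t; under eq_fun do rewrite rV_cons_split.
  apply: (@continuous_comp _ _ _ (fun t : R => t *: rV_cons (1, 0) + rV_cons (0, y)) g).
    by apply: cvgD; [apply: cvgZr_tmp; exact: cvg_id|exact: cvg_cst].
  exact: cg.
- by move=> t Mt; apply: f0 => /rV_cons_cube[].
- by move=> t Mt; apply: g0 => /rV_cons_cube[].
Qed.

End compactly_supported.

Section integration_by_parts.
Context (R : realType) (d : nat).
Local Notation mu := (@lebesgue_rV R d).
Implicit Types (f g : 'rV[R]_d -> R) (D : set 'rV[R]_d) (i : 'I_d).

Lemma test_fun_cube D f : test_fun D f ->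
  exists2 M : R, 0 < M & forall x, ~ rV_cube M x -> f x = 0.
Proof.
move=> [_ [K [cK _] f0]].
have [M M0 KM] := bounded_sub_box (compact_bounded cK).
by exists M => // x Mx; apply: f0 => /KM.
Qed.

Lemma ip_setT D f g : (forall x, ~ D x -> f x = 0) -> ip D f g = ip setT f g.
Proof.
move=> f0; rewrite /ip Rintegral_mkcond; congr (fine _).
apply: eq_integral => x _; rewrite patchE; case: ifPn => // /negP Dx.
by rewrite f0 ?mul0r// => Dx'; apply: Dx; rewrite inE.
Qed.

Lemma ipC D f g : ip D f g = ip D g f.
Proof. by congr (fine _); apply: eq_integral => x _; rewrite mulrC. Qed.

(** The derivative of f g has zero integral over the whole space, and both integrands vanish outside
    D, so no boundary term appears. *)
Lemma ip_partial D i f g : test_fun D f -> test_fun D g ->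
  ip D (partial i f) g = - ip D f (partial i g).
Proof.
move=> tf tg; have tif := test_fun_partial i tf; have tig := test_fun_partial i tg.
rewrite !ip_setT; [|by move=> x; exact: test_fun_eq0 tf|
  by move=> x; exact: test_fun_eq0 tif].
have [M M0 fM] := test_fun_cube tf; have [M' M'0 f'M] := test_fun_cube tif.
have MM x : ~ rV_cube (Num.max M M') x -> ~ rV_cube M x /\ ~ rV_cube M' x.
  by move=> h; split=> h'; apply: h => j; move: (h' j); rewrite /= !in_itv/=;
    rewrite -!ler_norml le_max => ->; rewrite ?orbT.
have int1 : mu.-integrable setT (EFin \o (fun x => partial i f x * g x)).
  apply: (@integrable_rV_cube _ _ (Num.max M M')) => [x|x /MM[_ h]].
    apply: continuousM; first exact: test_fun_continuous tif x.
    exact: test_fun_continuous tg x.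
  by rewrite f'M// mul0r.
have int2 : mu.-integrable setT (EFin \o (fun x => f x * partial i g x)).
  apply: (@integrable_rV_cube _ _ (Num.max M M')) => [x|x /MM[h _]].
    apply: continuousM; first exact: test_fun_continuous tf x.
    exact: test_fun_continuous tig x.
  by rewrite fM// mul0r.
apply/eqP; rewrite -addr_eq0; apply/eqP.
rewrite /ip -RintegralD//.
suff E : (\int[mu]_x (partial i f x * g x + f x * partial i g x)%:E = 0)%E.
  by rewrite /Rintegral E.
apply: (@integral_partial0 _ _ (fun x => f x * g x) _ i (Num.max M M')).
- by rewrite lt_max M0.
- move=> x; rewrite addrC [partial i f x * _]mulrC.
  by apply: is_deriveM; apply: smooth_is_derive; [case: tf|case: tg].
- move=> x; apply: (@continuousD _ _ _ (fun x => partial i f x * g x)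
    (fun x => f x * partial i g x)); apply: continuousM.
  + exact: test_fun_continuous tif x.
  + exact: test_fun_continuous tg x.
  + exact: test_fun_continuous tf x.
  + exact: test_fun_continuous tig x.
- by move=> x /MM[h _]; rewrite fM ?mul0r.
- by move=> x /MM[h h']; rewrite fM// f'M// !mul0r addr0.
Qed.

Definition partials (s : seq 'I_d) f := foldr (@partial R d) f s.

Lemma test_fun_partials D s f : test_fun D f -> test_fun D (partials s f).
Proof. by move=> tf; elim: s => //= i s; exact: test_fun_partial. Qed.

Lemma partials_partial D s i f : test_fun D f ->
  partials s (partial i f) = partial i (partials s f).
Proof.
move=> tf; elim: s => //= j s ->.
by rewrite partialC//; have [] := test_fun_partials s tf.
Qed.

(** Moving the derivatives across one at a time reverses their order; commutation of partial
    derivatives restores it. *)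
Lemma ip_partials D s f g : test_fun D f -> test_fun D g ->
  ip D (partials s f) g = (-1) ^+ size s * ip D f (partials s g).
Proof.
move=> tf; elim: s g => [|i s IH] g tg /=; first by rewrite mul1r.
have tsf := test_fun_partials s tf.
rewrite ip_partial// IH; last exact: test_fun_partial.
by rewrite (partials_partial _ _ tg) exprS mulN1r mulNr.
Qed.

(** A multi-index becomes a list of directions, on which integration by parts is an induction and
    whose length gives the sign. *)
Lemma Dalpha_partials N (alpha : {ffun 'I_d -> 'I_N.+1}) f :
  Dalpha alpha f = partials (flatten [seq nseq (alpha i) i | i <- enum 'I_d]) f.
Proof.
rewrite /Dalpha /partials; elim: (enum 'I_d) => //= i s ->.
rewrite foldr_cat; move: (foldr _ _ _) => h.
by elim: (nat_of_ord (alpha i)) => //= k ->.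
Qed.

Lemma test_fun_Dalpha D N (alpha : {ffun 'I_d -> 'I_N.+1}) f :
  test_fun D f -> test_fun D (Dalpha alpha f).
Proof. by rewrite Dalpha_partials; exact: test_fun_partials. Qed.

Lemma ip_Dalpha D N (alpha : {ffun 'I_d -> 'I_N.+1}) f g :
  test_fun D f -> test_fun D g ->
  ip D (Dalpha alpha f) g =
  (-1) ^+ (\sum_i alpha i)%N * ip D f (Dalpha alpha g).
Proof.
move=> tf tg; rewrite !Dalpha_partials (ip_partials _ tf tg); congr (_ ^+ _ * _).
rewrite size_flatten /shape -map_comp sumnE big_map big_enum /=.
by apply: eq_bigr => i _; rewrite size_nseq.
Qed.

End integration_by_parts.

(** * The space L_2 *)

Section L2_theory.
Context (R : realType) (d : nat) (D : set 'rV[R]_d) (mD : measurable D).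
Local Notation mu := (@lebesgue_rV R d).
Implicit Types (f g h : 'rV[R]_d -> R).

Lemma ae_on_filterS (P Q : 'rV[R]_d -> Prop) :
  (forall x, D x -> P x -> Q x) -> ae_on D P -> ae_on D Q.
Proof.
move=> PQ; rewrite /ae_on; apply: filterS => x Px Dx; exact: PQ (Px Dx).
Qed.

Lemma ae_on_filterS2 (P Q S : 'rV[R]_d -> Prop) :
  (forall x, D x -> P x -> Q x -> S x) -> ae_on D P -> ae_on D Q -> ae_on D S.
Proof.
move=> PQS; rewrite /ae_on; apply: filterS2 => x Px Qx Dx.
exact: PQS (Px Dx) (Qx Dx).
Qed.

Lemma L2P f : L2 D f <-> measurable_fun D f /\
  mu.-integrable D (EFin \o (fun x => f x ^+ 2)).
Proof.
split=> -[mf fi]; split=> //.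
- apply/integrableP; split.
    by apply/measurable_EFinP; exact: measurable_funX.
  by under eq_integral do rewrite /= ger0_norm ?sqr_ge0//.
- have /integrableP[_] := fi.
  by under eq_integral do rewrite /= ger0_norm ?sqr_ge0//.
Qed.

Lemma L2_dominated f g : measurable_fun D f ->
  mu.-integrable D (EFin \o g) -> (forall x, D x -> f x ^+ 2 <= g x) -> L2 D f.
Proof.
move=> mf ig fg; apply/L2P; split=> //; apply: le_integrable ig => //.
  by apply/measurable_EFinP; exact: measurable_funX.
move=> x Dx /=; rewrite lee_fin ger0_norm ?sqr_ge0// (le_trans (fg x Dx))//.
exact: ler_norm.
Qed.

Lemma L2_eq f g : (forall x, D x -> f x = g x) -> L2 D f -> L2 D g.
Proof.
move=> fg /L2P[mf fi]; apply: (@L2_dominated g (fun x => f x ^+ 2)) => //.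
  by apply: eq_measurable_fun mf => x /set_mem; exact: fg.
by move=> x Dx; rewrite fg.
Qed.

Lemma L2_lin c f g : L2 D f -> L2 D g -> L2 D (fun x => c * f x + g x).
Proof.
move=> /L2P[mf fi] /L2P[mg gi].
apply: (@L2_dominated _ (fun x => (2 * c ^+ 2) * f x ^+ 2 + 2 * g x ^+ 2)).
- apply: measurable_funD => //; apply: measurable_funM => //.
- rewrite (_ : _ \o _ = (fun x => (2 * c ^+ 2)%:E * (EFin \o (fun x => (f x) ^+ 2)%R) x)%E
    \+ (fun x => 2%:E * (EFin \o (fun x => (g x) ^+ 2)%R) x)%E)%E.
    by apply: integrableD => //; exact: integrableZl.
  by apply/funext => x; rewrite /= -EFinM -EFinM -EFinD.
- move=> x _; have := sqr_ge0 (c * f x - g x); lra.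
Qed.

Lemma L2_0 : L2 D (fun=> 0).
Proof.
apply: (@L2_dominated _ (fun=> 0)) => //; last by move=> x _; rewrite expr0n.
exact: integrable0.
Qed.

Lemma L2_scale c f : L2 D f -> L2 D (fun x => c * f x).
Proof.
by move=> fL; apply: L2_eq (L2_lin c fL L2_0) => x _; rewrite addr0.
Qed.

Lemma L2_add f g : L2 D f -> L2 D g -> L2 D (fun x => f x + g x).
Proof.
by move=> fL gL; apply: L2_eq (L2_lin 1 fL gL) => x _; rewrite mul1r.
Qed.

Lemma L2_sum I (r : seq I) (P : pred I) (F : I -> 'rV[R]_d -> R) :
  (forall i, P i -> L2 D (F i)) -> L2 D (fun x => \sum_(i <- r | P i) F i x).
Proof.
move=> FL; elim: r => [|i r IH].
  by apply: L2_eq L2_0 => x _; rewrite big_nil.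
case Pi : (P i); last by apply: L2_eq IH => x _; rewrite big_cons Pi.
by apply: L2_eq (L2_add (FL i Pi) IH) => x _; rewrite big_cons Pi.
Qed.

Lemma L2_integrableM f g : L2 D f -> L2 D g ->
  mu.-integrable D (EFin \o (fun x => f x * g x)).
Proof.
move=> /L2P[mf fi] /L2P[mg gi].
have fgi : mu.-integrable D (EFin \o (fun x => f x ^+ 2 + g x ^+ 2)).
  exact: (integrableD mD fi gi).
apply: le_integrable fgi => //.
  by apply/measurable_EFinP; exact: measurable_funM.
move=> x _ /=; rewrite lee_fin [leRHS]ger0_norm ?addr_ge0 ?sqr_ge0//.
rewrite normrM -(real_normK (num_real (f x))) -(real_normK (num_real (g x))).
have := sqr_ge0 (`|f x| - `|g x|); have := sqr_ge0 (`|f x| + `|g x|); nra.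
Qed.

Lemma ip_lin c f g h : L2 D f -> L2 D g -> L2 D h ->
  ip D (fun x => c * f x + g x) h = c * ip D f h + ip D g h.
Proof.
move=> fL gL hL; rewrite /ip -RintegralZl//; last exact: L2_integrableM.
rewrite -RintegralD//; last 2 first.
- rewrite (_ : _ \o _ = EFin \o (fun x => (c * f x) * h x)).
    by apply: L2_integrableM => //; exact: L2_scale.
  by apply/funext => x /=; rewrite mulrA.
- exact: L2_integrableM.
by apply: eq_Rintegral => x _; rewrite mulrDl mulrA.
Qed.

Lemma ip_ge0 f : 0 <= ip D f f.
Proof. by apply: Rintegral_ge0 => x _; rewrite -expr2 sqr_ge0. Qed.

Lemma eq_ip f f' g g' : (forall x, D x -> f x = f' x) ->
  (forall x, D x -> g x = g' x) -> ip D f g = ip D f' g'.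
Proof.
by move=> ff' gg'; apply: eq_Rintegral => x /set_mem Dx; rewrite ff'// gg'.
Qed.

Lemma ip0l g : ip D (fun=> 0) g = 0.
Proof.
rewrite (_ : ip _ _ _ = \int[mu]_(x in D) 0).
  by rewrite /Rintegral integral0.
by apply: eq_Rintegral => x _; rewrite mul0r.
Qed.

Lemma ip_scale c f h : L2 D f -> L2 D h ->
  ip D (fun x => c * f x) h = c * ip D f h.
Proof.
move=> fL hL; have := ip_lin c fL L2_0 hL; rewrite ip0l addr0 => <-.
by apply: eq_ip => // x _; rewrite addr0.
Qed.

Lemma ip_add f g h : L2 D f -> L2 D g -> L2 D h ->
  ip D (fun x => f x + g x) h = ip D f h + ip D g h.
Proof.
move=> fL gL hL; rewrite -(mul1r (ip D f h)) -ip_lin//.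
by apply: eq_ip => // x _; rewrite mul1r.
Qed.

Lemma ip_suml I (r : seq I) (P : pred I) (F : I -> 'rV[R]_d -> R) h :
  (forall i, P i -> L2 D (F i)) -> L2 D h ->
  ip D (fun x => \sum_(i <- r | P i) F i x) h = \sum_(i <- r | P i) ip D (F i) h.
Proof.
move=> FL hL; elim: r => [|i r IH].
  by rewrite big_nil -[RHS](ip0l h); apply: eq_ip => // x _; rewrite big_nil.
rewrite big_cons; case Pi : (P i); last first.
  by rewrite -IH; apply: eq_ip => // x _; rewrite big_cons Pi.
rewrite -IH -ip_add//; last 2 first.
- exact: FL.
- exact: L2_sum.
by apply: eq_ip => // x _; rewrite big_cons Pi.
Qed.

Lemma ip_ae f f' g : L2 D f -> L2 D f' -> L2 D g ->
  ae_on D (fun x => f x = f' x) -> ip D f g = ip D f' g.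
Proof.
move=> [mf _] [mf' _] [mg _] ff'; congr (fine _); apply: ae_eq_integral => //.
- by apply/measurable_EFinP; exact: measurable_funM.
- by apply/measurable_EFinP; exact: measurable_funM.
- by apply: ae_on_filterS ff' => x _ /= ->.
Qed.

Lemma ip_eq0 f : L2 D f -> ip D f f = 0 -> ae_on D (fun x => f x = 0).
Proof.
move=> /[dup] fL [mf _] f0.
have fi := L2_integrableM fL fL.
have : (\int[mu]_(x in D) `|(f x * f x)%:E| = 0)%E.
  under eq_integral do rewrite gee0_abs ?lee_fin -?expr2 ?sqr_ge0//.
  apply/eqP; rewrite -[X in X == _]fineK; last exact: integrable_fin_num.
  by move: f0; rewrite /ip /Rintegral => ->.
have mff : measurable_fun D (fun x => (f x * f x)%:E).
  by apply/measurable_EFinP; exact: measurable_funM.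
move=> /(ae_eq_integral_abs mu mD mff).
rewrite /ae_on; apply: filterS => x h Dx; have [] := h Dx.
by move/eqP; rewrite -expr2 sqrf_eq0 => /eqP.
Qed.

Lemma bounded_L2 f : (mu D < +oo)%E -> measurable_fun D f ->
  (exists M, forall x, D x -> `|f x| <= M) -> L2 D f.
Proof.
move=> Dfin mf [M fM]; apply: (@L2_dominated _ (fun=> M ^+ 2)) => //.
  apply: measurable_bounded_integrable => //.
  by exists `|M ^+ 2|; split=> // B MB x _; exact: ltW.
move=> x Dx; rewrite -(real_normK (num_real (f x))) ler_pXn2r ?nnegrE//.
- exact: fM.
- exact: le_trans (fM x Dx).
Qed.

End L2_theory.

(** * Completeness of L_2 *)

Lemma limn_einf_le (R : realType) (u : (\bar R)^nat) l :
  (forall n, (u n <= l)%E) -> (limn_einf u <= l)%E.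
Proof.
move=> ul; rewrite limn_einf_lim; apply: lime_le; first exact: is_cvg_einfs.
apply: nearW => n; apply: le_trans (ul n).
by apply: ereal_inf_lbound; exists n => //=.
Qed.

(** Since 4^k is the square of 2^k, the increments are at most sqrt B / 2^k and their series
    converges absolutely. *)
Lemma cvgn_geometric_increments (R : realType) (u : R^nat) (B : R) :
  (forall k, 4 ^+ k * (u k.+1 - u k) ^+ 2 <= B) -> cvgn u.
Proof.
move=> uB; pose K := Num.sqrt B.
have B0 : 0 <= B.
  by apply: le_trans (uB 0); rewrite mulr_ge0// sqr_ge0.
have bound k : `|telescope u k| <= geometric K 2^-1 k.
  rewrite /= exprVn ler_pdivlMr ?exprn_gt0// -[X in _ * X]ger0_norm ?exprn_ge0//.
  rewrite -normrM -sqrtr_sqr ler_sqrt// exprMn mulrC -exprM mulnC exprM.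
  by rewrite -natrX; exact: uB.
have : cvgn (series (telescope u)).
  apply: normed_cvg.
  apply: (@series_le_cvg R (fun n => `|telescope u n|) (geometric K 2^-1)) => //.
    by move=> n; rewrite /= mulr_ge0 ?sqrtr_ge0// exprn_ge0.
  by apply: is_cvg_geometric_series; rewrite ger0_norm// invf_lt1// ltr1n.
move=> /cvg_ex[l ul]; apply/cvg_ex; exists (u 0%N + l).
have ul' : (fun n => u 0%N + series (telescope u) n) @ \oo --> u 0%N + l.
  by apply: cvgD; [exact: cvg_cst|exact: ul].
apply: cvg_trans ul'; apply: near_eq_cvg; apply: nearW => n.
exact/esym/eq_sum_telescope.
Qed.

Section L2_complete.
Context (R : realType) (d : nat) (D : set 'rV[R]_d) (mD : measurable D).
Local Notation mu := (@lebesgue_rV R d).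
Implicit Types (f g h : 'rV[R]_d -> R).

Lemma ip_EFin f : L2 D f -> (ip D f f)%:E = (\int[mu]_(x in D) (f x ^+ 2)%:E)%E.
Proof.
move=> fL; rewrite /ip /Rintegral fineK; last first.
  by apply: integrable_fin_num => //; exact: L2_integrableM.
by apply: eq_integral => x _; rewrite expr2.
Qed.

(* The weights make [sum_k 4^k (g_(k+1) - g_k)^2] integrable, hence finite a.e., so
   that the increments are a.e. dominated by a geometric sequence. *)
Lemma L2_fast_cvg (g_ : nat -> 'rV[R]_d -> R) : (forall k, L2 D (g_ k)) ->
  (forall k, ip D (fun x => g_ k.+1 x - g_ k x) (fun x => g_ k.+1 x - g_ k x)
     <= (4 ^+ k * 2 ^+ k.+1)^-1) ->
  exists2 g : 'rV[R]_d -> R, measurable_fun D g &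
    ae_on D (fun x => g_ ^~ x @ \oo --> g x).
Proof.
move=> gL gle.
pose b k x : \bar R := (4 ^+ k * (g_ k.+1 x - g_ k x) ^+ 2)%:E.
have incL k : L2 D (fun x => g_ k.+1 x - g_ k x).
  by apply: L2_eq (L2_lin mD (-1) (gL k) (gL k.+1)) => // x _; ring.
have mb k : measurable_fun D (b k).
  apply/measurable_EFinP; apply: measurable_funM => //; apply: measurable_funX.
  by case: (incL k).
have b0 k x : (0 <= b k x)%E by rewrite lee_fin mulr_ge0// sqr_ge0.
pose S x := (\sum_(k <oo) b k x)%E.
have mS : measurable_fun D S by exact: ge0_emeasurable_sum.
have SD : (\int[mu]_(x in D) S x <= 1%:E)%E.
  rewrite integral_nneseries//.
  apply: le_trans (epsilon_trick0 xpredT (ler01 : (0 <= 1 :> R)%R)).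
  apply: lee_nneseries => k _; first by move=> _; exact: integral_ge0.
  rewrite /b; under eq_integral do rewrite EFinM.
  rewrite ge0_integralZl//; last first.
  - by move=> x _; rewrite lee_fin sqr_ge0.
  - apply/measurable_EFinP; apply: measurable_funX; by case: (incL k).
  rewrite -ip_EFin// -EFinM lee_fin.
  rewrite (le_trans (ler_wpM2l _ (gle k)))// invfM mulrA divff ?gt_eqF//.
  by rewrite natrX.
have iS : mu.-integrable D S.
  apply/integrableP; split=> //.
  under eq_integral do rewrite gee0_abs ?nneseries_ge0//.
  by rewrite (le_lt_trans SD)// ltry.
(* The upper limit is measurable whether or not the sequence converges, and it is the limit wherever
   the sequence does. *)
exists (fun x => fine (limn_esup (fun k => (g_ k x)%:E))).
  apply: measurableT_comp => //; apply: measurable_fun_limn_esup => k.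
  by apply/measurable_EFinP; case: (gL k).
have Sfin : ae_on D (fun x => S x \is a fin_num) by exact: integrable_ae iS.
apply: ae_on_filterS Sfin => x Dx Sx.
have gc : cvgn (g_ ^~ x).
  apply: (@cvgn_geometric_increments _ _ (fine (S x))) => k.
  rewrite -lee_fin fineK// -[leLHS]/(b k x).
  rewrite /S (@nneseriesD1 _ (b ^~ x) k xpredT)//.
  by rewrite leeDl// nneseries_ge0// => *; exact: b0.
have gl : (fun k => (g_ k x)%:E) @ \oo --> (limn (g_ ^~ x))%:E.
  by apply: cvg_EFin => //; exact: nearW.
by have [_ ->] := cvg_limn_einf_sup gl.
Qed.

(** Riesz-Fischer. A fast subsequence converges almost everywhere to g; Fatou's lemma then turns the
    Cauchy bound into a bound on the distance of the whole sequence to g, and shows that g is in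
    L_2. *)
Lemma L2_complete (f_ : nat -> 'rV[R]_d -> R) : (forall n, L2 D (f_ n)) ->
  (forall e, 0 < e -> exists N, forall n m, (N <= n)%N -> (N <= m)%N ->
     ip D (fun x => -1 * f_ n x + f_ m x) (fun x => -1 * f_ n x + f_ m x) < e) ->
  exists2 f, L2 D f & forall e, 0 < e -> exists N, forall n, (N <= n)%N ->
     ip D (fun x => -1 * f_ n x + f x) (fun x => -1 * f_ n x + f x) < e.
Proof.
move=> fL fC.
have /choice[N hN] : forall k : nat, exists N, forall n m, (N <= n)%N -> (N <= m)%N ->
     ip D (fun x => -1 * f_ n x + f_ m x) (fun x => -1 * f_ n x + f_ m x)
       < (4 ^+ k * 2 ^+ k.+1)^-1.
  by move=> k; apply: fC; rewrite invr_gt0 mulr_gt0// exprn_gt0.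
(* Adding up all thresholds makes [n_] monotone and at least [N k]; the summand k makes it
   unbounded. *)
pose n_ k := (\sum_(j < k.+1) N j + k)%N.
have Nn k : (N k <= n_ k)%N.
  by rewrite /n_ big_ord_recr /= addnAC leq_addl.
have nS k : (n_ k <= n_ k.+1)%N.
  by rewrite /n_ leq_add// [leqRHS]big_ord_recr leq_addr.
have kn k : (k <= n_ k)%N by rewrite leq_addl.
have [||g mg gl] := @L2_fast_cvg (fun k => f_ (n_ k)) => //.
  move=> k; have := hN k (n_ k) (n_ k.+1) (Nn k) (leq_trans (Nn k) (nS k)).
  move/ltW; congr (_ <= _); apply: eq_ip => x _; ring.
have dist e : 0 < e -> exists M, forall n, (M <= n)%N ->
   (\int[mu]_(x in D) ((-1 * f_ n x + g x) ^+ 2)%:E <= e%:E)%E.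
  move=> e0; have [M hM] := fC e e0; exists M => n Mn.
  (* The shift by M keeps the indices of the subsequence above the Cauchy threshold for every k. *)
  pose v k x : \bar R := ((-1 * f_ n x + f_ (n_ (k + M)) x) ^+ 2)%:E.
  have mf m : measurable_fun D (f_ m) by case: (fL m).
  have mv k : measurable_fun D (v k).
    by apply/measurable_EFinP; apply: measurable_funX; apply: measurable_funD => //;
      apply: measurable_funM.
  have v0 k x : D x -> (0 <= v k x)%E by move=> _; rewrite lee_fin sqr_ge0.
  have -> : (\int[mu]_(x in D) ((-1 * f_ n x + g x) ^+ 2)%:E =
      \int[mu]_(x in D) limn_einf (v ^~ x))%E.
    apply: ae_eq_integral => //.
    - by apply/measurable_EFinP; apply: measurable_funX; apply: measurable_funD => //;
        apply: measurable_funM.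
    - have -> : (fun x => limn_einf (v ^~ x)) =
          -%E \o (fun x => limn_esup (fun k => (- v k x)%E)).
        apply/funext => x /=; rewrite -limn_einfN; congr limn_einf.
        by apply/funext => k; rewrite -[LHS]oppeK.
      apply: measurableT_comp => //; apply: measurable_fun_limn_esup => k.
      by apply: measurableT_comp => //; exact: mv.
    - apply: ae_on_filterS gl => x _ gx.
      have vx : v ^~ x @ \oo --> ((-1 * f_ n x + g x) ^+ 2)%:E.
        apply: cvg_EFin; first exact: nearW.
        rewrite (_ : _ \o _ = fun k => (-1 * f_ n x + f_ (n_ (k + M)) x) ^+ 2)//.
        have gx' : (fun k => -1 * f_ n x + f_ (n_ (k + M)) x) @ \oo -->
            -1 * f_ n x + g x.
          apply: cvgD; first exact: cvg_cst.
          by rewrite (cvg_shiftn M (fun k => f_ (n_ k) x)).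
        by rewrite expr2; under eq_fun do rewrite expr2; exact: cvgM.
      by have [-> _] := cvg_limn_einf_sup vx.
  apply: le_trans (fatou mu mD mv v0) _; apply: limn_einf_le => k.
  rewrite -ip_EFin; last exact: L2_lin.
  by rewrite lee_fin ltW// hM// (leq_trans _ (kn _))// leq_addl.
have gL : L2 D g.
  have [M hM] := dist 1 ltr01; have {}hM := hM M (leqnn M).
  have hL : L2 D (fun x => -1 * f_ M x + g x).
    split; last by rewrite (le_lt_trans hM)// ltry.
    by apply: measurable_funD => //; apply: measurable_funM => //; case: (fL M).
  by apply: L2_eq (L2_add mD hL (fL M)) => // x _; ring.
(* Fatou yields only a weak inequality, so e/2 is used to reach a strict one. *)
exists g => // e e0; have [M hM] := dist _ (divr_gt0 e0 (ltr0n _ 2)).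
exists M => n /hM; rewrite -ip_EFin; last exact: L2_lin.
by rewrite lee_fin => /le_lt_trans; apply; rewrite ltr_pdivrMr// ltr_pMr// ltr1n.
Qed.

End L2_complete.

(** * The fundamental lemma of the calculus of variations *)

Section smooth_algebra.
Context (R : realType) (d : nat).
Implicit Types (f g : 'rV[R]_d -> R).

(* Unlike the set of products of smooth functions, this class is stable under
   partial derivatives, which proves its members smooth without Leibniz formula. *)
Inductive smooth_alg : ('rV[R]_d -> R) -> Prop :=
| Smooth_base f : smooth f -> smooth_alg f
| Smooth_add f g : smooth_alg f -> smooth_alg g -> smooth_alg (f \+ g)
| Smooth_mul f g : smooth_alg f -> smooth_alg g -> smooth_alg (f \* g).

Lemma smooth_alg_continuous f : smooth_alg f -> continuous f.
Proof.
elim=> {f} [f fs|f g _ cf _ cg|f g _ cf _ cg].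
- exact: smooth_continuous.
- by move=> x; apply: continuousD; [exact: cf|exact: cg].
- by move=> x; apply: continuousM; [exact: cf|exact: cg].
Qed.

Lemma smooth_alg_derivable f i x : smooth_alg f ->
  derivable f x (delta_mx ord0 i).
Proof.
elim=> {f} [f fs|f g _ df _ dg|f g _ df _ dg].
- by have [] := smooth_is_derive i x fs.
- exact: derivableD.
- exact: derivableM.
Qed.

Lemma smooth_alg_partial f i : smooth_alg f -> smooth_alg (partial i f).
Proof.
elim=> {f} [f fs|f g fA pf gA pg|f g fA pf gA pg].
- by apply: Smooth_base; exact: smooth_partial.
- rewrite (_ : partial i _ = partial i f \+ partial i g); first exact: Smooth_add.
  by apply/funext => x; apply: deriveD; exact: smooth_alg_derivable.
- rewrite (_ : partial i _ = (f \* partial i g) \+ (g \* partial i f)).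
    by apply: Smooth_add; exact: Smooth_mul.
  by apply/funext => x; apply: deriveM; exact: smooth_alg_derivable.
Qed.

Lemma smooth_alg_smooth f : smooth_alg f -> smooth f.
Proof.
move=> fA s; have : smooth_alg (foldr (@partial R d) f s).
  by elim: s => //= i s; exact: smooth_alg_partial.
move=> /[dup] /smooth_alg_continuous cs sA; split=> // i x.
exact: smooth_alg_derivable.
Qed.

Lemma smoothD f g : smooth f -> smooth g -> smooth (f \+ g).
Proof.
by move=> fs gs; apply: smooth_alg_smooth; apply: Smooth_add; exact: Smooth_base.
Qed.

Lemma smoothM f g : smooth f -> smooth g -> smooth (f \* g).
Proof.
by move=> fs gs; apply: smooth_alg_smooth; apply: Smooth_mul; exact: Smooth_base.
Qed.

Lemma smooth_cst (c : R) : smooth (fun _ : 'rV[R]_d => c).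
Proof.
have -> : (fun _ : 'rV[R]_d => c) = (fun x : 'rV[R]_d => c * tensor (fun _ _ => 1 : R) x).
  by apply/funext => x; rewrite /tensor big1// mulr1.
by apply: smoothZ; apply: smooth_tensor => i k; exact: Ck_cst.
Qed.

Lemma smoothX f n : smooth f -> smooth (fun x => f x ^+ n).
Proof.
move=> fs; elim: n => [|n IH].
  by under eq_fun do rewrite expr0; exact: smooth_cst.
by under eq_fun do rewrite exprS; exact: smoothM.
Qed.

Lemma smooth_prod I (r : seq I) (F : I -> 'rV[R]_d -> R) :
  (forall i, smooth (F i)) -> smooth (fun x => \prod_(i <- r) F i x).
Proof.
move=> Fs; elim: r => [|i r IH].
  by under eq_fun do rewrite big_nil; exact: smooth_cst.
by under eq_fun do rewrite big_cons; apply: smoothM.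
Qed.

End smooth_algebra.

(** * Test functions that approximate the indicator of an open set *)

Section indicator_approximation.
Context (R : realType) (d : nat) (A : set 'rV[R]_d) (oA : open A).

Definition rat_bump (p : 'rV[rat]_d * nat) : 'rV[R]_d -> R :=
  tensor (fun i => bump1 (ratr (p.1 ord0 i) - cube_radius R p.2)
                         (ratr (p.1 ord0 i) + cube_radius R p.2)).

(** A code of no cube, or of a cube not contained in A, gets the zero function, so that the bumps
    supported in A form a plain sequence. *)
Definition enum_bump (j : nat) : 'rV[R]_d -> R :=
  if unpickle j is Some p then
    if `[< rat_closed_cube p `<=` A >] then rat_bump p else fun=> 0
  else fun=> 0.

Lemma flat1_itv (t : R) : 0 <= flat 1 t <= 1.
Proof.
rewrite /flat; case: ifPn => [t0|_]; last by rewrite lexx ler01.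
by rewrite hornerC mul1r expR_ge0 expR_le1 oppr_le0 invr_ge0 ltW.
Qed.

Lemma bump1_itv (l r t : R) : 0 <= bump1 l r t <= 1.
Proof.
rewrite /bump1 /=; have /andP[a0 a1] := flat1_itv (1 * t + - l).
have /andP[b0 b1] := flat1_itv (-1 * t + r).
by rewrite mulr_ge0//= mulr_ile1.
Qed.

Lemma rat_bump_itv p x : 0 <= rat_bump p x <= 1.
Proof.
rewrite /rat_bump /tensor; elim/big_ind : _ => [|a b /andP[a0 a1] /andP[b0 b1]|i _].
- by rewrite ler01 lexx.
- by rewrite mulr_ge0//= mulr_ile1.
- exact: bump1_itv.
Qed.

Lemma enum_bump_itv j x : 0 <= enum_bump j x <= 1.
Proof.
rewrite /enum_bump; case: unpickle => [p|]; last by rewrite lexx ler01.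
by case: ifP => _; [exact: rat_bump_itv|rewrite lexx ler01].
Qed.

Lemma rat_bump_gt0 p x : rat_cube p x -> 0 < rat_bump p x.
Proof.
move=> px; apply: prodr_gt0 => i _; have := px i; rewrite /= in_itv/=.
by move=> /andP[]; exact: bump1_gt0.
Qed.

Lemma rat_bump_eq0 p x : ~ rat_closed_cube p x -> rat_bump p x = 0.
Proof.
move=> /existsNP[i]; rewrite /= in_itv/= => /negP pxi.
rewrite /rat_bump /tensor (bigD1 i)//= bump1_eq0 ?mul0r//.
by apply: contra pxi => /andP[/ltW-> /ltW->].
Qed.

Lemma smooth_enum_bump j : smooth (enum_bump j).
Proof.
rewrite /enum_bump; case: unpickle => [p|]; last exact: smooth_cst.
by case: ifP => _; [exact: smooth_tensor_bump|exact: smooth_cst].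
Qed.

Lemma enum_bump_support j : exists2 K, compact K /\ K `<=` A &
  forall x, ~ K x -> enum_bump j x = 0.
Proof.
rewrite /enum_bump; case: unpickle => [p|].
  case: ifPn => [/asboolP pA|_].
    exists (rat_closed_cube p); last exact: rat_bump_eq0.
    split=> //; apply: (@rV_compact _ _ (fun i => `[ratr (p.1 ord0 i) - cube_radius R p.2,
      ratr (p.1 ord0 i) + cube_radius R p.2]%classic)) => i.
    exact: segment_compact.
  by exists set0 => //; split=> //; exact: compact0.
by exists set0 => //; split=> //; exact: compact0.
Qed.

(* At a point of A some bump is positive, so the product tends to 0. *)
Definition indic_approx (k : nat) x : R :=
  1 - \prod_(j < k) (1 - enum_bump j x) ^+ k.

Lemma indic_approx_itv k x : 0 <= indic_approx k x <= 1.
Proof.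
have : 0 <= \prod_(j < k) (1 - enum_bump j x) ^+ k <= 1.
  elim/big_ind : _ => [|a b /andP[a0 a1] /andP[b0 b1]|i _].
  - by rewrite ler01 lexx.
  - by rewrite mulr_ge0//= mulr_ile1.
  - have /andP[b0 b1] := enum_bump_itv i x.
    by rewrite exprn_ge0 ?subr_ge0//= exprn_ile1 ?subr_ge0// gerBl.
by rewrite /indic_approx subr_ge0 gerBl => /andP[-> ->].
Qed.

Lemma test_fun_indic_approx k : test_fun A (indic_approx k).
Proof.
split.
  apply: (@smoothD _ _ (fun=> 1)); first exact: smooth_cst.
  under eq_fun do rewrite -mulN1r; apply: smoothZ; apply: smooth_prod => j.
  apply: smoothX; apply: (@smoothD _ _ (fun=> 1)); first exact: smooth_cst.
  under eq_fun do rewrite -mulN1r; apply: smoothZ; exact: smooth_enum_bump.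
have /choice[K hK] : forall j, exists K,
    (compact K /\ K `<=` A) /\ forall x, ~ K x -> enum_bump j x = 0.
  by move=> j; have [K ? ?] := enum_bump_support j; exists K.
(* Outside the finite union of supports all bumps vanish and the product is 1. *)
exists (\big[setU/set0]_(j < k) K j); first split.
- elim/big_ind : _ => [|B C|j _]; [exact: compact0|exact: compactU|].
  by have [[]] := hK j.
- by move=> x; rewrite -bigcup_mkord => -[j _ Kx]; have [[_ KA] _] := hK j; exact: KA.
- move=> x nx; rewrite /indic_approx big1 ?subrr// => j _.
  have [_ ->] := hK j; first by rewrite subr0 expr1n.
  by move=> Kx; apply: nx; rewrite -bigcup_mkord; exists j => //=.
Qed.

Lemma indic_approx_cvg x : indic_approx ^~ x @ \oo --> (\1_A x : R).
Proof.
have [Ax|Ax] := pselect (A x); last first.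
  rewrite indicE memNset//; apply: cvg_near_cst; apply: nearW => k.
  exact: test_fun_eq0 (test_fun_indic_approx k) Ax.
rewrite indicE mem_set//.
have [p [px pA]] := open_rat_cube oA Ax.
pose j := pickle p; have bE : enum_bump j x = rat_bump p x.
  by rewrite /enum_bump pickleK; case: asboolP.
have b0 : 0 < enum_bump j x by rewrite bE; exact: rat_bump_gt0.
have /andP[_ b1] := enum_bump_itv j x.
set z := 1 - enum_bump j x.
have z0 : 0 <= z by rewrite subr_ge0.
have z1 : z < 1 by rewrite ltrBlDr ltrDl.
rewrite -[X in _ --> X](subr0 1); apply: cvgB; first exact: cvg_cst.
apply: (@squeeze_cvgr _ _ _ _ (fun=> 0) (fun k => z ^+ k)); last 2 first.
- exact: cvg_cst.
- by apply: cvg_expr; rewrite ger0_norm.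
(* Once k > j the bump that is positive at x is among the factors, and the other factors are at most
   1; the product is then at most [z ^+ k]. *)
near=> k; have jk : (j < k)%N by near: k; exists j.+1.
have p01 (P : pred 'I_k) : 0 <= \prod_(i < k | P i) (1 - enum_bump i x) ^+ k <= 1.
  elim/big_ind : _ => [|a b /andP[a0 a1] /andP[c0 c1]|i _].
  - by rewrite ler01 lexx.
  - by rewrite mulr_ge0//= mulr_ile1.
  - have /andP[e0 e1] := enum_bump_itv i x.
    by rewrite exprn_ge0 ?subr_ge0//= exprn_ile1 ?subr_ge0// gerBl.
have /andP[-> _] := p01 xpredT.
rewrite (bigD1 (Ordinal jk))//= -/z ler_piMr ?exprn_ge0//.
by have /andP[_] := p01 (fun i => i != Ordinal jk).
Unshelve. all: by end_near. Qed.

End indicator_approximation.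

Section fundamental_lemma.
Context (R : realType) (d : nat).
Local Notation mu := (@lebesgue_rV R d).
Implicit Types (D : set 'rV[R]_d).

Lemma test_fun_L2 D D' f : measurable D' -> test_fun D f -> L2 D' f.
Proof.
move=> mD' tf; have cf := test_fun_continuous tf; apply/L2P => //; split.
  by apply: measurable_funTS; exact: continuous_measurable_rV.
have [M M0 fM] := test_fun_cube tf.
apply: (@integrableS _ _ _ _ setT) => //.
apply: (@integrable_rV_cube _ _ M) => [x|x /fM ->].
  by under eq_fun do rewrite expr2; apply: continuousM; exact: cf.
by rewrite expr0n.
Qed.

(** The sigma-algebra is generated by coordinates. Seeing it inside the one generated by open sets
    allows a Dynkin argument with open sets as the intersection-stable generator. *)
Lemma measurable_rV_open :
  @measurable _ 'rV[R]_d `<=` <<s (@open 'rV[R]_d) >>.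
Proof.
apply: smallest_sub; first exact: smallest_sigma_algebra.
rewrite -bigcup_seq => A /= [i _ [B mB <-]]; rewrite setTI.
have mcoord : measurable_fun [set: g_sigma_algebraType (@open 'rV[R]_d)]
    (@rV_coord R d i : g_sigma_algebraType (@open 'rV[R]_d) -> R).
  apply: (measurability _ (RGenOpens.measurableE R)).
  move=> _ [_ [a [b ->] <-]]; rewrite setTI; apply: sub_sigma_algebra.
  apply: open_comp; last exact: interval_open.
  by move=> x _; exact: coord_continuous.
by have := mcoord measurableT B mB; rewrite setTI.
Qed.

(** Sets are intersected with D so that the class lives on the whole space; the zero integral over D
    itself gives stability under complements. *)
Lemma dynkin_null_integral D (h : 'rV[R]_d -> \bar R) : measurable D ->
  mu.-integrable D h -> (\int[mu]_(x in D) h x = 0)%E ->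
  dynkin [set A | measurable A /\ (\int[mu]_(x in A `&` D) h x = 0)%E].
Proof.
move=> mD ih h0; have mh := measurable_int _ ih.
split; first by rewrite /= setTI.
- move=> A [mA hA]; split; first exact: measurableC.
  have := @integral_setU _ _ _ mu (A `&` D) (~` A `&` D) h.
  rewrite -setIUl setUCr setTI h0 hA add0e => <- //.
  + exact: measurableI.
  + by apply: measurableI => //; exact: measurableC.
  + by apply/disj_set2P; rewrite setIACA setICr set0I.
- move=> F tF HF; split; first by apply: bigcupT_measurable => k; case: (HF k).
  rewrite setI_bigcupl integral_bigcup//.
  + by rewrite eseries0// => k _ _; case: (HF k).
  + exact: trivIset_setIr.
  + by move=> k; apply: measurableI => //; case: (HF k).
  + apply: integrableS ih => //; last by move=> x [k _ []].
    by apply: bigcupT_measurable => k; apply: measurableI => //; case: (HF k).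
Qed.

(** Smooth approximations of indicators and dominated convergence give a zero integral over every
    open subset of D; the Dynkin class theorem extends this to all measurable subsets, hence h = 0
    almost everywhere. *)
Lemma fundamental_lemma D (h : 'rV[R]_d -> R) : open D -> (mu D < +oo)%E ->
  L2 D h -> (forall psi, test_fun D psi -> ip D h psi = 0) ->
  ae_on D (fun x => h x = 0).
Proof.
move=> oD Dfin hL h0; have mD := open_measurable_rV oD.
have [mh _] := hL.
(* Finite measure puts the constant 1 in L_2, which makes h = h 1 integrable. *)
have L1 : L2 D (fun=> 1) by apply: bounded_L2 => //; exists 1 => x _; rewrite normr1.
have ih : mu.-integrable D (EFin \o h).
  apply: eq_integrable (L2_integrableM mD hL L1) => // x _.
  by rewrite /= mulr1.
have int_open A : open A -> A `<=` D -> (\int[mu]_(x in A) (h x)%:E = 0)%E.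
  move=> oA AD.
  have mI (E : set 'rV[R]_d) : measurable E -> measurable_fun D (\1_E : 'rV[R]_d -> R).
    by move=> mE; exact: measurable_indic.
  have mA := open_measurable_rV oA.
  have tA k : test_fun D (indic_approx A k).
    exact: test_funS AD (test_fun_indic_approx A k).
  have [|||||_ _] := @dominated_convergence _ _ _ mu D mD
    (fun k x => (h x * indic_approx A k x)%:E)
    (fun x => (h x * \1_A x)%:E) (fun x => `|(h x)%:E|%E).
  - move=> k; apply/measurable_EFinP; apply: measurable_funM => //.
    by have [] := test_fun_L2 mD (tA k).
  - by apply/measurable_EFinP; apply: measurable_funM => //; exact: mI.
  - apply: aeW => x _; apply: cvg_EFin; first exact: nearW.
    by apply: cvgM; [exact: cvg_cst|exact: indic_approx_cvg].
  - exact: integrable_abse.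
  - apply: aeW => x k _; rewrite lee_fin normrM ler_piMr//.
    have /andP[i0 i1] := indic_approx_itv A k x.
    by rewrite ger0_norm.
  have -> : (fun k => \int[mu]_(x in D) (h x * indic_approx A k x)%:E)%E = fun=> 0%E.
    apply/funext => k; have := h0 _ (tA k); rewrite /ip /Rintegral => hk.
    rewrite -[LHS]fineK ?hk//; apply: integrable_fin_num => //.
    by apply: L2_integrableM => //; exact: test_fun_L2 (tA k).
  move=> /(cvg_lim (@ereal_hausdorff R)); rewrite lim_cst//= => intA.
  rewrite [RHS]intA -{1}(setIidr AD) integral_mkcondr; apply: eq_integral => x _.
  by rewrite patchE indicE; case: ifP => _; rewrite ?mulr1 ?mulr0.
have hD := int_open D oD (@subset_refl _ D).
have dyn := dynkin_null_integral mD ih hD.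
have all_meas : measurable `<=`
    [set A | measurable A /\ (\int[mu]_(x in A `&` D) (h x)%:E = 0)%E].
  apply: (subset_trans measurable_rV_open).
  rewrite -setI_closed_g_dynkin_g_sigma_algebra; last exact: openI.
  apply: smallest_sub => // A oA; split; first exact: open_measurable_rV.
  by apply: int_open; [exact: openI|exact: subIsetr].
have : ae_eq mu D (EFin \o h) (cst 0%E).
  apply: integral_ae_eq => // E ED mE.
  by have [_] := all_meas E mE; rewrite setIidl// integral0.
by rewrite /ae_on; apply: filterS => x hx Dx; have [] := hx Dx.
Qed.

End fundamental_lemma.

(** * Matrix-valued L_2 functions *)

Section frobenius.
Context (R : realType) (m n : nat).
Implicit Types (z : 'M[R]_(m, n)).

Lemma frobC z z' : frob z z' = frob z' z.
Proof. by apply: eq_bigr => i _; apply: eq_bigr => j _; rewrite mulrC. Qed.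

Lemma frob_lin c z z' z0 : frob (c *: z + z') z0 = c * frob z z0 + frob z' z0.
Proof.
rewrite /frob mulr_sumr -big_split; apply: eq_bigr => i _ /=.
rewrite mulr_sumr -big_split; apply: eq_bigr => j _ /=.
by rewrite !mxE mulrDl mulrA.
Qed.

Lemma frob_linr c z z' z0 : frob z0 (c *: z + z') = c * frob z0 z + frob z0 z'.
Proof. by rewrite frobC frob_lin !(frobC z0). Qed.

Lemma frob_ge0 z : 0 <= frob z z.
Proof. by apply: sumr_ge0 => i _; apply: sumr_ge0 => j _; rewrite -expr2 sqr_ge0. Qed.

Lemma frob_delta z i j : frob z (delta_mx i j) = z i j.
Proof.
rewrite /frob (bigD1 i)//= (bigD1 j)//= mxE !eqxx mulr1.
rewrite big1 ?addr0 => [|j' /negbTE jj]; last by rewrite mxE jj andbF mulr0.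
rewrite big1 ?addr0// => i' /negbTE ii; apply: big1 => j' _.
by rewrite mxE ii mulr0.
Qed.

(** The existence of such a P expresses that U is a linear subspace in a form fit for use: P brings
    test matrices and limits back into U and leaves pairings with elements of U unchanged. *)
Definition orth_proj (U : set 'M[R]_(m, n)) (P : 'M[R]_(m, n) -> 'M[R]_(m, n)) :=
  [/\ forall z, U (P z), forall z, U z -> P z = z,
      forall c z z', P (c *: z + z') = c *: P z + P z' &
      forall z z', frob (P z) z' = frob z (P z')].

End frobenius.

Lemma Uset_orth_proj (R : realType) k d : exists P, orth_proj (Uset R k d) P.
Proof.
case: k => /=.
- by exists id.
- by exists id.
- by exists id.
exists (fun z : 'M[R]_(d, d) => 2^-1 *: (z + z^T)); split.
- by move=> z /=; apply/matrixP => i j; rewrite !mxE addrC.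
- by move=> z /= zT; rewrite -zT; apply/matrixP => i j; rewrite !mxE; field.
- move=> c z z'; rewrite linearD/= linearZ/=.
  by apply/matrixP => i j; rewrite !mxE; ring.
- move=> z z'; rewrite /frob.
  rewrite (eq_bigr (fun i => 2^-1 * \sum_j z i j * z' i j +
      2^-1 * \sum_j z j i * z' i j)); last first.
    move=> i _; rewrite !mulr_sumr -big_split; apply: eq_bigr => j _ /=.
    by rewrite !mxE; ring.
  rewrite [RHS](eq_bigr (fun i => 2^-1 * \sum_j z i j * z' i j +
      2^-1 * \sum_j z i j * z' j i)); last first.
    move=> i _; rewrite !mulr_sumr -big_split; apply: eq_bigr => j _ /=.
    by rewrite !mxE; ring.
  rewrite !big_split/= -!mulr_sumr; congr (_ + _ * _).
  by rewrite exchange_big.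
Qed.

Section L2U_theory.
Context (R : realType) (d m n : nat) (U : set 'M[R]_(m, n)).
Context (P : 'M[R]_(m, n) -> 'M[R]_(m, n)) (hP : orth_proj U P).
Context (D : set 'rV[R]_d) (mD : measurable D).
Local Notation mu := (@lebesgue_rV R d).
Implicit Types (F G H : 'rV[R]_d -> 'M[R]_(m, n)).

Lemma Uspace_lin c z z' : U z -> U z' -> U (c *: z + z').
Proof.
case: hP => PU PK PL _ Uz Uz'.
by rewrite -(PK _ Uz) -(PK _ Uz') -PL; exact: PU.
Qed.

Lemma Uspace0 : U 0.
Proof.
by case: hP => PU _ PL _; have := Uspace_lin (-1) (PU 0) (PU 0); rewrite scaleN1r addNr.
Qed.

(** The entries of P (F x) become combinations, with constant coefficients, of the entries of F x;
    measurability and integrability are thus inherited. *)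
Lemma orth_proj_sum z : P z = \sum_i \sum_j z i j *: P (delta_mx i j).
Proof.
case: hP => _ _ PL _.
have P0 : P 0 = 0 by have := PL (-1) 0 0; rewrite scaler0 addr0 scaleN1r addNr.
have Psum I (r : seq I) (F : I -> 'M[R]_(m, n)) :
    P (\sum_(i <- r) F i) = \sum_(i <- r) P (F i).
  elim: r => [|i r IH]; first by rewrite !big_nil.
  rewrite !big_cons; have := PL 1 (F i) (\sum_(k <- r) F k).
  by rewrite !scale1r IH.
rewrite [in LHS](matrix_sum_delta z) Psum; apply: eq_bigr => i _.
rewrite Psum; apply: eq_bigr => j _.
by rewrite -[_ *: delta_mx i j]addr0 PL P0 addr0.
Qed.

Lemma frob_orth_proj_le z : frob (P z) (P z) <= frob z z.
Proof.
case: hP => PU PK _ PA; have := frob_ge0 (-1 *: P z + z).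
rewrite frob_lin !frob_linr PA (PK _ (PU z)) (frobC (P z) z); lra.
Qed.

Lemma L2U_lin c F G : L2U U D F -> L2U U D G -> L2U U D (fun x => c *: F x + G x).
Proof.
move=> [FU FL] [GU GL]; split=> [x Dx|i j].
  by apply: Uspace_lin; [exact: FU|exact: GU].
by apply: L2_eq (L2_lin mD c (FL i j) (GL i j)) => // x _; rewrite !mxE.
Qed.

Lemma L2U_0 : L2U U D (fun=> 0).
Proof.
split=> [x _|i j]; first exact: Uspace0.
by apply: L2_eq (L2_0 mD) => // x _; rewrite mxE.
Qed.

Lemma integrable_frob F G : (forall i j, L2 D (fun x => F x i j)) ->
  (forall i j, L2 D (fun x => G x i j)) ->
  mu.-integrable D (EFin \o (fun x => frob (F x) (G x))) /\
  ipU D F G = \sum_i \sum_j ip D (fun x => F x i j) (fun x => G x i j).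
Proof.
move=> FL GL.
have iij i j : mu.-integrable D (EFin \o (fun x => F x i j * G x i j)).
  by apply: L2_integrableM.
have Rsum I (r : seq I) (f : I -> 'rV[R]_d -> R) :
    (forall i, mu.-integrable D (EFin \o f i)) ->
    mu.-integrable D (EFin \o (fun x => \sum_(i <- r) f i x)) /\
    \int[mu]_(x in D) (\sum_(i <- r) f i x) = \sum_(i <- r) \int[mu]_(x in D) f i x.
  move=> fi; elim: r => [|i r [IH1 IH2]].
    rewrite big_nil; split.
      by under eq_fun do rewrite big_nil; exact: integrable0.
    transitivity (\int[mu]_(x in D) (0 : R)).
      by apply: eq_Rintegral => x _; rewrite big_nil.
    by rewrite /Rintegral integral0.
  split.
    rewrite (_ : _ \o _ = EFin \o (fun x => f i x + \sum_(i <- r) f i x)).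
      exact: (integrableD mD (fi i) IH1).
    by apply/funext => x /=; rewrite big_cons.
  rewrite big_cons -IH2 -RintegralD//.
  by apply: eq_Rintegral => x _; rewrite big_cons.
have row_int i := Rsum _ (index_enum 'I_n) (fun j x => F x i j * G x i j) (iij i).
have [int_FG FG_sum] := Rsum _ (index_enum 'I_m)
  (fun i x => \sum_j F x i j * G x i j) (fun i => (row_int i).1).
split=> //; rewrite /ipU /frob FG_sum; apply: eq_bigr => i _.
exact: (row_int i).2.
Qed.

Lemma ipU_sum F G : L2U U D F -> L2U U D G ->
  ipU D F G = \sum_i \sum_j ip D (fun x => F x i j) (fun x => G x i j).
Proof. by move=> [_ FL] [_ GL]; case: (integrable_frob FL GL). Qed.

Lemma ipUC F G : ipU D F G = ipU D G F.
Proof. by apply: eq_Rintegral => x _; rewrite frobC. Qed.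

Lemma eq_ipU F F' G G' : (forall x, D x -> F x = F' x) ->
  (forall x, D x -> G x = G' x) -> ipU D F G = ipU D F' G'.
Proof.
by move=> FF' GG'; apply: eq_Rintegral => x /set_mem Dx; rewrite FF'// GG'.
Qed.

Lemma ipU_lin c F G H : L2U U D F -> L2U U D G -> L2U U D H ->
  ipU D (fun x => c *: F x + G x) H = c * ipU D F H + ipU D G H.
Proof.
move=> FL GL HL; rewrite !ipU_sum//; last exact: L2U_lin.
rewrite mulr_sumr -big_split; apply: eq_bigr => i _ /=.
rewrite mulr_sumr -big_split; apply: eq_bigr => j _ /=.
rewrite -ip_lin//; [|exact: (FL.2)|exact: (GL.2)|exact: (HL.2)].
by apply: eq_ip => // x _; rewrite !mxE.
Qed.

Lemma ipU_ge0 F : 0 <= ipU D F F.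
Proof. by apply: Rintegral_ge0 => x _; exact: frob_ge0. Qed.

Lemma ipU_ae F F' G : L2U U D F -> L2U U D F' -> L2U U D G ->
  ae_on D (fun x => F x = F' x) -> ipU D F G = ipU D F' G.
Proof.
move=> FL FL' GL FF'; rewrite !ipU_sum//.
apply: eq_bigr => i _; apply: eq_bigr => j _; apply: ip_ae => //.
- exact: FL.2.
- exact: FL'.2.
- exact: GL.2.
- by apply: ae_on_filterS FF' => x _ ->.
Qed.

Lemma ae_on_matrix F G : (forall i j, ae_on D (fun x => F x i j = G x i j)) ->
  ae_on D (fun x => F x = G x).
Proof.
move=> FG; have : ae_on D (fun x => forall i j, F x i j = G x i j).
  rewrite /ae_on.
  have FG' i j : \forall x \ae mu, D x -> F x i j = G x i j by exact: FG.
  have : \forall x \ae mu, forall i, forall j, D x -> F x i j = G x i j.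
    by apply: filter_forall => i; apply: filter_forall => j; exact: FG'.
  by apply: filterS => x h Dx i j; exact: h.
by apply: ae_on_filterS => x _ h; apply/matrixP.
Qed.

Lemma ipU_eq0 F : L2U U D F -> ipU D F F = 0 -> ae_on D (fun x => F x = 0).
Proof.
move=> FL; rewrite ipU_sum// => /eqP; rewrite psumr_eq0 => [|i _]; last first.
  by apply: sumr_ge0 => j _; exact: ip_ge0.
move=> /allP h; apply: ae_on_matrix => i j; under eq_fun do rewrite mxE.
apply: ip_eq0 => //; first exact: FL.2.
have := h i (mem_index_enum _); rewrite psumr_eq0 => [|{}j _]; last exact: ip_ge0.
by move=> /allP/(_ j (mem_index_enum _))/eqP.
Qed.

Lemma ipU_cauchy_schwarz F G : L2U U D F -> L2U U D G ->
  `|ipU D F G| <= norm2U D F * norm2U D G.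
Proof.
apply: (@form_cauchy_schwarz_sqrt R _ (L2U U D) (fun c F G x => c *: F x + G x)).
- by move=> c F' G'; exact: L2U_lin.
- by move=> c F' G' H; exact: ipU_lin.
- by move=> F' G' _ _; exact: ipUC.
- by move=> F' _; exact: ipU_ge0.
Qed.

Lemma ip_cauchy_schwarz f g : L2 D f -> L2 D g ->
  `|ip D f g| <= norm2 D f * norm2 D g.
Proof.
apply: (@form_cauchy_schwarz_sqrt R _ (L2 D) (fun c f g x => c * f x + g x)).
- by move=> c f' g'; exact: L2_lin.
- by move=> c f' g' h; exact: ip_lin.
- by move=> f' g' _ _; exact: ipC.
- by move=> f' _; exact: ip_ge0.
Qed.

Lemma L2U_orth_proj F : (forall i j, L2 D (fun x => F x i j)) ->
  L2U U D (fun x => P (F x)).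
Proof.
move=> FL; split=> [x _|i j]; first by case: hP.
have : L2 D (fun x => \sum_k \sum_l P (delta_mx k l) i j * F x k l).
  by apply: L2_sum => // k _; apply: L2_sum => // l _; exact: L2_scale.
apply: L2_eq => // x _; rewrite orth_proj_sum summxE; apply: eq_bigr => k _.
by rewrite summxE; apply: eq_bigr => l _; rewrite mxE mulrC.
Qed.

(** The entrywise limits form a matrix that may leave U on a null set. Projecting it repairs this,
    and convergence survives since P fixes each F_k and does not increase the norm. *)
Lemma L2U_complete (F_ : nat -> 'rV[R]_d -> 'M[R]_(m, n)) :
  (forall k, L2U U D (F_ k)) ->
  (forall e, 0 < e -> exists N, forall k l, (N <= k)%N -> (N <= l)%N ->
     ipU D (fun x => -1 *: F_ k x + F_ l x) (fun x => -1 *: F_ k x + F_ l x) < e) ->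
  exists2 F, L2U U D F & forall e, 0 < e -> exists N, forall k, (N <= k)%N ->
     ipU D (fun x => -1 *: F_ k x + F x) (fun x => -1 *: F_ k x + F x) < e.
Proof.
move=> FL FC.
have lin_ij c F G i j : ip D (fun x => (c *: F x + G x) i j) (fun x => (c *: F x + G x) i j)
    = ip D (fun x => c * F x i j + G x i j) (fun x => c * F x i j + G x i j).
  by apply: eq_ip => x _; rewrite !mxE.
have comp_le F i j : L2U U D F -> ip D (fun x => F x i j) (fun x => F x i j) <= ipU D F F.
  move=> FL'; rewrite ipU_sum// (bigD1 i)//= (bigD1 j)//= -addrA lerDl addr_ge0//.
    by apply: sumr_ge0 => j' _; exact: ip_ge0.
  by apply: sumr_ge0 => i' _; apply: sumr_ge0 => j' _; exact: ip_ge0.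
have /choice[g hg] : forall ij : 'I_m * 'I_n, exists g, L2 D g /\
   forall e, 0 < e -> exists N, forall k, (N <= k)%N ->
     ip D (fun x => -1 * F_ k x ij.1 ij.2 + g x)
          (fun x => -1 * F_ k x ij.1 ij.2 + g x) < e.
  move=> [i j].
  have [||g gL gC] := @L2_complete R d D mD (fun k x => F_ k x i j).
  - by move=> k; exact: (FL k).2.
  - move=> e /FC[N hN]; exists N => k l Nk Nl.
    rewrite -lin_ij; apply: le_lt_trans (hN _ _ Nk Nl).
    by apply: comp_le; exact: L2U_lin.
  - by exists g.
pose G x : 'M[R]_(m, n) := \matrix_(i, j) g (i, j) x.
have GL i j : L2 D (fun x => G x i j).
  have [gL _] := hg (i, j).
  by apply: L2_eq gL => // x _; rewrite mxE.
have PGL := L2U_orth_proj GL.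
exists (fun x => P (G x)) => // e e0.
(* The successor makes the m n entrywise errors sum to strictly less than e, also when m n = 0. *)
pose e' := e / (m * n).+1%:R.
have e'0 : 0 < e' by rewrite divr_gt0.
have /choice[N hN] : forall ij : 'I_m * 'I_n, exists N, forall k, (N <= k)%N ->
     ip D (fun x => -1 * F_ k x ij.1 ij.2 + g ij x)
          (fun x => -1 * F_ k x ij.1 ij.2 + g ij x) < e'.
  by move=> ij; have [_] := hg ij; exact.
exists (\max_ij N ij)%N => k Nk.
have FGL i j : L2 D (fun x => (-1 *: F_ k x + G x) i j).
  by apply: L2_eq (L2_lin mD (-1) ((FL k).2 i j) (GL i j)) => // x _; rewrite !mxE.
apply: (@le_lt_trans _ _ (\sum_i \sum_j
   ip D (fun x => (-1 *: F_ k x + G x) i j) (fun x => (-1 *: F_ k x + G x) i j))).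
  have -> : ipU D (fun x => -1 *: F_ k x + P (G x)) (fun x => -1 *: F_ k x + P (G x)) =
      ipU D (fun x => P (-1 *: F_ k x + G x)) (fun x => P (-1 *: F_ k x + G x)).
    case: hP => _ PK PL _.
    by apply: eq_ipU => x Dx; rewrite PL (PK (F_ k x))//; exact: (FL k).1.
  have [int_H <-] := integrable_frob FGL FGL.
  have PHL := L2U_orth_proj FGL.
  apply: le_Rintegral => //; first exact: (integrable_frob PHL.2 PHL.2).1.
  by move=> x _; exact: frob_orth_proj_le.
apply: (@le_lt_trans _ _ (\sum_(i < m) \sum_(j < n) e')).
  apply: ler_sum => i _; apply: ler_sum => j _.
  rewrite (@eq_ip _ _ _ _ (fun x => -1 * F_ k x i j + g (i, j) x) _
    (fun x => -1 * F_ k x i j + g (i, j) x)).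
  - apply: ltW; apply: (hN (i, j) k); apply: leq_trans Nk.
    exact: (@leq_bigmax _ N (i, j)).
  - by move=> x _; rewrite !mxE.
  - by move=> x _; rewrite !mxE.
rewrite !sumr_const !card_ord -mulrnA -[ltLHS]mulr_natr /e' mulrAC ltr_pdivrMr//.
by rewrite ltr_pM2l// ltr_nat mulnC.
Qed.

End L2U_theory.

(** * Weak derivatives *)

Section restriction.
Context (R : realType) (d m n : nat) (U : set 'M[R]_(m, n)).
Local Notation mu := (@lebesgue_rV R d).
Implicit Types (D : set 'rV[R]_d) (f g : 'rV[R]_d -> R).
Implicit Types (F G : 'rV[R]_d -> 'M[R]_(m, n)).

Lemma L2S D D' f : measurable D -> measurable D' -> D' `<=` D ->
  L2 D f -> L2 D' f.
Proof.
move=> mD mD' D'D /L2P[mf fi]; apply/L2P; split.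
  exact: measurable_funS mf.
exact: integrableS fi.
Qed.

Lemma L2US D D' F : measurable D -> measurable D' -> D' `<=` D ->
  L2U U D F -> L2U U D' F.
Proof.
move=> mD mD' D'D [FU FL]; split=> [x /D'D/FU//|i j].
exact: L2S (FL i j).
Qed.

Lemma ip_subset D D' f g : D' `<=` D -> (forall x, ~ D' x -> g x = 0) ->
  ip D' f g = ip D f g.
Proof.
move=> D'D g0; rewrite ipC [RHS]ipC ip_setT// [RHS]ip_setT//.
by move=> x Dx; apply: g0 => /D'D.
Qed.

Lemma ipU_subset D D' F G : D' `<=` D -> (forall x, ~ D' x -> G x = 0) ->
  ipU D' F G = ipU D F G.
Proof.
move=> D'D G0; rewrite /ipU Rintegral_mkcond [RHS]Rintegral_mkcond.
apply: eq_Rintegral => x _; rewrite !patchE.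
have frob0 : ~ D' x -> frob (F x) (G x) = 0.
  by move=> /G0 ->; apply: big1 => i _; apply: big1 => j _; rewrite mxE mulr0.
case: ifPn => [/set_mem D'x|/negP D'x]; first by rewrite mem_set//; exact: D'D.
by case: ifP => // _; rewrite frob0// => ?; apply: D'x; rewrite inE.
Qed.

End restriction.

Section differential_operator_theory.
Context (R : realType) (d N m n : nat) (U : set 'M[R]_(m, n)).
Context (P : 'M[R]_(m, n) -> 'M[R]_(m, n)) (hP : orth_proj U P).
Context (a : diffop R d N m n) (ha : forall alpha, U (a alpha)).
Local Notation mu := (@lebesgue_rV R d).
Implicit Types (D : set 'rV[R]_d) (v q psi : 'rV[R]_d -> R).
Implicit Types (w g eta : 'rV[R]_d -> 'M[R]_(m, n)).

Lemma test_funU_L2U D D' eta : measurable D' -> test_funU U D eta ->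
  L2U U D' eta.
Proof. by move=> mD' [eU eT]; split=> // i j; exact: test_fun_L2 (eT i j). Qed.

Lemma A_testE psi x i j :
  A_test a psi x i j = \sum_alpha a alpha i j * Dalpha alpha psi x.
Proof.
by rewrite /A_test summxE; apply: eq_bigr => al _; rewrite mxE mulrC.
Qed.

Lemma A_test_L2U D D' psi : measurable D' -> test_fun D psi ->
  L2U U D' (A_test a psi).
Proof.
move=> mD' tpsi; split=> [x _|i j].
  rewrite /A_test; elim/big_ind : _ => [|z z' Uz Uz'|al _].
  - exact: Uspace0 hP.
  - by rewrite -[z]scale1r; exact: Uspace_lin hP _ _ _ _ _.
  - by rewrite -[_ *: _]addr0; apply: (Uspace_lin hP) => //; exact: Uspace0 hP.
apply: (@L2_eq _ _ _ mD' (fun x => \sum_alpha a alpha i j * Dalpha alpha psi x)).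
  by move=> x _; rewrite A_testE.
apply: L2_sum => // al _; apply: L2_scale => //.
exact: test_fun_L2 (test_fun_Dalpha al tpsi).
Qed.

Lemma A_test_eq0 D psi x : test_fun D psi -> ~ D x -> A_test a psi x = 0.
Proof.
move=> tpsi Dx; rewrite /A_test big1// => al _.
by rewrite (test_fun_eq0 (test_fun_Dalpha al tpsi) Dx) scale0r.
Qed.

Lemma As_test_L2 D D' eta : measurable D' -> test_funU U D eta ->
  L2 D' (As_test a eta).
Proof.
move=> mD' [_ teta]; apply: L2_sum => // al _; apply: L2_scale => //.
apply: L2_sum => // i _; apply: L2_sum => // j _; apply: L2_scale => //.
exact: test_fun_L2 (test_fun_Dalpha al (teta i j)).
Qed.

(** Integration by parts term by term, the signs being those built into [As_test]. It shows that
    classical and weak derivatives agree on test functions, for A as well as for its adjoint. *)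
Lemma A_test_adjoint D psi eta : measurable D -> test_fun D psi ->
  test_funU U D eta -> ipU D (A_test a psi) eta = ip D psi (As_test a eta).
Proof.
move=> mD tpsi teta; have [_ te] := teta.
have psiL : L2 D psi by exact: test_fun_L2 tpsi.
have eL i j : L2 D (fun x => eta x i j) by exact: test_fun_L2 (te i j).
have DeL al i j : L2 D (Dalpha al (fun x => eta x i j)).
  exact: test_fun_L2 (test_fun_Dalpha al (te i j)).
rewrite (ipU_sum mD (A_test_L2U mD tpsi) (test_funU_L2U mD teta)).
transitivity (\sum_i \sum_j \sum_(al : {ffun 'I_d -> 'I_N.+1})
    (-1) ^+ (\sum_i al i)%N * (a al i j * ip D psi (Dalpha al (fun x => eta x i j)))).
  apply: eq_bigr => i _; apply: eq_bigr => j _.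
  rewrite (@eq_ip _ _ _ _ (fun x => \sum_alpha a alpha i j * Dalpha alpha psi x) _
    (fun x => eta x i j))//; last by move=> x _; rewrite A_testE.
  have DpL al : L2 D (Dalpha al psi) by exact: test_fun_L2 (test_fun_Dalpha al tpsi).
  rewrite ip_suml//; last by move=> al _; exact: L2_scale.
  apply: eq_bigr => al _; rewrite ip_scale// (ip_Dalpha _ tpsi (te i j)).
  by rewrite mulrCA.
rewrite [RHS]ipC ip_suml//; last first.
  move=> al _; apply: L2_scale => //; apply: L2_sum => // i _.
  by apply: L2_sum => // j _; exact: L2_scale.
rewrite (eq_bigr (fun i => \sum_(al : {ffun 'I_d -> 'I_N.+1}) \sum_j
    (-1) ^+ (\sum_i al i)%N * (a al i j * ip D psi (Dalpha al (fun x => eta x i j)))));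
  last by move=> i _; rewrite exchange_big.
rewrite exchange_big; apply: eq_bigr => al _ /=.
rewrite ip_scale//; last first.
  by apply: L2_sum => // i _; apply: L2_sum => // j _; exact: L2_scale.
rewrite ip_suml//; last by move=> i _; apply: L2_sum => // j _; exact: L2_scale.
rewrite mulr_sumr; apply: eq_bigr => i _.
rewrite ip_suml//; last by move=> j _; exact: L2_scale.
rewrite mulr_sumr; apply: eq_bigr => j _.
by rewrite ip_scale// (ipC _ psi).
Qed.

Definition graphA D v g := [/\ L2 D v, L2U U D g & weakA U a D v g].
Definition graphAs D w q := [/\ L2U U D w, L2 D q & weakAs a D w q].

Lemma graphA_lin D c v g v' g' : measurable D -> graphA D v g -> graphA D v' g' ->
  graphA D (fun x => c * v x + v' x) (fun x => c *: g x + g' x).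
Proof.
move=> mD [vL gL vg] [vL' gL' vg']; split.
- exact: L2_lin.
- exact: (L2U_lin hP mD).
- move=> eta teta; rewrite (ipU_lin hP)//; last exact: test_funU_L2U teta.
  by rewrite ip_lin//; [rewrite vg// vg'|exact: As_test_L2 teta].
Qed.

Lemma graphAs_lin D c w q w' q' : measurable D -> graphAs D w q -> graphAs D w' q' ->
  graphAs D (fun x => c *: w x + w' x) (fun x => c * q x + q' x).
Proof.
move=> mD [wL qL wq] [wL' qL' wq']; split.
- exact: (L2U_lin hP mD).
- exact: L2_lin.
- move=> psi tpsi; rewrite (ipU_lin hP)//; last exact: A_test_L2U tpsi.
  by rewrite ip_lin//; [rewrite wq// wq'|exact: test_fun_L2 tpsi].
Qed.

Lemma graphA_0 D : measurable D -> graphA D (fun=> 0) (fun=> 0).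
Proof.
move=> mD; split; [exact: L2_0|exact: (L2U_0 hP mD)|move=> eta teta].
rewrite ip0l ipUC.
have := ipU_lin hP mD (-1) (L2U_0 hP mD) (L2U_0 hP mD) (test_funU_L2U mD teta).
rewrite mulN1r addNr => <-; rewrite ipUC.
by apply: eq_ipU => // x _; rewrite scaler0 addr0.
Qed.

Lemma graphA_test D psi : measurable D -> test_fun D psi ->
  graphA D psi (A_test a psi).
Proof.
move=> mD tpsi; split; [exact: test_fun_L2 tpsi|exact: A_test_L2U tpsi|].
by move=> eta teta; exact: A_test_adjoint.
Qed.

Lemma graphAs_test D eta : measurable D -> test_funU U D eta ->
  graphAs D eta (As_test a eta).
Proof.
move=> mD teta; split; [exact: test_funU_L2U teta|exact: As_test_L2 teta|].
by move=> psi tpsi; rewrite ipC -A_test_adjoint// ipUC.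
Qed.

(** A test function on D' vanishes outside D' and so is one on D with the same integrals. This
    restricts a global A^* w to the mesh elements. *)
Lemma graphAs_subset D D' w q : measurable D -> measurable D' -> D' `<=` D ->
  graphAs D w q -> graphAs D' w q.
Proof.
move=> mD mD' D'D [wL qL wq]; split.
- exact: L2US wL.
- exact: L2S qL.
- move=> psi tpsi; rewrite (ip_subset _ D'D); last by move=> x; exact: test_fun_eq0.
  rewrite (ipU_subset _ D'D); last by move=> x; exact: A_test_eq0.
  by apply: wq; exact: test_funS tpsi.
Qed.

(** The difference h is a weak A of the zero function, hence orthogonal to all U-valued test
    functions; the fundamental lemma is applied to each of its entries. *)
Lemma graphA_unique D v g g' : open D -> (mu D < +oo)%E ->
  graphA D v g -> graphA D v g' -> ae_on D (fun x => g x = g' x).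
Proof.
move=> oD Dfin vg vg'; have mD := open_measurable_rV oD.
have [_ hL hw] := graphA_lin (-1) mD vg vg'.
set h := (fun x => -1 *: g x + g' x) in hL hw.
case: (hP) => PU PK _ PA.
have h0 i j : ae_on D (fun x => h x i j = 0).
  apply: (@fundamental_lemma _ _ D (fun x => h x i j)) => //; first exact: hL.2.
  move=> psi tpsi.
  (* A multiple of [delta_mx i j] may leave U, its projection does not. As P is self-adjoint and h
     takes values in U, the pairing still isolates the entry (i, j) of h. *)
  have teta : test_funU U D (fun x => psi x *: P (delta_mx i j)).
    split=> [x|k l].
      rewrite -[_ *: _]addr0; apply: (Uspace_lin hP) => //; exact: Uspace0 hP.
    rewrite (_ : (fun x => _) = fun x => P (delta_mx i j) k l * psi x).
      exact: test_funZ.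
    by apply/funext => x; rewrite mxE mulrC.
  transitivity (ipU D h (fun x => psi x *: P (delta_mx i j))).
    apply: eq_Rintegral => x /set_mem Dx.
    rewrite -[psi x *: _]addr0 frob_linr -PA (PK (h x)) ?frob_delta; last exact: hL.1.
    rewrite [frob _ 0]big1 ?addr0 1?mulrC// => k _.
    by apply: big1 => l _; rewrite [X in _ * X]mxE mulr0.
  rewrite hw// (@eq_ip _ _ _ _ (fun=> 0) _
    (As_test a (fun x => psi x *: P (delta_mx i j))))//.
    exact: ip0l.
  by move=> x _; rewrite mulN1r addNr.
have : ae_on D (fun x => h x = 0).
  by apply: ae_on_matrix => i j; apply: ae_on_filterS (h0 i j) => x _ ->; rewrite mxE.
by apply: ae_on_filterS => x _; rewrite /h scaleN1r addrC => /subr0_eq.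
Qed.

Lemma graphAs_unique D w q q' : open D -> (mu D < +oo)%E ->
  graphAs D w q -> graphAs D w q' -> ae_on D (fun x => q x = q' x).
Proof.
move=> oD Dfin wq wq'; have mD := open_measurable_rV oD.
have [hU hL hw] := graphAs_lin (-1) mD wq wq'.
have : ae_on D (fun x => -1 * q x + q' x = 0).
  apply: fundamental_lemma => // psi tpsi; rewrite hw//.
  rewrite (@eq_ipU _ _ _ _ _ _ (fun=> 0) _ (A_test a psi))//.
    have AL := A_test_L2U mD tpsi; have ZL := L2U_0 hP mD.
    have := ipU_lin hP mD (-1) ZL ZL AL; rewrite mulN1r addNr => <-.
    by apply: eq_ipU => // x _; rewrite scaler0 addr0.
  by move=> x _; rewrite scaleN1r addNr.
by apply: ae_on_filterS => x _; rewrite mulN1r addrC => /subr0_eq.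
Qed.

Lemma graphA_HA D v g : graphA D v g -> HA U a D v.
Proof. by move=> [vL gL vg]; split=> //; exists g. Qed.

Lemma graphAs_HAs D w q : graphAs D w q -> HAs U a D w.
Proof. by move=> [wL qL wq]; split=> //; exists q. Qed.

Lemma graph_dA D v : HA U a D v -> graphA D v (dA U a D v).
Proof.
move=> [vL [g gP]]; have [? ?] : [set g | L2U U D g /\ weakA U a D v g] (dA U a D v).
  by rewrite /dA; apply: xgetPex; exists g.
by split.
Qed.

Lemma graph_dAs D w : HAs U a D w -> graphAs D w (dAs a D w).
Proof.
move=> [wL [q qP]]; have [? ?] : [set q | L2 D q /\ weakAs a D w q] (dAs a D w).
  by rewrite /dAs; apply: xgetPex; exists q.
by split.
Qed.

Lemma dA_ae D v g : open D -> (mu D < +oo)%E -> graphA D v g ->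
  ae_on D (fun x => dA U a D v x = g x).
Proof.
by move=> oD Dfin vg; exact: (graphA_unique oD Dfin (graph_dA (graphA_HA vg)) vg).
Qed.

Lemma dAs_ae D w q : open D -> (mu D < +oo)%E -> graphAs D w q ->
  ae_on D (fun x => dAs a D w x = q x).
Proof.
by move=> oD Dfin wq; exact: (graphAs_unique oD Dfin (graph_dAs (graphAs_HAs wq)) wq).
Qed.

End differential_operator_theory.

(** * The tensor field *)

Section ae_integral.
Context (R : realType) (d : nat) (D : set 'rV[R]_d) (mD : measurable D).
Local Notation mu := (@lebesgue_rV R d).

Lemma Rintegral_ae_ge0 (h : 'rV[R]_d -> R) : mu.-integrable D (EFin \o h) ->
  ae_on D (fun x => 0 <= h x) -> 0 <= \int[mu]_(x in D) h x.
Proof.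
move=> hi h0; have mh := measurable_int _ hi.
rewrite (_ : \int[mu]_(x in D) h x = \int[mu]_(x in D) `|h x|).
  by apply: Rintegral_ge0.
congr (fine _); apply: ae_eq_integral => //.
- by apply/measurable_EFinP; apply: measurableT_comp => //; exact/measurable_EFinP.
- by apply: ae_on_filterS h0 => x _ ? /=; rewrite ger0_norm.
Qed.

Lemma Rintegral_ae_le (h h' : 'rV[R]_d -> R) : mu.-integrable D (EFin \o h) ->
  mu.-integrable D (EFin \o h') -> ae_on D (fun x => h x <= h' x) ->
  \int[mu]_(x in D) h x <= \int[mu]_(x in D) h' x.
Proof.
move=> hi h'i hh'; rewrite -subr_ge0 -RintegralB//; apply: Rintegral_ae_ge0.
  exact: (integrableB mD h'i hi).
by apply: ae_on_filterS hh' => x _ ?; rewrite subr_ge0.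
Qed.

End ae_integral.

Section tensor_field.
Context (R : realType) (d m n : nat) (U : set 'M[R]_(m, n)).
Context (P : 'M[R]_(m, n) -> 'M[R]_(m, n)) (hP : orth_proj U P).
Context (Om : set 'rV[R]_d) (mOm : measurable Om).
Context (C : 'rV[R]_d -> 'M[R]_(m, n) -> 'M[R]_(m, n)).
Context (hC : spd_tensor_field U Om C).
Local Notation mu := (@lebesgue_rV R d).
Implicit Types (F G H g w : 'rV[R]_d -> 'M[R]_(m, n)).

Definition applyC g x := C x (g x).

Lemma applyC_lin c g g' x : Om x -> U (g x) -> U (g' x) ->
  applyC (fun x => c *: g x + g' x) x = c *: applyC g x + applyC g' x.
Proof. by case: hC => hU _ _ _ _ Omx gU g'U; have [_] := hU x Omx; exact. Qed.

(** Boundedness is assumed for the bilinear form; taking z' = C z and dividing by |C z| bounds the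
    operator. The absolute value makes the constant nonnegative. *)
Lemma applyC_bound : exists2 M, 0 <= M & ae_on Om (fun x => forall z, U z ->
  frob (C x z) (C x z) <= M ^+ 2 * frob z z).
Proof.
case: hC => hU _ [M hM] _ _; exists `|M| => //.
apply: ae_on_filterS hM => x Omx hM z Uz.
have UCz : U (C x z) by have [+ _] := hU x Omx; exact.
have := hM z (C x z) Uz UCz; rewrite ger0_norm ?frob_ge0//.
have F0 := frob_ge0 (C x z); have z0 := frob_ge0 z.
rewrite -(sqr_sqrtr F0) -(sqr_sqrtr z0) !sqrtr_sqr !(ger0_norm (sqrtr_ge0 _)).
set s := Num.sqrt (frob (C x z) _); set t := Num.sqrt (frob z _) => h.
have s0 : 0 <= s by exact: sqrtr_ge0.
have t0 : 0 <= t by exact: sqrtr_ge0.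
rewrite -exprMn ler_pXn2r ?nnegrE ?mulr_ge0//.
have [->|sN0] := eqVneq s 0; first by rewrite mulr_ge0.
have sp : 0 < s by rewrite lt0r sN0.
rewrite -(ler_pM2r sp) -expr2 (le_trans h)// ler_wpM2r// ler_wpM2r//.
exact: ler_norm.
Qed.

(** Measurability of C is assumed for constant arguments only; this expansion on fixed elements of U
    carries it over to a measurable argument g. *)
Lemma applyC_sum g i j x : Om x -> U (g x) ->
  applyC g x i j = \sum_k \sum_l g x k l * C x (P (delta_mx k l)) i j.
Proof.
case: hC => hU _ _ _ _ Omx gU; have [CU CL] := hU x Omx.
case: (hP) => PU PK _ _; have U0 := Uspace0 hP.
have C0 : C x 0 = 0.
  by have := CL (-1) 0 0 U0 U0; rewrite scaler0 addr0 scaleN1r addNr.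
have Csum I (r : seq I) (F : I -> 'M[R]_(m, n)) : (forall i, U (F i)) ->
    U (\sum_(i <- r) F i) /\ C x (\sum_(i <- r) F i) = \sum_(i <- r) C x (F i).
  move=> FU; elim: r => [|k r [IH1 IH2]]; first by rewrite !big_nil.
  rewrite !big_cons -IH2 -[F k]scale1r; split; first exact: (Uspace_lin hP).
  by rewrite CL// !scale1r.
have UPe y k l : U (y *: P (delta_mx k l)).
  by rewrite -[_ *: _]addr0; apply: (Uspace_lin hP).
have Crow k := Csum _ (index_enum 'I_n) (fun l => g x k l *: P (delta_mx k l))
  (fun l => UPe (g x k l) k l).
rewrite /applyC -{1}(PK _ gU) (orth_proj_sum hP).
have [_ ->] := Csum _ (index_enum 'I_m) (fun k => \sum_l g x k l *: P (delta_mx k l))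
  (fun k => (Crow k).1).
rewrite summxE; apply: eq_bigr => k _; rewrite (Crow k).2 summxE.
apply: eq_bigr => l _; rewrite -[g x k l *: _]addr0 CL// C0 addr0.
by rewrite mxE.
Qed.

Lemma applyC_L2U g : L2U U Om g -> L2U U Om (applyC g).
Proof.
move=> gL; have [gU gc] := gL; split=> [x Omx|i j].
  by case: hC => hU _ _ _ _; have [+ _] := hU x Omx; apply; exact: gU.
have mC : measurable_fun Om (fun x => applyC g x i j).
  apply: (@eq_measurable_fun _ _ _ _ _
    (fun x => \sum_k \sum_l g x k l * C x (P (delta_mx k l)) i j)).
    by move=> x /set_mem Omx; rewrite applyC_sum//; exact: gU.
  apply: measurable_sum => k; apply: measurable_sum => l.
  apply: measurable_funM; first by case: (gc k l).
  by case: hC => _ + _ _ _; apply; case: hP.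
have [M M0 hM] := applyC_bound.
have [int_g _] := integrable_frob mOm gc gc.
split=> //.
apply: (@le_lt_trans _ _ (\int[mu]_(x in Om) (M ^+ 2 * frob (g x) (g x))%:E)%E).
  apply: ae_ge0_le_integral => //.
  - by move=> x _; rewrite lee_fin sqr_ge0.
  - by apply/measurable_EFinP; exact: measurable_funX.
  - by move=> x _; rewrite lee_fin mulr_ge0 ?sqr_ge0 ?frob_ge0.
  - exact: measurable_int (integrableZl mOm (M ^+ 2) int_g).
  - apply: ae_on_filterS hM => x Omx hM; rewrite lee_fin (le_trans _ (hM _ (gU x Omx)))//.
    rewrite /frob (bigD1 i)//= (bigD1 j)//= expr2 -addrA lerDl addr_ge0//.
      by apply: sumr_ge0 => j' _; rewrite -expr2 sqr_ge0.
    by apply: sumr_ge0 => i' _; apply: sumr_ge0 => j' _; rewrite -expr2 sqr_ge0.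
have int_Mg := integrableZl mOm (M ^+ 2) int_g.
have := integrable_fin_num mOm int_Mg; rewrite ge0_fin_numE//.
by apply: integral_ge0 => x _; rewrite lee_fin mulr_ge0 ?sqr_ge0 ?frob_ge0.
Qed.

Lemma applyC_sym g g' : L2U U Om g -> L2U U Om g' ->
  ipU Om (applyC g) g' = ipU Om (applyC g') g.
Proof.
move=> gL gL'; rewrite [RHS]ipUC.
have CgL := applyC_L2U gL; have CgL' := applyC_L2U gL'.
congr (fine _); apply: ae_eq_integral => //.
- exact: measurable_int (integrable_frob mOm CgL.2 gL'.2).1.
- exact: measurable_int (integrable_frob mOm gL.2 CgL'.2).1.
case: hC => _ _ _ hs _; apply: ae_on_filterS hs => x Omx hs.
by rewrite /applyC hs//; [exact: gL.1|exact: gL'.1].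
Qed.

Lemma ipU_applyC_lin c g g' h : L2U U Om g -> L2U U Om g' -> L2U U Om h ->
  ipU Om (applyC (fun x => c *: g x + g' x)) h =
  c * ipU Om (applyC g) h + ipU Om (applyC g') h.
Proof.
move=> gL gL' hL; rewrite -(ipU_lin hP mOm)//; try exact: applyC_L2U.
by apply: eq_ipU => // x Omx; apply: applyC_lin => //; [exact: gL.1|exact: gL'.1].
Qed.

Lemma applyC_norm : exists2 M, 0 <= M & forall g, L2U U Om g ->
  norm2U Om (applyC g) <= M * norm2U Om g.
Proof.
have [M M0 hM] := applyC_bound; exists M => // g gL.
have CgL := applyC_L2U gL.
have [int_g gE] := integrable_frob mOm gL.2 gL.2.
have [int_Cg _] := integrable_frob mOm CgL.2 CgL.2.
rewrite /norm2U -[X in X * _](ger0_norm M0) -sqrtr_sqr -sqrtrM ?sqr_ge0//.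
rewrite ler_sqrt ?mulr_ge0 ?sqr_ge0 ?ipU_ge0//.
rewrite {2}/ipU -RintegralZl//; apply: Rintegral_ae_le => //.
  exact: (integrableZl mOm (M ^+ 2) int_g).
by apply: ae_on_filterS hM => x Omx; apply; exact: gL.1.
Qed.

Lemma applyC_coercive : exists2 c, 0 < c & forall g, L2U U Om g ->
  c * ipU Om g g <= ipU Om (applyC g) g.
Proof.
case: (hC) => _ _ _ _ [c c0 hc]; exists c => // g gL.
have CgL := applyC_L2U gL.
have [int_g _] := integrable_frob mOm gL.2 gL.2.
have [int_Cg _] := integrable_frob mOm CgL.2 gL.2.
rewrite {1}/ipU -RintegralZl//; apply: Rintegral_ae_le => //.
  exact: (integrableZl mOm c int_g).
by apply: ae_on_filterS hc => x Omx; apply; exact: gL.1.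
Qed.

End tensor_field.

(** * The variational problem *)

Section variational_problem.
Context (R : realType) (d N m n : nat) (U : set 'M[R]_(m, n)).
Context (P : 'M[R]_(m, n) -> 'M[R]_(m, n)) (hP : orth_proj U P).
Context (a : diffop R d N m n) (ha : forall alpha, U (a alpha)).
Context (Om : set 'rV[R]_d) (oOm : open Om).
Context (Omfin : (lebesgue_rV d Om < +oo)%E).
Context (C : 'rV[R]_d -> 'M[R]_(m, n) -> 'M[R]_(m, n)).
Context (hC : spd_tensor_field U Om C).
Implicit Types (v q f : 'rV[R]_d -> R) (w g : 'rV[R]_d -> 'M[R]_(m, n)).
Local Notation L2UOm := (L2U U Om).

Let mOm : measurable Om := open_measurable_rV oOm.

Lemma norm2U_ge0 g : 0 <= norm2U Om g. Proof. exact: sqrtr_ge0. Qed.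
Lemma norm2_ge0 f : 0 <= norm2 Om f. Proof. exact: sqrtr_ge0. Qed.

Lemma sqr_norm2U g : norm2U Om g ^+ 2 = ipU Om g g.
Proof. by rewrite sqr_sqrtr// ipU_ge0. Qed.

Lemma sqr_norm2 f : norm2 Om f ^+ 2 = ip Om f f.
Proof. by rewrite sqr_sqrtr// ip_ge0. Qed.

Lemma ipU_le_applyC c g : 0 < c -> c * ipU Om g g <= ipU Om (applyC C g) g ->
  ipU Om g g <= c^-1 * ipU Om (applyC C g) g.
Proof. by move=> c0 h; rewrite mulrC ler_pdivlMr// mulrC. Qed.

Lemma applyC_ge0 g : L2UOm g -> 0 <= ipU Om (applyC C g) g.
Proof.
move=> gL; have [c c0 hc] := applyC_coercive hP mOm hC.
by apply: le_trans (hc g gL); rewrite mulr_ge0 ?ipU_ge0// ltW.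
Qed.

Lemma norm2U_le_applyC : exists2 K, 0 <= K & forall g, L2UOm g ->
  norm2U Om g <= K * Num.sqrt (ipU Om (applyC C g) g).
Proof.
have [c c0 hc] := applyC_coercive hP mOm hC.
exists (Num.sqrt c^-1) => [|g gL]; first exact: sqrtr_ge0.
have c0' : 0 <= c^-1 by rewrite invr_ge0 ltW.
rewrite -sqrtrM// ler_sqrt ?mulr_ge0 ?applyC_ge0//.
exact: ipU_le_applyC (hc g gL).
Qed.

Lemma applyC_le_norm2U : exists2 K, 0 <= K & forall g, L2UOm g ->
  ipU Om (applyC C g) g <= K * ipU Om g g.
Proof.
have [K K0 hK] := applyC_norm hP mOm hC; exists K => // g gL.
have CgL := applyC_L2U hP mOm hC gL.
apply: le_trans (ler_norm _) _.
apply: le_trans (ipU_cauchy_schwarz hP mOm CgL gL) _.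
by rewrite -sqr_norm2U expr2 mulrA ler_wpM2r ?norm2U_ge0//; exact: hK.
Qed.

(** The form (C g, g) is equivalent to the squared L_2 norm: coercivity transfers the Cauchy
    property, boundedness transfers the convergence back. The Cauchy property in L_2 is returned as
    well, because the Friedrichs inequality will pass it on to v. *)
Lemma applyC_complete (g_ : nat -> 'rV[R]_d -> 'M[R]_(m, n)) :
  (forall k, L2UOm (g_ k)) ->
  (forall e, 0 < e -> exists N, forall k l, (N <= k)%N -> (N <= l)%N ->
     ipU Om (applyC C (fun x => -1 *: g_ k x + g_ l x))
            (fun x => -1 *: g_ k x + g_ l x) < e) ->
  (forall e, 0 < e -> exists N, forall k l, (N <= k)%N -> (N <= l)%N ->
     ipU Om (fun x => -1 *: g_ k x + g_ l x)
            (fun x => -1 *: g_ k x + g_ l x) < e) /\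
  exists2 g, L2UOm g & forall e, 0 < e -> exists N, forall k, (N <= k)%N ->
     ipU Om (applyC C (fun x => -1 *: g_ k x + g x))
            (fun x => -1 *: g_ k x + g x) < e /\
     ipU Om (fun x => -1 *: g_ k x + g x) (fun x => -1 *: g_ k x + g x) < e.
Proof.
move=> gL gC; have [c c0 hc] := applyC_coercive hP mOm hC.
have gC' : forall e, 0 < e -> exists N, forall k l, (N <= k)%N -> (N <= l)%N ->
     ipU Om (fun x => -1 *: g_ k x + g_ l x) (fun x => -1 *: g_ k x + g_ l x) < e.
  move=> e e0; have [M hM] := gC _ (mulr_gt0 c0 e0).
  exists M => k l Nk Nl; rewrite -(ltr_pM2l c0).
  by apply: le_lt_trans (hM k l Nk Nl); apply: hc; exact: (L2U_lin hP).
split=> //.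
have [g gL' gg] := L2U_complete hP mOm gL gC'.
exists g => // e e0; have [K K0 hK] := applyC_le_norm2U.
have K1 : 0 < K + 1 by rewrite ltr_wpDl.
have [N1 hN1] := gg _ (divr_gt0 e0 K1); have [N2 hN2] := gg _ e0.
exists (maxn N1 N2) => k; rewrite geq_max => /andP[k1 k2]; split; last exact: hN2.
have dL : L2UOm (fun x => -1 *: g_ k x + g x) by exact: (L2U_lin hP).
apply: (le_lt_trans (hK _ dL)).
apply: (@le_lt_trans _ _ ((K + 1) * ipU Om (fun x => -1 *: g_ k x + g x)
  (fun x => -1 *: g_ k x + g x))); last by rewrite mulrC -ltr_pdivlMr//; exact: hN1.
by rewrite ler_wpM2r ?ipU_ge0// lerDl.
Qed.

(* The pointwise inverse of C is obtained from the Riesz theorem, which spares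
   a proof that it is measurable. *)
Lemma applyC_surjective w : L2UOm w ->
  exists2 z, L2UOm z & ae_on Om (fun x => C x (z x) = w x).
Proof.
move=> wL; have [K K0 hK] := norm2U_le_applyC.
have [z zL zw] : exists2 z, L2UOm z & forall g, L2UOm g ->
    ipU Om (applyC C z) g = ipU Om w g.
  apply: (@riesz_representation R _ L2UOm (fun c g g' x => c *: g x + g' x)
    (fun g g' => ipU Om (applyC C g) g') _ _ _ _ (ipU Om w) (norm2U Om w * K)).
  - by move=> c g g'; exact: (L2U_lin hP).
  - by move=> c g g' h; exact: (ipU_applyC_lin hP mOm hC).
  - by move=> g g'; exact: (applyC_sym hP mOm hC).
  - by move=> g; exact: applyC_ge0.
  - by exists (fun=> 0); exact: (L2U_0 hP).
  - by move=> c g g' gL gL'; rewrite ipUC (ipU_lin hP)// !(ipUC _ w).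
  - move=> g gL; apply: le_trans (ipU_cauchy_schwarz hP mOm wL gL) _.
    by rewrite -mulrA ler_wpM2l ?norm2U_ge0//; exact: hK.
  - move=> g_ gL gC; have [_ [g gL' gg]] := applyC_complete gL gC.
    by exists g => // e /gg[M hM]; exists M => k /hM[].
exists z => //; have CzL := applyC_L2U hP mOm hC zL.
have dL : L2UOm (fun x => -1 *: applyC C z x + w x) by exact: (L2U_lin hP).
(* The residual w - C z is tested with itself: z represents w against every field in L_2. *)
have : ipU Om (fun x => -1 *: applyC C z x + w x)
    (fun x => -1 *: applyC C z x + w x) = 0.
  by rewrite (ipU_lin hP)// zw// mulN1r addNr.
move=> /(ipU_eq0 mOm dL); apply: ae_on_filterS => x _.
by rewrite scaleN1r addrC => /subr0_eq/esym.
Qed.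

Lemma applyC_injective g g' : L2UOm g -> L2UOm g' ->
  ae_on Om (fun x => C x (g x) = C x (g' x)) -> ae_on Om (fun x => g x = g' x).
Proof.
move=> gL gL' gg'; have dL : L2UOm (fun x => -1 *: g x + g' x).
  exact: (L2U_lin hP).
have : ipU Om (fun x => -1 *: g x + g' x) (fun x => -1 *: g x + g' x) = 0.
  apply/eqP; rewrite eq_le ipU_ge0 andbT.
  have [c c0 hc] := applyC_coercive hP mOm hC.
  rewrite -(ler_pM2l c0) mulr0 (le_trans (hc _ dL))//.
  rewrite (ipU_applyC_lin hP mOm hC)//.
  rewrite (@ipU_ae _ _ _ _ U Om mOm (applyC C g) (applyC C g'))//.
  - by rewrite mulN1r addNr.
  - exact: (applyC_L2U hP).
  - exact: (applyC_L2U hP).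
move=> /(ipU_eq0 mOm dL); apply: ae_on_filterS => x _.
by rewrite scaleN1r addrC => /subr0_eq/esym.
Qed.

Lemma applyCinvP w : L2UOm w -> L2UOm (applyCinv U Om C w) /\
  ae_on Om (fun x => C x (applyCinv U Om C w x) = w x).
Proof.
move=> wL; have [z zL zw] := applyC_surjective wL.
have [? ?] : [set z | L2U U Om z /\ ae_on Om (fun x => C x (z x) = w x)]
    (applyCinv U Om C w) by apply: xgetPex; exists z.
by [].
Qed.

(* The pairs (v, A v) with v in H_0(A); unlike the representative [dA v], the
   graph is exactly linear. *)
Definition graphA0 v g := graphA U a Om v g /\
  forall w q, graphAs U a Om w q -> ipU Om g w = ip Om v q.

Lemma graphA0_lin c v g v' g' : graphA0 v g -> graphA0 v' g' ->
  graphA0 (fun x => c * v x + v' x) (fun x => c *: g x + g' x).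
Proof.
move=> [vg bv] [vg' bv']; split; first exact: (graphA_lin hP).
move=> w q wq; have [wL qL _] := wq; have [vL gL _] := vg; have [vL' gL' _] := vg'.
by rewrite (ipU_lin hP)// ip_lin// (bv w q)// (bv' w q).
Qed.

Lemma graphA0_0 : graphA0 (fun=> 0) (fun=> 0).
Proof.
split; first exact: (graphA_0 hP a mOm).
move=> w q [wL qL _]; rewrite ip0l.
have ZL := L2U_0 hP mOm.
have := ipU_lin hP mOm (-1) ZL ZL wL; rewrite mulN1r addNr => <-.
by apply: eq_ipU => // x _; rewrite scaler0 addr0.
Qed.

(** For a test function, the vanishing of the boundary pairing with w is exactly the definition of
    the weak A^* w. *)
Lemma graphA0_test psi : test_fun Om psi -> graphA0 psi (A_test a psi).
Proof.
move=> tpsi; split; first exact: (graphA_test hP ha).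
by move=> w q [_ _ wq]; rewrite ipUC -wq// ipC.
Qed.

Lemma graphA0_H0A v g : graphA0 v g -> H0A U a Om v.
Proof.
move=> [vg bv]; split; first exact: graphA_HA vg.
move=> w /graph_dAs wq; have [_ gL _] := vg; have [wL _ _] := wq.
have [_ dL _] := graph_dA (graphA_HA vg).
rewrite /gammaGamma (@ipU_ae _ _ _ _ U Om mOm _ g)//.
  by rewrite (bv _ _ wq) subrr.
exact: (dA_ae hP).
Qed.

Lemma H0A_graphA0 v : H0A U a Om v -> graphA0 v (dA U a Om v).
Proof.
move=> [vH bv]; have vg := graph_dA vH; split=> // w q wq.
have wH := graphAs_HAs wq; have [_ dL _] := graph_dAs wH.
have [vL _ _] := vg; have [_ qL _] := wq.
have := bv w wH; rewrite /gammaGamma => /subr0_eq ->.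
rewrite ipC [RHS]ipC; apply: ip_ae => //.
exact: (dAs_ae hP ha).
Qed.

Context (CPF : R) (CPF_gt0 : 0 < CPF).
Context (hPF : forall v, H0A U a Om v ->
  norm2 Om v <= CPF * norm2U Om (dA U a Om v)).

Lemma poincare v g : graphA0 v g -> norm2 Om v <= CPF * norm2U Om g.
Proof.
move=> vg; apply: le_trans (hPF (graphA0_H0A vg)) _.
have [vg' _] := vg; have [_ gL _] := vg'.
have [_ dL _] := graph_dA (graphA_HA vg').
have da := dA_ae hP oOm Omfin vg'.
rewrite ler_wpM2l ?(ltW CPF_gt0)// /norm2U (ipU_ae mOm dL gL dL da).
by rewrite ipUC (ipU_ae mOm dL gL gL da).
Qed.

(** Both conditions defining H_0(A), the weak derivative and the zero trace, are identities (g, p) =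
    (v, q); passing to the limit in these proves that the space is closed. *)
Lemma graph_limit (v_ : nat -> 'rV[R]_d -> R) (g_ : nat -> 'rV[R]_d -> 'M[R]_(m, n))
    v g p q :
  (forall k, L2 Om (v_ k)) -> (forall k, L2UOm (g_ k)) -> L2 Om v -> L2UOm g ->
  L2 Om q -> L2UOm p ->
  (forall e, 0 < e -> exists N, forall k, (N <= k)%N ->
     ip Om (fun x => -1 * v_ k x + v x) (fun x => -1 * v_ k x + v x) < e) ->
  (forall e, 0 < e -> exists N, forall k, (N <= k)%N ->
     ipU Om (fun x => -1 *: g_ k x + g x) (fun x => -1 *: g_ k x + g x) < e) ->
  (forall k, ipU Om (g_ k) p = ip Om (v_ k) q) -> ipU Om g p = ip Om v q.
Proof.
move=> vkL gkL vL gL qL pL vv gg E; apply/eqP; rewrite -subr_eq0 -normr_le0.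
apply/ler_addgt0Pl => e e0; rewrite addr0.
(* The error is at most (|p| + |q|) e/s <= e; the summand 1 keeps s positive. *)
pose s := norm2U Om p + norm2 Om q + 1.
have s0 : 0 < s by rewrite ltr_wpDl// addr_ge0 ?norm2U_ge0 ?norm2_ge0.
have es : 0 < (e / s) ^+ 2 by rewrite exprn_gt0// divr_gt0.
have [M1 hM1] := vv _ es; have [M2 hM2] := gg _ es.
pose k := maxn M1 M2.
have vd := hM1 k (leq_maxl _ _); have gd := hM2 k (leq_maxr _ _).
have dvL : L2 Om (fun x => -1 * v_ k x + v x) by exact: L2_lin.
have dgL : L2UOm (fun x => -1 *: g_ k x + g x) by exact: (L2U_lin hP).
have es0 : 0 <= e / s by rewrite divr_ge0// ltW.
have vd' : norm2 Om (fun x => -1 * v_ k x + v x) <= e / s.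
  by rewrite -(ger0_norm es0) -sqrtr_sqr ler_sqrt ?sqr_ge0// ltW.
have gd' : norm2U Om (fun x => -1 *: g_ k x + g x) <= e / s.
  by rewrite -(ger0_norm es0) -sqrtr_sqr ler_sqrt ?sqr_ge0// ltW.
have -> : ipU Om g p - ip Om v q = ipU Om (fun x => -1 *: g_ k x + g x) p -
    ip Om (fun x => -1 * v_ k x + v x) q.
  by rewrite (ipU_lin hP)// ip_lin// E; ring.
rewrite (le_trans (ler_normB _ _))//.
have h1 := ipU_cauchy_schwarz hP mOm dgL pL.
have h2 := ip_cauchy_schwarz mOm dvL qL.
have p0 := norm2U_ge0 p; have q0 := norm2_ge0 q.
apply: le_trans (lerD (le_trans h1 (ler_wpM2r p0 gd'))
  (le_trans h2 (ler_wpM2r q0 vd'))) _.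
rewrite -mulrDr mulrAC ler_pdivrMr// ler_wpM2l ?(ltW e0)//.
by rewrite /s lerDl.
Qed.

(** The Riesz theorem on pairs (v, g), with a form that sees only g. The Friedrichs inequality
    bounds the functional and, applied to differences, makes the components v Cauchy. *)
Lemma variational_solution f : L2 Om f -> exists v g, graphA0 v g /\
  forall v' g', graphA0 v' g' -> ipU Om (applyC C g) g' = ip Om f v'.
Proof.
move=> fL; have [K K0 hK] := norm2U_le_applyC.
pose S := [set x : ('rV[R]_d -> R) * ('rV[R]_d -> 'M[R]_(m, n)) | graphA0 x.1 x.2].
pose lin c (x y : ('rV[R]_d -> R) * ('rV[R]_d -> 'M[R]_(m, n))) :=
  (fun t => c * x.1 t + y.1 t, fun t => c *: x.2 t + y.2 t).
have S1 x : S x -> L2 Om x.1 by move=> [[]].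
have S2 x : S x -> L2UOm x.2 by move=> [[]].
have [[v g] vg hvg] : exists2 x, S x & forall y, S y ->
    ipU Om (applyC C x.2) y.2 = ip Om f y.1.
  apply: (@riesz_representation R _ S lin (fun x y => ipU Om (applyC C x.2) y.2)
    _ _ _ _ (fun y => ip Om f y.1) (norm2 Om f * (CPF * K))).
  - by move=> c [v g] [v' g']; exact: graphA0_lin.
  - by move=> c x y z Sx Sy Sz; apply: (ipU_applyC_lin hP mOm hC); exact: S2.
  - by move=> x y Sx Sy; apply: (applyC_sym hP mOm hC); exact: S2.
  - by move=> x Sx; apply: applyC_ge0; exact: S2.
  - by exists (fun=> 0, fun=> 0); exact: graphA0_0.
  - move=> c x y Sx Sy; rewrite ipC ip_lin//; [|exact: S1|exact: S1].
    by rewrite !(ipC _ f).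
  - move=> x Sx; apply: le_trans (ip_cauchy_schwarz mOm fL (S1 x Sx)) _.
    rewrite -mulrA ler_wpM2l ?norm2_ge0//.
    apply: le_trans (poincare Sx) _; rewrite -mulrA ler_wpM2l ?(ltW CPF_gt0)//.
    by apply: hK; exact: S2.
  - move=> x_ Sx_ xC.
    have [gC [g gL gg]] := applyC_complete (fun k => S2 _ (Sx_ k)) xC.
    have vC e : 0 < e -> exists N, forall k l, (N <= k)%N -> (N <= l)%N ->
        ip Om (fun t => -1 * (x_ k).1 t + (x_ l).1 t)
              (fun t => -1 * (x_ k).1 t + (x_ l).1 t) < e.
      move=> e0; have CPF2 : 0 < CPF ^+ 2 by rewrite exprn_gt0.
      have [M hM] := gC _ (divr_gt0 e0 CPF2); exists M => k l Mk Ml.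
      have := hM k l Mk Ml; rewrite ltr_pdivlMr// mulrC; apply: le_lt_trans.
      have := poincare (graphA0_lin (-1) (Sx_ k) (Sx_ l)).
      rewrite -sqr_norm2 -sqr_norm2U -exprMn.
      by rewrite ler_pXn2r ?nnegrE ?norm2_ge0// mulr_ge0 ?norm2U_ge0// ltW.
    have [v vL vv] := L2_complete mOm (fun k => S1 _ (Sx_ k)) vC.
    have gg' e : 0 < e -> exists N, forall k, (N <= k)%N ->
        ipU Om (fun t => -1 *: (x_ k).2 t + g t) (fun t => -1 *: (x_ k).2 t + g t) < e.
      by move=> /gg[M hM]; exists M => k /hM[].
    exists (v, g); last by move=> e /gg[M hM]; exists M => k /hM[].
    (* Used twice: with U-valued test functions for the weak derivative, and with fields of H(A^* )
       for the zero trace. *)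
    have lim p q : L2UOm p -> L2 Om q ->
        (forall k, ipU Om (x_ k).2 p = ip Om (x_ k).1 q) -> ipU Om g p = ip Om v q.
      move=> pL qL; apply: (@graph_limit (fun k => (x_ k).1) (fun k => (x_ k).2)) => //.
        by move=> k; exact: S1.
      by move=> k; exact: S2.
    split=> /=; first split=> //.
      move=> eta teta; apply: lim.
      + exact: (test_funU_L2U mOm teta).
      + exact: (As_test_L2 a mOm teta).
      + by move=> k; have [[_ _ h] _] := Sx_ k; exact: h.
    move=> w q wq; have [wL qL _] := wq; apply: lim => // k.
    by have [_] := Sx_ k; exact.
by exists v, g; split=> // v' g' vg'; exact: (hvg (v', g')).
Qed.

(** The mesh-free form of the problem: g stands for A u, and [graphAs] states A^* w = f on the whole
    domain. *)
Definition strong_solution f w u g :=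
  [/\ graphA0 u g, L2UOm w, ae_on Om (fun x => w x = C x (g x)) &
      graphAs U a Om w f].

Lemma strong_solution_exists f : L2 Om f -> exists w u g, strong_solution f w u g.
Proof.
move=> fL; have [u [g [ug hug]]] := variational_solution fL.
have [[_ gL _] _] := ug; have CgL := applyC_L2U hP mOm hC gL.
exists (applyC C g), u, g; split=> //; first exact: aeW.
by split=> // psi tpsi; rewrite -(hug _ _ (graphA0_test tpsi)).
Qed.

Lemma strong_solution_lin c f w u g f' w' u' g' :
  strong_solution f w u g -> strong_solution f' w' u' g' ->
  strong_solution (fun x => c * f x + f' x) (fun x => c *: w x + w' x)
    (fun x => c * u x + u' x) (fun x => c *: g x + g' x).
Proof.
move=> [ug wL wg wf] [ug' wL' wg' wf']; split.
- exact: graphA0_lin.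
- exact: (L2U_lin hP).
- apply: ae_on_filterS2 wg wg' => x Omx -> ->.
  have [[_ gL _] _] := ug; have [[_ gL' _] _] := ug'.
  by rewrite -[RHS]/(applyC C (fun x => c *: g x + g' x) x) (applyC_lin hC)//;
    [exact: gL.1|exact: gL'.1].
- exact: (graphAs_lin hP ha).
Qed.

Lemma strong_solution_bound : exists2 K, 0 <= K & forall f w u g,
  strong_solution f w u g -> [/\ norm2U Om w <= K * norm2 Om f,
    norm2 Om u <= K * norm2 Om f & norm2U Om g <= K * norm2 Om f].
Proof.
have [c c0 hc] := applyC_coercive hP mOm hC.
have [M M0 hM] := applyC_norm hP mOm hC.
pose G := CPF / c.
have G0 : 0 <= G by rewrite divr_ge0// ltW.
(* The three terms bound |w|, |u| and |g| in this order, with G coming from c |g|^2 <= |u| |f| <=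
   CPF |g| |f|. *)
exists (M * G + CPF * G + G).
  by rewrite !addr_ge0// mulr_ge0// ltW.
move=> f w u g [ug wL wg wf].
have [ugA bu] := ug; have [uL gL _] := ugA; have [_ fL _] := wf.
have CgL := applyC_L2U hP mOm hC gL.
have gG : norm2U Om g <= G * norm2 Om f.
  have h1 : c * norm2U Om g ^+ 2 <= norm2 Om u * norm2 Om f.
    rewrite sqr_norm2U (le_trans (hc g gL))//.
    have -> : ipU Om (applyC C g) g = ip Om u f.
      rewrite -(bu _ _ wf) [RHS]ipUC.
      by apply/esym; exact: (ipU_ae mOm wL CgL gL wg).
    by rewrite (le_trans (ler_norm _))// ip_cauchy_schwarz.
  have h2 : c * norm2U Om g ^+ 2 <= CPF * norm2U Om g * norm2 Om f.
    by rewrite (le_trans h1)// ler_wpM2r ?norm2_ge0// poincare.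
  have [g0|g0] := eqVneq (norm2U Om g) 0.
    by rewrite g0 mulr_ge0 ?norm2_ge0.
  have gp : 0 < norm2U Om g by rewrite lt0r g0 norm2U_ge0.
  rewrite /G mulrAC ler_pdivlMr// -(ler_pM2r gp); move: h2; lra.
have f0 := norm2_ge0 f.
have wE : norm2U Om w = norm2U Om (applyC C g).
  rewrite /norm2U; congr Num.sqrt.
  by rewrite (ipU_ae mOm wL CgL wL wg) ipUC (ipU_ae mOm wL CgL CgL wg).
have cpf0 := ltW CPF_gt0.
have Gf : 0 <= G * norm2 Om f by rewrite mulr_ge0.
have CGf : 0 <= CPF * (G * norm2 Om f) by rewrite mulr_ge0.
have MGf : 0 <= M * (G * norm2 Om f) by rewrite mulr_ge0.
have h3 : norm2U Om w <= M * (G * norm2 Om f).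
  by rewrite wE (le_trans (hM g gL))// ler_wpM2l.
have h4 : norm2 Om u <= CPF * (G * norm2 Om f).
  by rewrite (le_trans (poincare ug))// ler_wpM2l.
by split; lra.
Qed.

End variational_problem.

(** * The mixed hybrid formulation *)

Lemma sqrt_sum_sqr_le (R : realType) (s t : R) : 0 <= s -> 0 <= t ->
  Num.sqrt (s ^+ 2 + t ^+ 2) <= s + t.
Proof.
move=> s0 t0; rewrite -[leRHS]ger0_norm ?addr_ge0// -sqrtr_sqr.
by rewrite ler_sqrt ?sqr_ge0// sqrrD; have := mulr_ge0 s0 t0; lra.
Qed.

Section mesh_formulation.
Context (R : realType) (d N m n : nat) (U : set 'M[R]_(m, n)).
Context (P : 'M[R]_(m, n) -> 'M[R]_(m, n)) (hP : orth_proj U P).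
Context (a : diffop R d N m n) (ha : forall alpha, U (a alpha)).
Context (Om : set 'rV[R]_d) (oOm : open Om).
Context (Omfin : (lebesgue_rV d Om < +oo)%E).
Context (C : 'rV[R]_d -> 'M[R]_(m, n) -> 'M[R]_(m, n)).
Context (hC : spd_tensor_field U Om C).
Context (K : nat) (T : 'I_K -> set 'rV[R]_d) (hT : regular_mesh Om T).
Context (Ht : set ('rV[R]_d -> 'M[R]_(m, n))).
Context (hHt : closed_intermediate_space U a Om T Ht).
Implicit Types (v q f u : 'rV[R]_d -> R) (w g z : 'rV[R]_d -> 'M[R]_(m, n)).

Let mOm : measurable Om := open_measurable_rV oOm.

Lemma mesh_open i : open (T i).
Proof. by have [h _ _] := hT; apply: polyhedral_open; case: (h i). Qed.

Lemma mesh_measurable i : measurable (T i).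
Proof. by apply: open_measurable_rV; exact: mesh_open. Qed.

Lemma mesh_sub i : T i `<=` Om.
Proof. by have [h _ _] := hT; case: (h i). Qed.

Lemma mesh_finite i : (lebesgue_rV d (T i) < +oo)%E.
Proof.
apply: le_lt_trans Omfin; apply: le_measure; rewrite ?inE//.
- exact: mesh_measurable.
- exact: mesh_sub.
Qed.

Lemma mesh_L2 i v : L2 Om v -> L2 (T i) v.
Proof. by apply: L2S => //; [exact: mesh_measurable|exact: mesh_sub]. Qed.

Lemma mesh_ae i (Q : 'rV[R]_d -> Prop) : ae_on Om Q -> ae_on (T i) Q.
Proof. by rewrite /ae_on; apply: filterS => x Qx /mesh_sub; exact: Qx. Qed.

(** The cut-offs of q to the disjoint elements add up to q off the skeleton, which is a null set. *)
Lemma ip_mesh f q : L2 Om f -> L2 Om q -> \sum_i ip (T i) f q = ip Om f q.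
Proof.
move=> fL qL; pose q_ i x := \1_(T i) x * q x.
have q_L i : L2 Om (q_ i).
  apply: (@L2_dominated _ _ _ mOm _ (fun x => q x ^+ 2)).
  - apply: measurable_funM; last by case: qL.
    exact: measurable_indic (mesh_measurable i).
  - by move/L2P: qL => [].
  - move=> x _; rewrite /q_ indicE; case: (_ \in _); rewrite ?mul1r ?mul0r//.
    by rewrite expr0n sqr_ge0.
have -> : \sum_i ip (T i) f q = \sum_i ip Om (q_ i) f.
  apply: eq_bigr => i _; rewrite (ipC Om) -(ip_subset f (@mesh_sub i)).
    by apply: eq_ip => // x Tx; rewrite /q_ indicE mem_set// mul1r.
  by move=> x Tx; rewrite /q_ indicE memNset// mul0r.
rewrite -ip_suml// [RHS]ipC; apply: ip_ae => //.
  exact: L2_sum.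
have := regular_mesh_ae hT; rewrite -/(ae_on Om _).
apply: ae_on_filterS => x _ [i _ Tix].
rewrite (bigD1 i)//= /q_ indicE mem_set// mul1r big1 ?addr0// => j ji.
rewrite indicE memNset ?mul0r// => Tjx.
have [_ + _] := hT; move=> /(_ _ _ ji)/seteqP[/(_ x)+ _].
by apply.
Qed.

Lemma mesh_graphAs i w q : graphAs U a Om w q -> graphAs U a (T i) w q.
Proof.
apply: graphAs_subset; [exact: mOm|exact: mesh_measurable|exact: mesh_sub].
Qed.

Lemma mesh_dAs i w q : graphAs U a Om w q ->
  ae_on (T i) (fun x => dAs a (T i) w x = q x).
Proof.
move=> /(mesh_graphAs i); apply: (dAs_ae hP ha); [exact: mesh_open|exact: mesh_finite].
Qed.

Lemma mesh_dAs_L2 i w : HAsT U a Om T w -> L2 (T i) (dAs a (T i) w).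
Proof.
move=> [wL /(_ i)[q [qL wq]]].
have : HAs U a (T i) w.
  split; last by exists q.
  exact: (L2US mOm (mesh_measurable i) (@mesh_sub i) wL).
by move=> /graph_dAs[].
Qed.

Lemma ip_meshAs_graphAs v w q : L2 Om v -> graphAs U a Om w q ->
  ip_meshAs a T v w = ip Om v q.
Proof.
move=> vL wq; have [wL qL _] := wq; rewrite -ip_mesh//; apply: eq_bigr => i _.
rewrite ipC [RHS]ipC; apply: ip_ae.
- exact: mesh_measurable.
- by have [] := graph_dAs (graphAs_HAs (mesh_graphAs i wq)).
- exact: mesh_L2.
- exact: mesh_L2.
- exact: mesh_dAs.
Qed.

(** On each element A^* w is the restriction of the global q, so the squared broken norms add up to
    a quantity that no longer depends on the mesh. *)
Lemma normAsT_le w q : graphAs U a Om w q ->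
  normAsT a Om T w <= norm2U Om w + norm2 Om q.
Proof.
move=> wq; have [wL qL _] := wq; rewrite /normAsT.
have -> : \sum_i norm2 (T i) (dAs a (T i) w) ^+ 2 = norm2 Om q ^+ 2.
  rewrite sqr_norm2 -ip_mesh//; apply: eq_bigr => i _; rewrite sqr_norm2.
  have [_ dL _] := graph_dAs (graphAs_HAs (mesh_graphAs i wq)).
  have dq := mesh_dAs i wq; have mT := mesh_measurable i.
  by rewrite (ip_ae mT dL (mesh_L2 i qL) dL dq) ipC
    (ip_ae mT dL (mesh_L2 i qL) (mesh_L2 i qL) dq).
by apply: sqrt_sum_sqr_le; exact: sqrtr_ge0.
Qed.

Lemma gammaS_graphA u g z : graphA U a Om u g -> L2U U Om z ->
  gammaS U a Om T u z = ipU Om g z - ip_meshAs a T u z.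
Proof.
move=> ug zL; have [_ gL _] := ug; have [_ dL _] := graph_dA (graphA_HA ug).
by rewrite /gammaS (ipU_ae mOm dL gL zL (dA_ae hP oOm Omfin ug)).
Qed.

Lemma gammaS_lin c u g u' g' z : graphA U a Om u g -> graphA U a Om u' g' ->
  Ht z -> gammaS U a Om T (fun x => c * u x + u' x) z =
  c * gammaS U a Om T u z + gammaS U a Om T u' z.
Proof.
move=> ug ug' zH; have [_ HtT _ _] := hHt; have zT := HtT _ zH.
have [zL _] := zT; have [uL gL _] := ug; have [uL' gL' _] := ug'.
rewrite (gammaS_graphA (graphA_lin hP c mOm ug ug') zL).
rewrite (gammaS_graphA ug zL) (gammaS_graphA ug' zL) (ipU_lin hP)//.
have -> : ip_meshAs a T (fun x => c * u x + u' x) z =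
    c * ip_meshAs a T u z + ip_meshAs a T u' z.
  rewrite mulr_sumr -big_split; apply: eq_bigr => i _ /=; apply: ip_lin.
  - exact: mesh_measurable.
  - exact: mesh_L2.
  - exact: mesh_L2.
  - exact: mesh_dAs_L2.
ring.
Qed.

(** For a global A^* w the sum over the elements collapses to one integral over Om, and the skeleton
    pairing becomes the boundary pairing, zero on H_0(A). *)
Lemma gammaS_HAs v w q : H0A U a Om v -> graphAs U a Om w q ->
  gammaS U a Om T v w = 0.
Proof.
move=> v0 wq; have [wL _ _] := wq.
have [vg bv] := H0A_graphA0 hP ha oOm Omfin v0; have [vL _ _] := vg.
by rewrite /gammaS (ip_meshAs_graphAs vL wq) (bv _ _ wq) subrr.
Qed.

Lemma normAS_le phi u g : graphA U a Om u g -> trace_of U a Om T Ht phi u ->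
  normAS U a Om T Ht phi <= norm2 Om u + norm2U Om g.
Proof.
move=> ug pu; have uH := graphA_HA ug.
apply: (@le_trans _ _ (normA U a Om u)).
  apply: ge_inf; last by exists u.
  by exists 0 => _ [v _ <-]; exact: sqrtr_ge0.
have [_ gL _] := ug; have [_ dL _] := graph_dA uH.
have dg := dA_ae hP oOm Omfin ug.
rewrite /normA (_ : norm2U Om (dA U a Om u) = norm2U Om g).
  by apply: sqrt_sum_sqr_le; exact: sqrtr_ge0.
by rewrite /norm2U (ipU_ae mOm dL gL dL dg) ipUC (ipU_ae mOm dL gL gL dg).
Qed.

(** Removes the mesh from an arbitrary solution, with g = C^{-1} w; uniqueness and estimates then
    concern the problem on Om only. *)
Lemma is_solution_strong f w u phi : L2 Om f ->
  is_solution U a Om T Ht C f w u phi -> exists g,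
  strong_solution U a Om C f w u g /\ trace_of U a Om T Ht phi u.
Proof.
move=> fL [wH uL [v v0 phiv] eq1 eq2]; have [HAsHt HtT _ _] := hHt.
have [wL _] := HtT _ wH; have [zL Cz] := applyCinvP hP oOm hC wL.
set z := applyCinv U Om C w in eq1 zL Cz.
have zu eta q : graphAs U a Om eta q -> ipU Om z eta = ip Om u q.
  move=> eq; have eH := HAsHt _ (graphAs_HAs eq).
  have := eq1 _ eH; rewrite (phiv _ eH) (gammaS_HAs v0 eq) subr0.
  by rewrite (ip_meshAs_graphAs uL eq) => /subr0_eq.
(* One identity yields two facts: U-valued test functions lie in H(A^* ), so z is the weak A u, and
   the remaining fields express that the trace of u is zero. *)
have uz : graphA0 U a Om u z.
  split; last exact: zu.
  split=> // eta teta; rewrite (zu _ _ (graphAs_test hP ha mOm teta))//.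
(* Admitting the zero trace separates the second equation into its volume part and its skeleton
   part. *)
have zero_trace : H0AS U a Om T Ht (fun=> 0).
  exists (fun=> 0); first exact: (graphA0_H0A hP oOm Omfin (graphA0_0 hP a oOm)).
  move=> x xH; have [xL _] := HtT _ xH.
  have g0 := graphA_0 hP a mOm.
  have := gammaS_lin (-1) g0 g0 xH.
  rewrite (_ : (fun y => _) = fun=> 0); last by apply/funext => y; rewrite mulr0 addr0.
  by move=> E; lra.
(* For a test function psi, the volume part gives (psi, A^* w)_T = (f, psi), and the skeleton part
   with the trace of psi gives (A psi, w) = (psi, A^* w)_T. Together they say A^* w = f across the
   element boundaries. *)
have wf : graphAs U a Om w f.
  split=> // psi tpsi.
  have psi0 := graphA0_test hP ha oOm tpsi; have psiH := graphA0_H0A hP oOm Omfin psi0.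
  have psiL : L2 Om psi by exact: test_fun_L2 mOm tpsi.
  have := eq2 psi _ psiL zero_trace; rewrite subr0 => /oppr_inj <-.
  have := eq2 (fun=> 0) (gammaS U a Om T psi) (L2_0 mOm).
  have -> : ip_meshAs a T (fun=> 0) w = 0 by apply: big1 => i _; exact: ip0l.
  rewrite (ipC _ f) ip0l oppr0 sub0r => E.
  have {}E : gammaS U a Om T psi w = 0.
    by apply/oppr_inj; rewrite oppr0 E//; exists psi.
  move: E; rewrite (gammaS_graphA psi0.1 wL) => /subr0_eq <-.
  exact: ipUC.
exists z; split.
  by split=> //; apply: ae_on_filterS Cz => x _ ->.
move=> x xH; have [xL _] := HtT _ xH.
have := eq1 x xH; rewrite (gammaS_graphA uz.1 xL) => /subr0_eq <-//.
Qed.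

(** Once C^{-1} w is identified with g, the first equation is the definition of the trace of u; in
    the second the skeleton term drops because A^* w is global. *)
Lemma strong_is_solution f w u g : strong_solution U a Om C f w u g ->
  is_solution U a Om T Ht C f w u (gammaS U a Om T u).
Proof.
move=> [ug wL wg wf]; have [HAsHt HtT _ _] := hHt.
have uH := graphA0_H0A hP oOm Omfin ug; have [ugA _] := ug; have [uL gL _] := ugA.
split=> //.
- exact/HAsHt/graphAs_HAs/wf.
- by exists u.
- move=> x xH; have [xL _] := HtT _ xH.
  have [zL Cz] := applyCinvP hP oOm hC wL.
  have zg : ae_on Om (fun x => applyCinv U Om C w x = g x).
    apply: (applyC_injective hP oOm hC zL gL).
    by apply: ae_on_filterS2 Cz wg => y _ -> ->.
  by rewrite (ipU_ae mOm zL gL xL zg) (gammaS_graphA ugA xL) subrr.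
- move=> du dphi duL [v v0 dphiv].
  have wH := HAsHt _ (graphAs_HAs wf).
  rewrite (dphiv _ wH) (gammaS_HAs v0 wf) subr0 (ip_meshAs_graphAs duL wf).
  by rewrite ipC.
Qed.

(** Applied to differences, the a priori bound gives continuous dependence, and uniqueness when f =
    f'. *)
Lemma solution_difference f w u g phi f' w' u' g' phi' :
  strong_solution U a Om C f w u g -> trace_of U a Om T Ht phi u ->
  strong_solution U a Om C f' w' u' g' -> trace_of U a Om T Ht phi' u' ->
  strong_solution U a Om C (fun x => f x - f' x) (fun x => w x - w' x)
    (fun x => u x - u' x) (fun x => g x - g' x) /\
  trace_of U a Om T Ht (fun z => phi z - phi' z) (fun x => u x - u' x).
Proof.
move=> s tr s' tr'.
have E (h h' : 'rV[R]_d -> R) : (fun x => -1 * h' x + h x) = (fun x => h x - h' x).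
  by apply/funext => x; rewrite mulN1r addrC.
have EU (h h' : 'rV[R]_d -> 'M[R]_(m, n)) :
    (fun x => -1 *: h' x + h x) = (fun x => h x - h' x).
  by apply/funext => x; rewrite scaleN1r addrC.
have := strong_solution_lin hP ha oOm hC (-1) s' s; rewrite !E !EU => ss; split=> //.
move=> z zH; have [[ug _] _ _ _] := s; have [[ug' _] _ _ _] := s'.
by have := gammaS_lin (-1) ug' ug zH; rewrite !E => ->; rewrite tr// tr'// mulN1r addrC.
Qed.

Context (Kb : R) (Kb0 : 0 <= Kb).
Context (hKb : forall f w u g, strong_solution U a Om C f w u g ->
  [/\ norm2U Om w <= Kb * norm2 Om f, norm2 Om u <= Kb * norm2 Om f &
      norm2U Om g <= Kb * norm2 Om f]).

(** The factor collects |w| + |A^* w| <= (Kb + 1)|f|, |u| <= Kb |f|, and |u| + |g| <= 2 Kb |f| for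
    the trace. *)
Lemma solution_bound f w u g phi : strong_solution U a Om C f w u g ->
  trace_of U a Om T Ht phi u ->
  normAsT a Om T w + norm2 Om u + normAS U a Om T Ht phi
    <= (4 * Kb + 1) * norm2 Om f.
Proof.
move=> s tr; have [h1 h2 h3] := hKb s; have [[ug _] _ _ wf] := s.
have := normAsT_le wf; have := normAS_le ug tr; lra.
Qed.

(** The bound with zero data also gives g = g' almost everywhere, and with u = u' this makes the two
    traces equal as functionals on [Ht]. *)
Lemma solution_unique f w u g phi w' u' g' phi' :
  strong_solution U a Om C f w u g -> trace_of U a Om T Ht phi u ->
  strong_solution U a Om C f w' u' g' -> trace_of U a Om T Ht phi' u' ->
  [/\ ae_on Om (fun x => w x = w' x), ae_on Om (fun x => u x = u' x) &
      forall z, Ht z -> phi z = phi' z].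
Proof.
move=> s tr s' tr'; have [ss _] := solution_difference s tr s' tr'.
have [h1 h2 h3] := hKb ss.
have f0 : norm2 Om (fun x => f x - f x) = 0.
  rewrite /norm2 (@eq_ip _ _ _ _ (fun=> 0) _ (fun x => f x - f x))//.
    by rewrite ip0l sqrtr0.
  by move=> x _; rewrite subrr.
rewrite f0 mulr0 in h1 h2 h3.
have [[[duL dgL _] _] dwL _ _] := ss.
have U0 h : L2U U Om h -> norm2U Om h <= 0 -> ae_on Om (fun x => h x = 0).
  move=> hL; rewrite /norm2U -sqrtr0 => h0; apply: (ipU_eq0 mOm hL).
  apply/eqP; rewrite eq_le ipU_ge0 andbT.
  by move: h0; rewrite sqrtr0 -[X in _ <= X]sqrtr0 ler_sqrt.
have uu' : ae_on Om (fun x => u x = u' x).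
  have : ip Om (fun x => u x - u' x) (fun x => u x - u' x) = 0.
    apply/eqP; rewrite eq_le ip_ge0 andbT.
    by move: h2; rewrite /norm2 -[X in _ <= X]sqrtr0 ler_sqrt.
  by move=> /(ip_eq0 mOm duL); apply: ae_on_filterS => x _ /subr0_eq.
split=> //.
  by apply: ae_on_filterS (U0 _ dwL h1) => x _ /subr0_eq.
move=> z zH; have [_ HtT _ _] := hHt; have zT := HtT _ zH; have [zL _] := zT.
have [[ug _] _ _ _] := s; have [[ug' _] _ _ _] := s'.
have [uL gL _] := ug; have [uL' gL' _] := ug'.
have gg' : ae_on Om (fun x => g x = g' x).
  by apply: ae_on_filterS (U0 _ dgL h3) => x _ /subr0_eq.
rewrite tr// tr'// (gammaS_graphA ug zL) (gammaS_graphA ug' zL).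
rewrite (ipU_ae mOm gL gL' zL gg'); congr (_ - _); apply: eq_bigr => i _.
apply: ip_ae.
- exact: mesh_measurable.
- exact: mesh_L2.
- exact: mesh_L2.
- exact: mesh_dAs_L2.
- exact: mesh_ae.
Qed.

End mesh_formulation.

(** * Well-posedness with one constant for all meshes *)

Theorem theorem3 (R : realType) (d : nat) (d_gt0 : (0 < d)%N)
    (Om : set 'rV[R]_d) (hOm : bounded_lipschitz_domain Om)
    (k : Ukind) (N : nat) (a : diffop R d N (Urows k d) (Ucols k d))
    (ha : forall alpha, Uset R k d (a alpha))
    (C : 'rV[R]_d -> 'M[R]_(Urows k d, Ucols k d) ->
         'M[R]_(Urows k d, Ucols k d))
    (hC : spd_tensor_field (Uset R k d) Om C)
    (CPF cis : R) (CPF_gt0 : 0 < CPF) (cis_gt0 : 0 < cis)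
    (hPF : forall v, H0A (Uset R k d) a Om v ->
       norm2 Om v <= CPF * norm2U Om (dA (Uset R k d) a Om v))
    (his : forall v, L2 Om v ->
       ((cis * norm2 Om v)%:E <=
        ereal_sup [set (ip Om (dAs a Om w) v)%:E |
          w in [set w | HAs (Uset R k d) a Om w /\ normAs a Om w = 1%R]])%E) :
  exists Cst : R,
  forall (K : nat) (T : 'I_K -> set 'rV[R]_d),
  regular_mesh Om T ->
  forall Ht : set ('rV[R]_d -> 'M[R]_(Urows k d, Ucols k d)),
  closed_intermediate_space (Uset R k d) a Om T Ht ->
  let solves := is_solution (Uset R k d) a Om T Ht C in
  [/\ forall f, L2 Om f -> exists w u phi, solves f w u phi,
      forall f w u phi w' u' phi', L2 Om f ->
        solves f w u phi -> solves f w' u' phi' ->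
        [/\ ae_on Om (fun x => w x = w' x), ae_on Om (fun x => u x = u' x) &
            forall z, Ht z -> phi z = phi' z],
      forall f f' w u phi w' u' phi', L2 Om f -> L2 Om f' ->
        solves f w u phi -> solves f' w' u' phi' ->
        normAsT a Om T (fun x => w x - w' x) + norm2 Om (fun x => u x - u' x) +
          normAS (Uset R k d) a Om T Ht (fun z => phi z - phi' z)
        <= Cst * norm2 Om (fun x => f x - f' x) &
      forall f w u phi, L2 Om f -> solves f w u phi ->
        normAsT a Om T w + norm2 Om u + normAS (Uset R k d) a Om T Ht phi
          <= Cst * norm2 Om f /\
        [/\ H0A (Uset R k d) a Om u,
            HAs (Uset R k d) a Om w,
            ae_on Om (fun x => w x = C x (dA (Uset R k d) a Om u x)),
            forall z, Ht z -> phi z = gammaS (Uset R k d) a Om T u z &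
            weakAs a Om (fun x => C x (dA (Uset R k d) a Om u x)) f]].
Proof.
have [oOm _ _ bOm _] := hOm; have mOm := open_measurable_rV oOm.
have Omfin := bounded_lebesgue_rV_lty mOm bOm.
have [P hP] := Uset_orth_proj R k d.
have [Kb Kb0 hKb] := strong_solution_bound hP oOm Omfin hC CPF_gt0 hPF.
(* [Kb] comes from the problem on Om alone, so the constant is fixed before any mesh is
   introduced. *)
exists (4 * Kb + 1) => K T hT Ht hHt solves.
have to_strong f w u phi : L2 Om f -> solves f w u phi -> exists g,
    strong_solution (Uset R k d) a Om C f w u g /\
    trace_of (Uset R k d) a Om T Ht phi u.
  exact: (is_solution_strong hP ha oOm Omfin hC hT hHt).
split.
- move=> f fL.
  have [w [u [g s]]] := strong_solution_exists hP ha oOm Omfin hC CPF_gt0 hPF fL.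
  exists w, u, (gammaS (Uset R k d) a Om T u).
  exact: (strong_is_solution hP ha oOm Omfin hC hT hHt s).
- move=> f w u phi w' u' phi' fL /(to_strong _ _ _ _ fL)[g [s tr]].
  move=> /(to_strong _ _ _ _ fL)[g' [s' tr']].
  exact: (solution_unique hP ha oOm Omfin hC hT hHt hKb s tr s' tr').
- move=> f f' w u phi w' u' phi' fL fL' /(to_strong _ _ _ _ fL)[g [s tr]].
  move=> /(to_strong _ _ _ _ fL')[g' [s' tr']].
  have [ss trr] := solution_difference hP ha oOm Omfin hC hT hHt s tr s' tr'.
  exact: (solution_bound hP ha oOm Omfin hT hKb ss trr).
- move=> f w u phi fL /(to_strong _ _ _ _ fL)[g [s tr]]; split.
    exact: (solution_bound hP ha oOm Omfin hT hKb s tr).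
  have [ug wL wg wf] := s; have [ugA _] := ug.
  have [_ dL _] := graph_dA (graphA_HA ugA).
  have wd : ae_on Om (fun x => w x = C x (dA (Uset R k d) a Om u x)).
    by apply: ae_on_filterS2 wg (dA_ae hP oOm Omfin ugA) => x _ -> ->.
  split=> //.
  + exact: (graphA0_H0A hP oOm Omfin ug).
  + exact: graphAs_HAs wf.
  (* A^* C A u = f is A^* w = f with w replaced, under the integral, by C A u, to which it is equal
     almost everywhere. *)
  + move=> psi tpsi; have [_ _ ->//] := wf.
    apply: (ipU_ae mOm wL (applyC_L2U hP mOm hC dL) _ wd).
    exact: (A_test_L2U hP ha mOm tpsi).
Qed.
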